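(* There is an algorithm that, given a forest $T$ on $n$ vertices, decides in $O(n^2)$ time whether $T$ is an iso-unique zero forcing graph.
   Context: Zero forcing: in a graph $G$, starting with an initial set $S\subseteq V(G)$ of active vertices, repeatedly apply the rule: if an active vertex $u$ has exactly one non-active neighbor $v$, then $v$ becomes active. $S$ is a zero forcing set if eventually all vertices become active; a minimum zero forcing set is one of minimum size. A graph $G$ is an iso-unique zero forcing graph if for every two minimum zero forcing sets $A,B$ of $G$ there is an automorphism $\phi$ of $G$ with $\phi(A)=B$. *)

(* Defs.v *)
From mathcomp Require Import all_boot fingroup perm.
Set Implicit Arguments. Unset Strict Implicit. Unset Printing Implicit Defensive.

Definition simple_graph (n : nat) (e : rel 'I_n) : Prop :=
  symmetric e /\ irreflexive e.

Definition forest (n : nat) (e : rel 'I_n) : Prop :=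
  simple_graph e /\
  forall s : seq 'I_n, uniq s -> 3 <= size s -> ~~ path.cycle e s.

Inductive zf_reach (n : nat) (e : rel 'I_n) (S : {set 'I_n}) :
  {set 'I_n} -> Prop :=
| zf_init : zf_reach e S S
| zf_step (A : {set 'I_n}) (u v : 'I_n) :
    zf_reach e S A -> u \in A -> v \notin A -> e u v ->
    (forall w, e u w -> w \notin A -> w = v) ->
    zf_reach e S (v |: A).

Definition zero_forcing_set (n : nat) (e : rel 'I_n) (S : {set 'I_n}) : Prop :=
  zf_reach e S [set: 'I_n].

Definition min_zero_forcing_set (n : nat) (e : rel 'I_n) (S : {set 'I_n}) :=
  zero_forcing_set e S /\
  forall S' : {set 'I_n}, zero_forcing_set e S' -> #|S| <= #|S'|.

Definition automorphism (n : nat) (e : rel 'I_n) (phi : {perm 'I_n}) : Prop :=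
  forall x y, e (phi x) (phi y) = e x y.

Definition iso_unique_zf (n : nat) (e : rel 'I_n) : Prop :=
  forall A B : {set 'I_n},
    min_zero_forcing_set e A -> min_zero_forcing_set e B ->
    exists phi : {perm 'I_n}, automorphism e phi /\ phi @: A = B.

Inductive instr : Type :=
| IConst (r k : nat)
| IAdd (r a b : nat)
| ISub (r a b : nat)
| ILoad (r a : nat)
| IStore (a r : nat)
| IJz (r l : nat)
| IJmp (l : nat)
| IHalt.

Definition program := seq instr.
Definition memory := nat -> nat.
Definition config := (nat * memory)%type.

Definition upd (m : memory) (a v : nat) : memory :=
  fun x => if x == a then v else m x.

Definition fetch (P : program) (pc : nat) : instr := nth IHalt P pc.

Definition step (P : program) (c : config) : config :=
  let: (pc, m) := c in
  match fetch P pc with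
  | IConst r k => (pc.+1, upd m r k)
  | IAdd r a b => (pc.+1, upd m r (m a + m b))
  | ISub r a b => (pc.+1, upd m r (m a - m b))
  | ILoad r a => (pc.+1, upd m r (m (m a)))
  | IStore a r => (pc.+1, upd m (m a) (m r))
  | IJz r l => if m r == 0 then (l, m) else (pc.+1, m)
  | IJmp l => (l, m)
  | IHalt => (pc, m)
  end.

Definition halted (P : program) (c : config) : bool :=
  if fetch P c.1 is IHalt then true else false.

Definition run (P : program) (k : nat) (c : config) : config := iter k (step P) c.

(* Input encoding of a graph on 'I_n: M[0] = n, the adjacency matrix is stored
   row by row in cells 1 .. n*n (M[1 + i*n + j] = 1 iff ij is an edge), and all
   other cells are 0. *)
Definition encodes (n : nat) (e : rel 'I_n) (m : memory) : Prop :=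
  m 0 = n /\
  (forall i j : 'I_n, m (1 + i * n + j) = (e i j : nat)) /\
  (forall a, n * n < a -> m a = 0).

(* Main.v *)
(* Read a zero forcing set of a forest as the set of first vertices of a cover by
   oriented paths: every such cover arises, because a walk through a stuck
   colouring that never backtracks would contain a cycle.

   In an iso-unique forest, replacing one end of a path of a minimum cover by the
   other end, or moving a starting vertex by rerouting two paths, cannot change
   the number of starting vertices in any orbit.  This forces all paths to end in
   leaves; apart from the paths leaf-centre-leaf and the remaining leaves at such
   centres, the paths are then determined, and the two ends of each lie in one
   orbit.  Conversely, let a forest have such paths.  They are the same in all
   minimum covers by a count of degrees.  An automorphism exchanging the ends of a
   path can be cut down to one that exchanges the parts of the forest hanging from
   the two halves of the path, and it affects the choice of ends only on paths
   that are further from the centre, so that any choice can be turned into any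
   other starting from the centre.

   On a forest the orbits are found by [n] rounds of colour refinement, each of
   them linear in [n] since colour classes can be renamed by looking up the sum of
   the colours of the neighbours in a table.  The paths are found by repeatedly
   removing an edge at a vertex of degree 1: whether it lies on a path is
   determined by the edges removed before. *)
Require Import Defs.
From mathcomp Require Import all_boot fingroup perm.
From mathcomp Require Import zify.
From Stdlib Require Import Classical_Prop.
Set Implicit Arguments. Unset Strict Implicit. Unset Printing Implicit Defensive.

(** * Forests and zero forcing *)

Section Forest.
Variables (n : nat) (e : rel 'I_n).
Hypothesis fe : forest e.
Local Notation V := 'I_n.

(** The two directions meet in [balanced_factor], a certificate that mentions neither covers nor
    automorphisms: a subgraph with degrees prescribed by [demand], and a label that is constant
    along its edges and equals the colour at its leaves. Necessity only needs colours to be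
    invariant under automorphisms. Sufficiency needs an automorphism exchanging equally coloured
    ends of a path, and as these lie in one component, refinement has to decide orbits only inside
    components. The machine looks for the same certificate, whose edges are forced by the degrees,
    so that no search is involved.

    The quadratic bound rests on unit-cost arithmetic with unbounded words: a multiset of colours is
    one number in base [n.+1] and serves directly as an address. The other obstacle is the input
    layout. The matrix starts at cell 1, so for large [n] every cell that a given program names is
    occupied, and any write destroys data; only a conditional jump inspects an entry without
    writing, which is why the first entries are remembered in the program counter before any cell is
    reused. *)

Lemma forest_sym : symmetric e. Proof. by case: fe => -[]. Qed.
Lemma forest_irr : irreflexive e. Proof. by case: fe => -[]. Qed.

Lemma forest_neq x y : e x y -> x != y.
Proof. by apply: contraTneq => ->; rewrite forest_irr. Qed.

(* A longest path in [X] could be prolonged, since one of the two neighbours of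
   its end is not the next vertex and closes no cycle. *)
Lemma forest_low_degree (X : {set V}) (x0 : V) :
  x0 \in X ->
  (forall x, x \in X -> exists y z,
     [/\ y != z, y \in X, z \in X, e x y & e x z]) -> False.
Proof.
move=> x0X deg2.
have long k : exists x p, [/\ size p = k, uniq (x :: p), path e x p & x \in X].
  elim: k => [|k [x [p [sp up pp xX]]]]; first by exists x0, [::].
  have [y [z [yz yX zX exy exz]]] := deg2 x xX.
  have [w [wX exw wp]] : exists w, [/\ w \in X, e x w & w != head x p].
    have [yp|yp] := eqVneq y (head x p); last by exists y.
    by exists z; split=> //; rewrite -yp eq_sym.
  exists w, (x :: p); split=> //=; [by rewrite sp| |by rewrite forest_sym exw].
  move: (up) => /= ->; rewrite andbT.
  apply/negP; rewrite inE (negPf (_ : w != x)) /=; last first.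
    by rewrite eq_sym forest_neq.
  move=> wip; case/splitPr: wip sp up pp wp => p1 p2 _ up pp wp.
  have nz : 0 < size p1 by case: p1 wp {up pp} => //=; rewrite eqxx.
  have /negP[] : ~~ path.cycle e (x :: rcons p1 w).
    apply: (proj2 fe); last by rewrite /= size_rcons.
    by move: up; rewrite -cat_rcons -cat_cons cat_uniq => /andP[].
  rewrite /= rcons_path last_rcons forest_sym exw andbT.
  by move: pp; rewrite -cat_rcons cat_path => /andP[].
have [x [p [sp up _ _]]] := long n.
by have := max_card (mem (x :: p)); rewrite (card_uniqP up) /= sp card_ord ltnn.
Qed.

(** Replacing [X] by its image until nothing changes makes [h] a permutation of [X]; then [h x] and
    the preimage of [x] are two neighbours of [x] in [X], distinct because [h] never steps back. *)
Lemma forest_acyclic_fun (h : V -> V) (X : {set V}) (x0 : V) :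
  x0 \in X -> (forall x, x \in X -> h x \in X) ->
  (forall x, x \in X -> e x (h x)) -> (forall x, x \in X -> h (h x) != x) ->
  False.
Proof.
have [k] := ubnP #|X|; elim: k X x0 => // k IH X x0 ltX x0X hX eh hh.
have sub : h @: X \subset X by apply/subsetP => _ /imsetP[x xX ->]; apply: hX.
have [eqX|neX] := eqVneq (h @: X) X; last first.
  have hXP y : y \in h @: X -> y \in X by move/(subsetP sub).
  apply: (IH (h @: X) (h x0)); rewrite ?imset_f //.
  - have: h @: X \proper X by rewrite properEneq neX.
    by move/proper_card/leq_trans; apply.
  - by move=> x /hXP xX; rewrite imset_f.
  - by move=> x /hXP /eh.
  - by move=> x /hXP /hh.
apply: (forest_low_degree x0X) => x xX.
have /imsetP[y yX xy] : x \in h @: X by rewrite eqX.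
exists (h x), y; split=> //; [|exact: hX|exact: eh|].
  by rewrite xy; apply: hh.
by rewrite forest_sym {1}xy eh.
Qed.

(* [p x] is the vertex preceding [x] on its path, and [p x = x] at the first
   vertex of a path: [p] encodes a cover of the forest by oriented paths. *)
Definition pcover (p : V -> V) : Prop :=
  [/\ forall x, p x != x -> e (p x) x,
      forall x y, p x != x -> p y != y -> p x = p y -> x = y &
      forall x, p (p x) = x -> p x = x].

Definition starts (p : V -> V) : {set V} := [set x | p x == x].

(** Here [p x] is the vertex that forced [x]. The last clause of the invariant, that a vertex which
    has forced is active and has no white neighbour left, makes [p] injective outside its fixed
    points and prevents two vertices from forcing each other. *)
Lemma zf_reach_pcover (S A : {set V}) : zf_reach e S A ->
  exists p, [/\ pcover p, S \subset A, forall x, x \notin A -> p x = x,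
    forall x, x \in A -> (p x == x) = (x \in S) &
    forall x, p x != x -> p x \in A /\ forall w, e (p x) w -> w \in A].
Proof.
elim=> [|{}A u v _ [p [[pe pinj pp] SA pA pS pact]] uA vA euv uni].
  exists id; split=> //.
  - by split=> [x|x y|x] //=; rewrite eqxx.
  - by move=> x ->; rewrite eqxx.
  - by move=> x; rewrite eqxx.
have uv : u != v by exact: forest_neq.
have npu y : p y != y -> p y != u.
  move=> py; apply: contraNneq vA => pyu.
  by have [_ /(_ v)] := pact y py; rewrite pyu; apply.
have npv y : y != v -> p y != v.
  move=> yv; have [->//|py] := eqVneq (p y) y.
  by apply: contraNneq vA => <-; have [] := pact y py.
exists (fun x => if x == v then u else p x); split.
- split.
  + by move=> x; case: ifP => [/eqP-> _|_ /pe].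
  + move=> x y; case: ifP => [/eqP->|xv]; case: ifP => [/eqP->|yv] // px py.
    * by move=> E; case/eqP: (npu y py).
    * by move=> E; case/eqP: (npu x px).
    * exact: pinj.
  + move=> x; case: (eqVneq x v) => [->|xv].
      rewrite (negPf uv) => E; case/negP: vA.
      by have [pu|/pact[]] := eqVneq (p u) u; [rewrite -E pu|rewrite E].
    by rewrite (negPf (npv x xv)) => /pp.
- by apply: subset_trans SA _; apply/subsetP => x xA; rewrite !inE xA orbT.
- by move=> x; rewrite !inE negb_or => /andP[/negPf-> /pA].
- move=> x; rewrite !inE; case: (eqVneq x v) => [->|xv] /=.
    by move=> _; rewrite (negPf uv); apply/esym/negbTE; apply: contra vA => /(subsetP SA).
  exact: pS.
- move=> x; case: ifP => [_ _|xv /pact[pxA H]].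
    split; first by rewrite !inE uA orbT.
    by move=> w euw; rewrite !inE; case: (boolP (w \in A)); rewrite ?orbT // => wA; rewrite (uni w) ?eqxx.
  by split=> [|w /H]; rewrite !inE ?pxA ?orbT // => ->; rewrite orbT.
Qed.

(* If forcing gets stuck at [A], walking from a white vertex to its predecessor
   and from a black predecessor to another white neighbour never backtracks. *)
Lemma pcover_zf_reach (p : V -> V) (A : {set V}) :
  pcover p -> starts p \subset A -> zf_reach e (starts p) A ->
  zero_forcing_set e (starts p).
Proof.
move=> [pe pinj pp]; have [k] := ubnP #|~: A|; elim: k A => // k IH A ltA SA rA.
have [x0 x0A|Afull] := pickP (mem (~: A)); last first.
  by rewrite /zero_forcing_set (_ : setT = A) //; apply/setP=> x; move: (Afull x); rewrite !inE; case: (x \in A).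
have [/existsP[u /existsP[v /and4P[uA vA euv /forallP uni]]]|] :=
  boolP [exists u, exists v, [&& u \in A, v \notin A, e u v &
    [forall w, (e u w && (w \notin A)) ==> (w == v)]]].
  apply: (IH (v |: A)).
  - rewrite -ltnS; apply: leq_trans ltA; rewrite ltnS; apply: proper_card.
    rewrite properE; apply/andP; split.
      by apply/subsetP=> x; rewrite !inE negb_or => /andP[].
    by apply/subsetPn; exists v; rewrite !inE ?eqxx.
  - by apply: subset_trans SA (subsetU1 _ _).
  - apply: zf_step rA uA vA euv _ => w euw wA.
    by apply/eqP; have := uni w; rewrite euw wA.
rewrite negb_exists => /forallP stuck; exfalso.
have npx x : x \notin A -> p x != x.
  by apply: contra => px; apply: (subsetP SA); rewrite inE.
pose g y := [pick w | [&& e y w, w \notin A & p w != y]].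
pose h x := if x \in A then odflt x (g x) else p x.
pose X := ~: A :|: p @: ~: A.
have gP y : y \in A -> y \in X -> [/\ e y (h y), h y \notin A & p (h y) != y].
  move=> yA; rewrite /h yA !inE yA /= => /imsetP[x]; rewrite inE => xA yx.
  rewrite /g; case: pickP => [w /and3P[]|nog] //=.
  move: (stuck y); rewrite negb_exists => /forallP/(_ x).
  have exy : e y x by rewrite yx; apply/pe/npx.
  rewrite yA xA exy /= negb_forall => /existsP[w].
  rewrite negb_imply => /andP[/andP[ew wA] wx].
  move: (nog w); rewrite ew wA /= yx => /negbFE/eqP/pinj wx'.
  by case/eqP: wx; apply: wx'; apply: npx.
have x0X : x0 \in X by rewrite inE; apply/orP; left.
have hX x : x \notin A -> h x = p x by rewrite /h => /negPf->.
apply: (@forest_acyclic_fun h X x0) => // x xX.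
- have [xA|xA] := boolP (x \in A); first by have [_ hA _] := gP x xA xX; rewrite !inE hA.
  by rewrite hX // inE imset_f ?orbT // inE.
- have [xA|xA] := boolP (x \in A); first by have [] := gP x xA xX.
  by rewrite hX // forest_sym pe ?npx.
- have [xA|xA] := boolP (x \in A).
    by have [_ hA hh] := gP x xA xX; rewrite (hX (h x)).
  rewrite (hX x) //; have [pA|pA] := boolP (p x \in A); last first.
    by rewrite hX //; apply: contra (npx x xA) => /eqP/pp->.
  have pX : p x \in X by rewrite inE imset_f ?orbT // inE.
  have [_ _] := gP _ pA pX; by apply: contra => /eqP->.
Qed.

Lemma zero_forcingP (S : {set V}) :
  zero_forcing_set e S <-> exists p, pcover p /\ S = starts p.
Proof.
split=> [/zf_reach_pcover[p [pc _ _ pS _]]|[p [pc ->]]].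
  by exists p; split=> //; apply/setP=> x; rewrite inE pS ?inE.
by apply: (pcover_zf_reach pc (subxx _)); apply: zf_init.
Qed.

Definition minp (p : V -> V) : Prop :=
  pcover p /\ forall q, pcover q -> #|starts p| <= #|starts q|.

Lemma min_zero_forcingP (S : {set V}) :
  min_zero_forcing_set e S <-> exists p, minp p /\ S = starts p.
Proof.
split=> [[/zero_forcingP[p [pc ->]] minS]|[p [[pc pmin] ->]]].
  by exists p; split=> //; split=> // q qc; apply: minS; apply/zero_forcingP; exists q.
split; first by apply/zero_forcingP; exists p.
by move=> S' /zero_forcingP[q [qc ->]]; apply: pmin.
Qed.

Lemma minp_exists : exists p, minp p.
Proof.
have idc : pcover id by split=> [x|x y|x] //=; rewrite eqxx.
suff H k : forall p, pcover p -> #|starts p| <= k -> exists q, minp q.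
  by apply: (H _ id idc (leqnn _)).
elim: k => [|k IH] p pc pk.
  by exists p; split=> // q _; apply: leq_trans pk _.
have [[q [qc qk]]|nq] := Classical_Prop.classic (exists q, pcover q /\ #|starts q| <= k).
  exact: IH qc qk.
exists p; split=> // q qc; apply: leq_trans pk _; rewrite ltnNge.
by apply/negP=> qk; apply: nq; exists q.
Qed.

End Forest.

(** * Paths of a cover: roots, reversal and prolongation *)

Section Cover.
Variables (n : nat) (e : rel 'I_n).
Hypothesis fe : forest e.
Local Notation V := 'I_n.

Lemma fconnect_fixed (p : V -> V) x z : fconnect p x z -> p x = x -> z = x.
Proof. by move=> /iter_findex <- px; elim: (findex _ _ _) => //= k ->. Qed.

Section Chains.
Variable p : V -> V.
Hypothesis pc : pcover e p.

Lemma pcover_edge x : p x != x -> e (p x) x. Proof. by case: pc => H _ _; apply: H. Qed.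
Lemma pcover_inj x y : p x != x -> p y != y -> p x = p y -> x = y.
Proof. by case: pc => _ H _; apply: H. Qed.
Lemma pcover_asym x : p (p x) = x -> p x = x. Proof. by case: pc => _ _ H; apply: H. Qed.

(** The definition of a cover excludes only cycles of length 2 of [p]; a longer one would be a cycle
    of the forest, so iterating [p] stops at a first vertex. *)
Lemma ex_root x : exists2 z, fconnect p x z & p z = z.
Proof.
have [/existsP[z /andP[xz /eqP pz]]|] := boolP [exists z, fconnect p x z && (p z == z)].
  by exists z.
rewrite negb_exists => /forallP nofix; exfalso.
have nf z : fconnect p x z -> p z != z by move=> xz; have := nofix z; rewrite xz.
apply: (@forest_acyclic_fun _ _ fe p [set z | fconnect p x z] x).
- by rewrite inE connect0.
- by move=> z; rewrite !inE => xz; apply: connect_trans xz (fconnect1 _ _).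
- by move=> z; rewrite inE (forest_sym fe) => /nf/pcover_edge.
- by move=> z; rewrite inE => /nf; apply: contra => /eqP/pcover_asym->.
Qed.

Definition root_of x : V := odflt x [pick z | fconnect p x z && (p z == z)].

Lemma root_ofP x : fconnect p x (root_of x) /\ p (root_of x) = root_of x.
Proof.
rewrite /root_of; case: pickP => [z /andP[xz /eqP]|no] //.
by have [z xz pz] := ex_root x; move: (no z); rewrite xz pz eqxx.
Qed.

Lemma root_of_uniq x z : fconnect p x z -> p z = z -> root_of x = z.
Proof.
move=> xz pz; have [xr pr] := root_ofP x.
have fix_iter w k : p w = w -> iter k p w = w by move=> pw; elim: k => //= k ->.
rewrite -(iter_findex xr) -(iter_findex xz).
set i := findex _ _ _; set j := findex _ _ _.
have Ei : p (iter i p x) = iter i p x by rewrite iter_findex.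
have Ej : p (iter j p x) = iter j p x by rewrite iter_findex.
move: i j Ei Ej => i j Ei Ej.
case: (leqP i j) => [/subnK E|/ltnW/subnK E].
  by rewrite -[in RHS]E iterD (fix_iter _ _ Ei).
by rewrite -[in LHS]E iterD (fix_iter _ _ Ej).
Qed.

Lemma root_of_fixed x : p x = x -> root_of x = x.
Proof. by move=> px; apply: root_of_uniq px; apply: connect0. Qed.

Lemma root_of_step x : root_of (p x) = root_of x.
Proof.
have [xr pr] := root_ofP (p x); symmetry; apply: root_of_uniq pr.
exact: connect_trans (fconnect1 _ _) xr.
Qed.

Lemma root_of_connect x y : fconnect p x y -> root_of y = root_of x.
Proof. by move/iter_findex <-; elim: (findex _ _ _) => //= k <-; rewrite root_of_step. Qed.

Lemma fconnect_anti x y : fconnect p x y -> fconnect p y x -> x = y.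
Proof.
move=> xy yx; have [->//|ney] := eqVneq x y.
have nf : forall k, fconnect p (iter k p x) x.
  elim=> [|k IH] /=; first exact: connect0.
  have [E|nE] := eqVneq (iter k p x) x; last first.
    move: IH => /connectP[[|z q] /= pth lst]; first by rewrite -lst eqxx in nE.
    case/andP: pth => /eqP-> pth; apply/connectP; by exists q.
  rewrite E; move: xy => /connectP[[|z q] /= pth lst]; first by rewrite lst eqxx in ney.
  case/andP: pth => /eqP-> pth; apply: connect_trans yx.
  by apply/connectP; exists q.
have [xr pr] := root_ofP x.
have rx : root_of x = x by apply/esym/(fconnect_fixed _ pr); rewrite -(iter_findex xr).
by rewrite rx in pr; rewrite (fconnect_fixed xy pr).
Qed.

Definition succ x : V := odflt x [pick y | (p y == x) && (y != x)].

Lemma succP x : succ x != x -> p (succ x) = x.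
Proof. by rewrite /succ; case: pickP => [y /andP[/eqP]|] //=; rewrite eqxx. Qed.

Lemma succ_eq x y : p y = x -> y != x -> succ x = y.
Proof.
move=> pyx yx; rewrite /succ; case: pickP => [z /andP[/eqP pz zx]|no] /=; last first.
  by move: (no y); rewrite pyx eqxx yx.
by apply: pcover_inj; rewrite ?pz ?pyx // eq_sym.
Qed.

Lemma succ_id x : succ x = x -> forall y, p y = x -> y = x.
Proof. by move=> sx y pyx; have [//|/(succ_eq pyx)] := eqVneq y x; rewrite sx => ->. Qed.

Definition ends : {set V} := [set x | succ x == x].

(** Such a [Q] is a union of whole paths, which may be reversed independently of all others. *)
Definition pclosed (Q : {set V}) := forall x, (p x \in Q) = (x \in Q).

Lemma pclosed_chain z : pclosed [set x | root_of x == z].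
Proof. by move=> x; rewrite !inE root_of_step. Qed.

Definition flip (Q : {set V}) x : V := if x \in Q then succ x else p x.

Lemma succ_closed Q x : pclosed Q -> (succ x \in Q) = (x \in Q).
Proof.
by move=> Qc; have [->//|/succP sx] := eqVneq (succ x) x; rewrite -Qc sx.
Qed.

Lemma pcover_flip Q : pclosed Q -> pcover e (flip Q).
Proof.
move=> Qc; rewrite /flip; split.
- move=> x; case: ifP => xQ; last exact: pcover_edge.
  by move=> sx; rewrite (forest_sym fe) -{1}(succP sx); apply: pcover_edge; rewrite succP // eq_sym.
- move=> x y; case: ifP => xQ; case: ifP => yQ.
  + by move=> sx sy E; rewrite -(succP sx) -(succP sy) E.
  + by move=> _ _ E; have := succ_closed x Qc; rewrite E Qc yQ xQ.
  + by move=> _ _ E; have := succ_closed y Qc; rewrite -E Qc yQ xQ.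
  + exact: pcover_inj.
- move=> x; case xQ: (x \in Q); last by rewrite Qc xQ => /pcover_asym.
  rewrite succ_closed // xQ => E; apply/eqP; apply: contraT => sx.
  have ssx : succ (succ x) != succ x by rewrite E eq_sym.
  have := succP sx; rewrite -{1}(succP ssx) E => /pcover_asym pxx.
  by have := succP ssx; rewrite E pxx => xs; rewrite -xs eqxx in sx.
Qed.

Lemma starts_flip Q : starts (flip Q) = (starts p :\: Q) :|: (ends :&: Q).
Proof. by apply/setP=> x; rewrite !inE /flip; case: (x \in Q); rewrite /= ?andbT ?andbF ?orbF. Qed.

(** [p] maps the vertices of [Q] that are not starts bijectively to those that are not ends. *)
Lemma card_ends Q : pclosed Q -> #|ends :&: Q| = #|starts p :&: Q|.
Proof.
move=> Qc.
suff: #|Q :\: starts p| = #|Q :\: ends|.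
  have := cardsID (starts p) Q; have := cardsID ends Q.
  by rewrite ![Q :&: _]setIC; lia.
have inj : {in Q :\: starts p &, injective p}.
  by move=> x y; rewrite !inE => /andP[px _] /andP[py _]; apply: pcover_inj.
rewrite -(card_in_imset inj); apply: eq_card => y; apply/imsetP/idP => [[x]|].
  rewrite !inE => /andP[px xQ] ->; rewrite Qc xQ andbT.
  by rewrite (succ_eq erefl) eq_sym.
rewrite !inE => /andP[sy yQ]; exists (succ y); last by rewrite succP.
by rewrite !inE succP // succ_closed // yQ eq_sym sy.
Qed.

Lemma card_starts_flip Q : pclosed Q -> #|starts (flip Q)| = #|starts p|.
Proof.
move=> Qc; rewrite starts_flip -(cardsID Q (starts p)) cardsU card_ends //.
rewrite (_ : _ :&: (_ :&: Q) = set0) ?cards0; first by lia.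
by apply/setP=> x; rewrite !inE; case: (x \in Q); rewrite ?andbF.
Qed.

Lemma end_uniq x y : succ x = x -> succ y = y -> root_of x = root_of y -> x = y.
Proof.
move=> sx sy E; have := card_ends (@pclosed_chain (root_of y)).
rewrite (_ : starts p :&: _ = [set root_of y]) ?cards1; last first.
  apply/setP=> z; rewrite !inE; apply/andP/eqP => [[/eqP/root_of_fixed -> /eqP] //|->].
  by have [_ pr] := root_ofP y; rewrite (root_of_fixed pr) {1}pr !eqxx.
move/eqP/cards1P=> [z Ez]; have: x \in [set z] /\ y \in [set z].
  by rewrite -Ez !inE E sx sy !eqxx.
by rewrite !inE => -[/eqP-> /eqP->].
Qed.

End Chains.

Lemma flip_minp p Q : minp e p -> pclosed p Q -> minp e (flip p Q).
Proof.
move=> [pc pmin] Qc; split; first exact: pcover_flip.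
by move=> q qc; rewrite card_starts_flip //; apply: pmin.
Qed.

(* Prolonging the path of [y] by the path starting at [x] cuts off what came
   after [y]; a minimum cover cannot afford to have nothing to cut off. *)
Definition prolong (p : V -> V) (x y : V) z : V :=
  if z == x then y else if p z == y then z else p z.

Lemma pcover_prolong p x y : pcover e p -> e x y -> p x = x -> p y != x -> pcover e (prolong p x y).
Proof.
move=> pc exy px pyx; have xy := forest_neq fe exy; rewrite /prolong; split.
- move=> z; case: (eqVneq z x) => [->|zx]; first by rewrite (forest_sym fe).
  by case: ifP => [_|_]; rewrite ?eqxx //; apply: pcover_edge.
- move=> z w; case: (eqVneq z x) => [->|zx]; case: (eqVneq w x) => [->|wx] //.
  + by case: (eqVneq (p w) y) => [_|pw] _ nw E; [rewrite eqxx in nw|rewrite -E eqxx in pw].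
  + by case: (eqVneq (p z) y) => [_|pz] nz _ E; [rewrite eqxx in nz|rewrite E eqxx in pz].
  + case: ifP => _; first by rewrite eqxx.
    case: ifP => _; first by rewrite eqxx.
    exact: pcover_inj pc _ _.
- move=> z; case: (eqVneq z x) => [->|zx].
    rewrite (negPf (_ : y != x)) 1?eq_sym //.
    by case: ifP => [_ E|_ E]; [rewrite E eqxx in xy|rewrite E eqxx in pyx].
  case: (eqVneq (p z) y) => [//|pzy]; case: (eqVneq (p z) x) => [pzx E|pzx].
    by move: pyx; rewrite E pzx eqxx.
  by case: ifP => // _ /(pcover_asym pc).
Qed.

(** The start [x] disappears, so minimality requires that a new one appears, namely the vertex that
    came after [y]. Besides reversal this is the second basic move: it exchanges a single start. *)
Lemma prolong_minp p x y : minp e p -> e x y -> p x = x -> p y != x ->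
  [/\ succ p y != y, succ p y != x, minp e (prolong p x y) &
      starts (prolong p x y) = succ p y |: (starts p :\ x)].
Proof.
move=> [pc pmin] exy px pyx; have pc' := pcover_prolong pc exy px pyx.
have xy := forest_neq fe exy.
have sy : succ p y != y.
  apply/eqP => sy; have := pmin _ pc'; rewrite leqNgt => /negP[]; apply: proper_card.
  apply/properP; split; last first.
    by exists x; rewrite !inE /prolong ?eqxx ?px // eq_sym.
  apply/subsetP=> z; rewrite !inE /prolong.
  case: (eqVneq z x) => [->|zx]; first by rewrite px eqxx.
  case: (eqVneq (p z) y) => [pz|//] _.
  by rewrite pz (succ_id pc sy pz).
have psy := succP sy.
have sx : succ p y != x by apply: contraNneq xy => E; move: psy; rewrite E px => ->.
have Es : starts (prolong p x y) = succ p y |: (starts p :\ x).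
  apply/setP=> z; rewrite !inE /prolong; case: (eqVneq z x) => [->|zx] /=.
    by rewrite orbF (eq_sym y) (negPf xy) eq_sym (negPf sx).
  case: (eqVneq (p z) y) => [pz|pz]; last first.
    by rewrite (_ : (z == _) = false) //; apply: contraNF pz => /eqP->; rewrite psy.
  rewrite eqxx; have [zy|zy] := eqVneq z y; first by rewrite pz -zy eqxx orbT.
  by rewrite (succ_eq pc pz zy) eqxx.
split=> //; split=> // q qc; apply: leq_trans (pmin q qc).
rewrite Es cardsU1 !inE psy sx /= eq_sym sy add1n.
by rewrite (cardsD1 x (starts p)) inE px eqxx.
Qed.

(** Reversing the path of [y] makes [y] an end, and prolonging it by the path of [x] would then save
    a start. *)
Lemma adjacent_starts p x y : minp e p -> p x = x -> p y = y -> e x y -> False.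
Proof.
move=> pm px py exy; have pc := proj1 pm.
pose Q := [set z | root_of p z == y]; have Qc : pclosed p Q := pclosed_chain pc y.
have xy := forest_neq fe exy.
have xQ : x \notin Q by rewrite inE (root_of_fixed pc).
have yQ : y \in Q by rewrite inE (root_of_fixed pc).
have fx : flip p Q x = x by rewrite /flip (negPf xQ).
have sx : succ p y != x.
  apply: contraNneq xQ => <-; by rewrite succ_closed.
have fyx : flip p Q y != x by rewrite /flip yQ.
have [sy _ _ _] := prolong_minp (flip_minp pm Qc) exy fx fyx.
have := succP sy; rewrite /flip; set z := succ _ y; case: ifP => zQ.
  move=> E; have zy : succ p z != z by rewrite E eq_sym.
  by have := succP zy; rewrite E py => yz; rewrite -/z -yz eqxx in sy.
by move=> pz; move: zQ; rewrite -Qc pz yQ.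
Qed.

End Cover.

(** * Minimum path covers of iso-unique forests *)

Section Structure.
Variables (n : nat) (e : rel 'I_n).
Local Notation V := 'I_n.

Lemma in_rel (r : rel V) v w : (w \in r v) = r v w. Proof. by []. Qed.

Definition deg v := #|e v|.
Definition star v := 2 <= #|[set w | e v w && (deg w == 1)]|.
Definition star_leaf v := (deg v == 1) && [exists w, e v w && star w].

(* The degree of [v] inside the paths of length at least 3 of a minimum path
   cover whose paths all end in leaves: the cover consists of these paths, of
   paths leaf-centre-leaf at the vertices with at least two leaves, and of
   single vertices. *)
Definition demand v :=
  if deg v == 1 then (~~ star_leaf v : nat)
  else if (deg v == 0) || star v then 0 else 2.

(** [F] stands for the edges of the paths other than those at stars. The label carries the colour of
    one end of a path to the other, so the last two clauses express that both ends have the same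
    colour in a form that can be checked edge by edge. *)
Definition balanced_factor (F : rel V) (lab c : V -> nat) : Prop :=
  [/\ symmetric F, subrel F e, forall v, #|F v| = demand v,
      forall u v, F u v -> lab u = lab v &
      forall v, demand v = 1 -> lab v = c v].

Lemma star_deg v : star v -> 2 <= deg v.
Proof.
move/leq_trans; apply; apply: subset_leq_card.
by apply/subsetP=> w; rewrite inE => /andP[].
Qed.

Lemma star_intro v x y : x != y -> e v x -> e v y -> deg x = 1 -> deg y = 1 -> star v.
Proof.
move=> xy vx vy dx dy; rewrite /star -(_ : #|[set x; y]| = 2); last by rewrite cards2 xy.
apply: subset_leq_card; apply/subsetP=> w; rewrite !inE.
by case/orP=> /eqP->; rewrite ?vx ?vy ?dx ?dy.
Qed.

Lemma star_leaf_nbr u v : symmetric e -> deg u = 1 -> e u v -> star_leaf u = star v.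
Proof.
move=> es du euv; rewrite /star_leaf du eqxx /=; apply/existsP/idP => [[w /andP[euw]]|sv].
  suff -> : w = v by [].
  have /card1P[z Ez] : #|e u| == 1 by rewrite -/(deg u) du.
  by move: (Ez v) (Ez w); rewrite !in_rel euv euw !inE => /esym/eqP-> /esym/eqP->.
by exists v; rewrite euv.
Qed.

Lemma deg1_nbr u v w : deg u = 1 -> e u v -> e u w -> v = w.
Proof.
move=> du uv uw; apply/eqP; apply: contraT => vw.
have : 2 <= deg u; last by rewrite du.
rewrite -(_ : #|[set v; w]| = 2); last by rewrite cards2 vw.
by apply: subset_leq_card; apply/subsetP=> z; rewrite !inE => /orP[] /eqP->.
Qed.

Lemma deg_gt0 v x : e v x -> 0 < deg v.
Proof. by move=> vx; apply/card_gt0P; exists x. Qed.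

Lemma demand_le v : demand v <= 2.
Proof. by rewrite /demand; case: ifP => _; [case: (~~ _)|case: ifP]. Qed.

Lemma demand1 v : demand v = 1 <-> deg v = 1 /\ ~~ star_leaf v.
Proof.
rewrite /demand; case: ifP => [/eqP->|/eqP d]; last by case: ifP; split=> // -[].
by case: (star_leaf v); split=> // -[].
Qed.

Lemma demand2 v : demand v = 2 <-> 2 <= deg v /\ ~~ star v.
Proof.
rewrite /demand; case: ifP => [/eqP->|/eqP d1]; first by case: (star_leaf v); split=> // -[].
case: ifP; first by case/orP => [/eqP->|sv]; split=> // -[//]; rewrite sv.
by move/negbT; rewrite negb_or => /andP[/eqP d0 ->]; split=> // _; split=> //; lia.
Qed.

Lemma aut_deg (phi : {perm V}) v : automorphism e phi -> deg (phi v) = deg v.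
Proof.
move=> aut; rewrite /deg -(card_imset (e v) (@perm_inj _ phi)).
apply: eq_card => w; apply/idP/imsetP => [ew|[u eu ->]]; last by rewrite in_rel aut.
by exists (phi^-1%g w); rewrite ?permKV // in_rel -aut permKV.
Qed.

Definition path_rel (p : V -> V) : rel V := [rel x y | (x != y) && ((p x == y) || (p y == x))].

Lemma path_rel_sym p : symmetric (path_rel p).
Proof. by move=> x y; rewrite /path_rel /= [in LHS]eq_sym orbC. Qed.

Hypothesis fe : forest e.

Lemma path_rel_sub p : pcover e p -> subrel (path_rel p) e.
Proof.
move=> pc x y /= /andP[xy /orP[/eqP E|/eqP E]].
  by rewrite (forest_sym fe) -E; apply: (pcover_edge pc); rewrite E eq_sym.
by rewrite -E; apply: (pcover_edge pc); rewrite E.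
Qed.

Lemma path_rel_nbrs p v w : pcover e p ->
  path_rel p v w = [|| (w == p v) && (p v != v) | (w == succ p v) && (succ p v != v)].
Proof.
move=> pc; rewrite /path_rel /=; apply/idP/idP.
  case/andP=> vw /orP[/eqP E|/eqP E]; first by rewrite E eq_sym vw eqxx.
  by rewrite (succ_eq pc E) 1?eq_sym // eqxx [w == v]eq_sym vw orbT.
case/orP=> /andP[/eqP-> nv]; first by rewrite eq_sym nv eqxx.
by rewrite eq_sym nv succP // eqxx orbT.
Qed.

Lemma card_path_rel p v : pcover e p ->
  #|path_rel p v| = (p v != v) + (succ p v != v).
Proof.
move=> pc; rewrite (@eq_card _ _ (mem ([set w | (w == p v) && (p v != v)] :|:
    [set w | (w == succ p v) && (succ p v != v)]))); last first.
  by move=> w; rewrite !inE -(path_rel_nbrs v w pc).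
rewrite cardsU (_ : _ :&: _ = set0) ?cards0 ?subn0; last first.
  apply/setP=> w; rewrite !inE; apply/negbTE/negP => /andP[/andP[/eqP-> pv] /andP[/eqP E sv]].
  by have := succP sv; rewrite -E => /(pcover_asym pc) Ep; rewrite Ep eqxx in pv.
congr (_ + _); case: (boolP (_ != v)) => _ /=.
- by rewrite (@eq_card _ _ (pred1 (p v))) ?card1 // => w; rewrite !inE andbT.
- by rewrite (@eq_card _ _ pred0) ?card0 // => w; rewrite !inE andbF.
- by rewrite (@eq_card _ _ (pred1 (succ p v))) ?card1 // => w; rewrite !inE andbT.
- by rewrite (@eq_card _ _ pred0) ?card0 // => w; rewrite !inE andbF.
Qed.

Definition invariant (P : pred V) := forall phi, automorphism e phi -> forall x, P (phi x) = P x.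

Section Necessity.
Hypothesis iso : iso_unique_zf e.

Lemma iso_count p q P : minp e p -> minp e q -> invariant P ->
  #|[set x in starts p | P x]| = #|[set x in starts q | P x]|.
Proof.
move=> pm qm iP.
have [||phi [aut <-]] := iso (A := starts p) (B := starts q).
- by apply/(min_zero_forcingP fe); exists p.
- by apply/(min_zero_forcingP fe); exists q.
rewrite -(card_imset _ (@perm_inj _ phi)); apply: eq_card => x.
apply/imsetP/idP => [[y]|].
  by rewrite !inE => /andP[py Py] ->; rewrite imset_f ?inE //= iP.
rewrite inE => /andP[/imsetP[y py ->]]; rewrite iP // => Py.
by exists y; rewrite // inE py.
Qed.

(** Reversing the paths in [Q] replaces their starts by their ends and leaves all other starts in
    place. *)
Lemma iso_flip p Q P : minp e p -> pclosed p Q -> invariant P ->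
  #|[set x in starts p :&: Q | P x]| = #|[set x in ends p :&: Q | P x]|.
Proof.
move=> pm Qc iP; have := iso_count pm (flip_minp fe pm Qc) iP.
rewrite starts_flip.
rewrite -(cardsID Q [set x in starts p | P x]) -(cardsID Q [set x in _ :|: _ | P x]).
set a := #|_|; set b := #|_|; set c := #|_|; set d := #|_|.
have -> : b = d.
  apply: eq_card => x; rewrite !inE; case: (x \in Q) => //=.
  by rewrite andbF orbF.
move/addIn; rewrite /a /c => H; transitivity a; last (rewrite /a H).
  by apply: eq_card => x; rewrite !inE andbAC.
apply: eq_card => x; rewrite !inE; case: (x \in Q); rewrite ?andbF ?andbT //=.
Qed.

Lemma iso_prolong p x y P : minp e p -> e x y -> p x = x -> p y != x -> invariant P ->
  P (succ p y) = P x.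
Proof.
move=> pm exy px pyx iP; have [sy sx pm' Es] := prolong_minp fe pm exy px pyx.
have := iso_count pm pm' iP; rewrite Es.
set A := [set z in _ | _]; set B := [set z in _ | _].
have : A :\ x = B :\ succ p y.
  apply/setP=> z; rewrite !inE; case: (eqVneq z (succ p y)) => [->|zs] /=.
    by rewrite succP // [y == _]eq_sym (negPf sy) andbF.
  by rewrite andbA.
rewrite (cardsD1 x A) (cardsD1 (succ p y) B) => -> /addIn.
by rewrite !inE px !eqxx /=; case: (P x); case: (P _).
Qed.

Lemma inv_deg k : invariant (fun v => deg v <= k).
Proof. by move=> phi aut x; rewrite aut_deg. Qed.

(** By [iso_flip], both ends of a path have degree at least 2 or neither has. A path with two such
    ends could be appended to a path beginning with a vertex of degree at most 1, and the resulting
    minimum cover would violate this. *)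
Lemma starts_leaf p x : minp e p -> p x = x -> deg x <= 1.
Proof.
move=> pm; have pc := proj1 pm; move=> px; rewrite leqNgt; apply/negP => dx.
have other z : 2 <= deg z -> exists y, e z y && (p y != z).
  move/card_gt1P => [a [b []]]; rewrite !in_rel => za zb ab.
  have [pa|pa] := eqVneq (p a) z; last by exists a; rewrite za.
  exists b; rewrite zb; apply: contraNneq ab => pb.
  by apply/eqP; apply: (pcover_inj pc); rewrite ?pa ?pb //; apply: (forest_neq fe).
(* Otherwise one could walk forever without backtracking: back along a path to its start, from there
   to a neighbour that is not the next vertex, and so on, always on paths whose starts have degree
   at least 2. *)
have [x1 [y [px1 dx1 exy pyx dq]]] : exists x1 y, [/\ p x1 = x1, 2 <= deg x1,
    e x1 y, p y != x1 & deg (root_of p y) <= 1].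
  apply: NNPP => no.
  pose h z := if p z == z then odflt z [pick y | e z y && (p y != z)] else p z.
  have hP z : 2 <= deg z -> p z = z -> e z (h z) /\ p (h z) != z.
    move=> dz pz; rewrite /h pz eqxx; case: pickP => [y /andP[]|no'] //=.
    by have [y] := other z dz; rewrite no'.
  have hN z : p z != z -> h z = p z by rewrite /h => /negPf->.
  pose X := [set z | 2 <= deg (root_of p z)].
  apply: (@forest_acyclic_fun _ _ fe h X x).
  - by rewrite inE (root_of_fixed fe).
  - move=> z; rewrite !inE => dz; have [pz|pz] := eqVneq (p z) z; last first.
      by rewrite hN // (root_of_step fe pc).
    rewrite (root_of_fixed fe pc pz) in dz.
    rewrite ltnNge; apply/negP => dh; apply: no; exists z, (h z).
    by have [] := hP z dz pz.
  - move=> z; rewrite inE => dz; have [pz|pz] := eqVneq (p z) z; last first.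
      by rewrite hN // (forest_sym fe); apply: (pcover_edge pc).
    by rewrite (root_of_fixed fe pc pz) in dz; have [] := hP z dz pz.
  - move=> z; rewrite inE => dz; have [pz|pz] := eqVneq (p z) z; last first.
      rewrite (hN z) //; have [ppz|ppz] := eqVneq (p (p z)) (p z); last first.
        by rewrite hN //; apply: contra pz => /eqP/(pcover_asym pc)->.
      have dpz : 2 <= deg (p z).
        by rewrite -(root_of_fixed fe pc ppz) (root_of_step fe pc).
      by have [_] := hP _ dpz ppz; apply: contra => /eqP->.
    rewrite (root_of_fixed fe pc pz) in dz; have [ez phz] := hP z dz pz.
    (* If [h z] were a start as well, the walk could jump straight back to [z]. *)
    have [phh|phh] := eqVneq (p (h z)) (h z); last by rewrite hN.
    by case: (adjacent_starts fe pm pz phh ez).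
clear x px dx; rename x1 into x; rename px1 into px; rename dx1 into dx.
have [sy sx pm' Es] := prolong_minp fe pm exy px pyx.
have rx := root_of_fixed fe pc px.
have qx : root_of p y != x by apply: contraTneq dq => ->; rewrite -ltnNge.
pose Qx := [set z | root_of p z == x].
have Qxc : pclosed p Qx := pclosed_chain fe pc x.
have [b bQ db] : exists2 b, b \in ends p :&: Qx & 2 <= deg b.
  have := iso_flip pm Qxc (P := fun v => ~~ (deg v <= 1)) _.
  rewrite -[LHS]/(#|_|) => H.
  have: 0 < #|[set z in ends p :&: Qx | ~~ (deg z <= 1)]|.
    rewrite -H; last by move=> phi aut z; rewrite aut_deg.
    by apply/card_gt0P; exists x; rewrite !inE px rx !eqxx -ltnNge dx.
  by case/card_gt0P=> b; rewrite inE -ltnNge => /andP[]; exists b.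
pose p' := prolong p x y.
have p'x : p' x = y by rewrite /p' /prolong eqxx.
have p'y z : z != x -> p z = y -> p' z = z.
  by move=> zx pz; rewrite /p' /prolong (negPf zx) pz eqxx.
have p'N z : z != x -> p z != y -> p' z = p z.
  by move=> zx pz; rewrite /p' /prolong (negPf zx) (negPf pz).
(* This is the path of the new cover that runs from the root of [y] through [y] and [x] to [b]. *)
pose Q := Qx :|: [set z | fconnect p y z].
have ry z : fconnect p y z -> root_of p z = root_of p y by exact: (root_of_connect fe pc).
have step z : p z != y -> fconnect p y (p z) -> fconnect p y z.
  move=> pzy H; have := iter_findex H; move: (findex _ _ _) pzy {H} => k.
  elim: k => [|k IH] pzy /= E; first by rewrite E eqxx in pzy.
  have [pz|pz] := eqVneq (p z) z; first by rewrite -pz -E; apply: (fconnect_iter _ k.+1).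
  have [pw|pw] := eqVneq (p (iter k p y)) (iter k p y).
    by apply: IH => //; rewrite -pw.
  by rewrite -(pcover_inj pc pw pz E) fconnect_iter.
have Qc : pclosed p' Q.
  move=> z; rewrite !inE; have [->|zx] := eqVneq z x.
    by rewrite p'x rx eqxx connect0 orbT.
  have [pz|pz] := eqVneq (p z) y; first by rewrite p'y.
  rewrite p'N // (root_of_step fe pc) //; congr (_ || _); apply/idP/idP => [/(step z pz) //|yz].
  exact: connect_trans yz (fconnect1 _ _).
have := iso_flip pm' Qc (P := fun v => ~~ (deg v <= 1)) _.
rewrite [X in X = _]eq_card0 => [H|].
  have {}H := H (fun phi aut z => congr1 (fun d => ~~ (d <= 1)) (aut_deg z aut)).
  have/esym/card0_eq/(_ b) := H.
  rewrite !inE -ltnNge db andbT; case/andP.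
  move: bQ; rewrite !inE => /andP[/eqP sb /eqP rb]; rewrite rb eqxx; split=> //.
  apply: contraT => s'b; have := succP s'b; set z := succ _ b => E.
  move: E; rewrite -/p'; have [->|zx] := eqVneq z x.
    by rewrite p'x => yb; rewrite yb rb eqxx in qx.
  have [pz|pz] := eqVneq (p z) y; first by rewrite p'y // => zb; rewrite -/z zb eqxx in s'b.
  by rewrite p'N // => /(succ_id pc sb) zb; rewrite -/z zb eqxx in s'b.
move=> z; rewrite !inE -ltnNge; apply/negbTE/negP => /andP[/andP[]].
rewrite -/p' => /eqP pz.
have zx : z != x by apply: contraTneq exy => E; rewrite -[y]p'x -E pz E (forest_irr fe).
have [pzy|pzy] := eqVneq (p z) y => H dz.
  case/orP: H => [/eqP rz|yz].
    by rewrite -rz -(root_of_step fe pc z) pzy eqxx in qx.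
  have zy : z = y by apply: (fconnect_anti fe pc) => //; rewrite -pzy fconnect1.
  by rewrite zy in pzy dz; rewrite (root_of_fixed fe pc pzy) leqNgt dz in dq.
rewrite p'N // in pz; case/orP: H => [|/ry E].
  by rewrite (root_of_fixed fe pc pz) (negPf zx).
by rewrite -E (root_of_fixed fe pc pz) leqNgt dz in dq.
Qed.

Lemma pclosed_setT p : pclosed p [set: V]. Proof. by move=> x; rewrite !inE. Qed.

Lemma ends_leaf p x : minp e p -> succ p x = x -> deg x <= 1.
Proof.
move=> pm sx; apply: (starts_leaf (flip_minp fe pm (@pclosed_setT p))).
by rewrite /flip inE.
Qed.

Lemma succ_flip p x : pcover e p -> succ (flip p [set: V]) x = p x.
Proof.
move=> pc; have pc' := pcover_flip fe pc (@pclosed_setT p).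
have [px|px] := eqVneq (p x) x; last first.
  by apply: (succ_eq pc') => //; rewrite /flip inE; apply: (succ_eq pc); rewrite // eq_sym.
rewrite px; apply/eqP; apply: contraT => sx; have := succP sx.
rewrite /flip inE => sz; have zs : succ p (succ (flip p [set: V]) x) != succ (flip p [set: V]) x.
  by rewrite sz eq_sym.
by have := succP zs; rewrite sz px => E; rewrite -E eqxx in sx.
Qed.

(* An unused leaf edge [v x] lets both neighbours of [v] on its path become
   starts, hence leaves. *)
Lemma unused_leaf p x v w : minp e p -> e x v -> p x = x -> succ p x = x ->
  path_rel p v w -> deg w <= 1.
Proof.
move=> pm exv px sx; have pc := proj1 pm; rewrite path_rel_nbrs //.
have xv := forest_neq fe exv.
have pvx : p v != x by apply: contraNneq xv => /(succ_id pc sx)->.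
have svx : succ p v != x.
  apply: contraNneq (xv) => E; have sv : succ p v != v by rewrite E.
  by have := succP sv; rewrite E px => ->.
case/orP=> /andP[/eqP-> _].
  have pm' := flip_minp fe pm (@pclosed_setT p).
  have := iso_prolong (p := flip p [set: V]) pm' exv _ _ (@inv_deg 1).
  rewrite succ_flip // /flip !inE => -> //; exact: starts_leaf pm px.
by have := iso_prolong pm exv px pvx (@inv_deg 1) => ->; apply: starts_leaf pm px.
Qed.

(** Either some leaf at [v] is off the path of [v], and [unused_leaf] applies, or the leaves at [v],
    at least two, fill the at most two places next to [v] on its path. *)
Lemma star_paths p v w : minp e p -> star v -> path_rel p v w -> deg w = 1.
Proof.
move=> pm sv vw; have pc := proj1 pm; have evw := path_rel_sub pc vw.
have dw : 0 < deg w by apply: (@deg_gt0 _ v); rewrite (forest_sym fe).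
suff : deg w <= 1 by lia.
have [/existsP[x /and3P[exv dx nvx]]|] := boolP [exists x, [&& e x v, deg x == 1 & ~~ path_rel p v x]].
  have nx y : ~~ path_rel p x y.
    apply/negP => xy; have := deg1_nbr (eqP dx) exv (path_rel_sub pc xy) => E.
    by rewrite path_rel_sym -E in xy; rewrite xy in nvx.
  have px : p x = x.
    by apply/eqP; apply: contraNT (nx (p x)) => px; rewrite path_rel_nbrs // eqxx px.
  have sx : succ p x = x.
    by apply/eqP; apply: contraNT (nx (succ p x)) => sx; rewrite path_rel_nbrs // eqxx sx orbT.
  exact: unused_leaf pm exv px sx vw.
rewrite negb_exists => /forallP all.
have sub : [set x | e v x & deg x == 1] \subset path_rel p v.
  apply/subsetP=> x; rewrite inE => /andP[vx dx]; have := all x.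
  by rewrite (forest_sym fe) vx dx /= negbK.
have cp : #|path_rel p v| <= 2 by rewrite card_path_rel //; do 2!case: (_ != _).
have := subset_cardP _ sub; have/eqP: #|[set x | e v x & deg x == 1]| = #|path_rel p v|.
  apply/eqP; rewrite eqn_leq (subset_leq_card sub) /=; exact: leq_trans cp sv.
move/eqP=> -> /(_ erefl) /(_ w); rewrite !inE => H.
by have: path_rel p v w := vw; rewrite -[path_rel p v w]H => /andP[_ /eqP->].
Qed.

(** Any minimum cover will do: its edges between vertices of positive demand form the factor, and
    every path is labelled by the colour of its start. *)
Lemma iso_balanced_factor (c : V -> nat) :
  (forall k, invariant (fun v => c v == k)) ->
  exists F lab, balanced_factor F lab c.
Proof.
move=> ic; have [p pm] := minp_exists e; have pc := proj1 pm.
have es := forest_sym fe.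
pose F u v := [&& path_rel p u v, demand u != 0 & demand v != 0].
have dge1 u v : e u v -> 0 < deg v by rewrite es => /deg_gt0.
have Fdeg v : demand v != 0 -> #|path_rel p v| = demand v.
  move: (demand_le v); case E: (demand v) => [|[|[|d]]] //= _ _; rewrite card_path_rel //.
    have [d1 nsl] := (demand1 v).1 E.
    have le1 : #|path_rel p v| <= 1.
      by rewrite -d1; apply: subset_leq_card; apply/subsetP=> w; apply: (path_rel_sub pc).
    rewrite card_path_rel // in le1; apply/eqP; rewrite eqn_leq le1 /= lt0n addn_eq0 !eqb0 !negbK.
    (* If the leaf [v] were a path by itself, the vertex after its neighbour [y] would be a leaf
       too, and [y] would be a star. *)
    apply/negP => /andP[/eqP pv /eqP sv].
    have/card_gt0P[y] : 0 < deg v by rewrite d1.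
    rewrite in_rel => evy; case/negP: nsl; rewrite (star_leaf_nbr es d1 evy).
    have vy := forest_neq fe evy.
    have pyv : p y != v by apply: contraNneq vy => /(succ_id pc sv)->.
    have [sy svn _ _] := prolong_minp fe pm evy pv pyv.
    have rs : path_rel p y (succ p y) by rewrite path_rel_nbrs // eqxx sy orbT.
    have eys := path_rel_sub pc rs.
    apply: (@star_intro _ v (succ p y)) => //; rewrite ?(es y v) 1?eq_sym //.
    by have := unused_leaf pm evy pv sv rs; have := dge1 _ _ eys; lia.
  have [d2 _] := (demand2 v).1 E.
  have -> : p v != v by apply/eqP => /(starts_leaf pm); lia.
  by have -> : succ p v != v by apply/eqP => /(ends_leaf pm); lia.
have core v w : demand v != 0 -> path_rel p v w -> demand w != 0.
  move=> dv vw; have evw := path_rel_sub pc vw; have ewv : e w v by rewrite es.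
  have nstar : star w -> False.
    move=> sw; have d1 : deg v = 1 by apply: (star_paths pm sw); rewrite path_rel_sym.
    by move: dv; rewrite /demand d1 eqxx (star_leaf_nbr es d1 evw) sw.
  have := dge1 _ _ evw; rewrite /demand; case: ifP => [/eqP d1 _|/eqP d1 d0].
    rewrite (star_leaf_nbr es d1 ewv); case: (boolP (star v)) => // sv.
    have dd := star_deg sv; move: dv; rewrite /demand sv orbT.
    by rewrite (gtn_eqF dd).
  by case: ifP => // /orP[/eqP|/nstar //]; lia.
exists F, (fun v => c (root_of p v)); split.
- by move=> u v; rewrite /F path_rel_sym; congr andb; rewrite andbC.
- by move=> u v /and3P[/(path_rel_sub pc)].
- move=> v; have [dv|dv] := eqVneq (demand v) 0.
    by rewrite dv; apply: eq_card0 => w; rewrite in_rel /F dv /= andbF.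
  rewrite -(Fdeg v dv); apply: eq_card => w; rewrite !in_rel /F dv.
  by case H: (path_rel p v w); rewrite //= (core v w).
- move=> u v /and3P[]; rewrite path_rel_nbrs // => /orP[] /andP[/eqP-> nv] _ _.
    by rewrite (root_of_step fe pc).
  by rewrite -{1}(succP nv) (root_of_step fe pc).
- move=> v dv; have [d1 _] := (demand1 v).1 dv.
  have [pv|pv] := eqVneq (p v) v; first by rewrite (root_of_fixed fe pc).
  have sv : succ p v = v.
    apply/eqP; apply: contraT => sv; have := Fdeg v; rewrite dv => /(_ isT).
    by rewrite card_path_rel // pv sv.
  (* On the single path of [v], the colour class of [v] contains as many starts as ends, and [v] is
     an end. *)
  have := iso_flip pm (pclosed_chain fe pc (root_of p v)) (ic (c v)) => H.
  have: 0 < #|[set x in ends p :&: [set z | root_of p z == root_of p v] | c x == c v]|.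
    by apply/card_gt0P; exists v; rewrite !inE sv !eqxx.
  rewrite -H => /card_gt0P[x]; rewrite !inE => /andP[/andP[/eqP px /eqP <-] /eqP <-].
  by rewrite (root_of_fixed fe pc px).
Qed.

End Necessity.
End Structure.

(** * Colour refinement and heights *)

Lemma card_fibers (T : finType) (f : T -> nat) (A : {set T}) M :
  (forall w, f w < M) -> #|A| = \sum_(k < M) #|[set w in A | f w == k]|.
Proof.
move=> bd; rewrite -sum1_card (partition_big (fun w => Ordinal (bd w)) predT) //=.
apply: eq_bigr => k _; rewrite sum1dep_card; apply: eq_card => w.
by rewrite !inE -val_eqE.
Qed.

Lemma connect_homo_map (T T' : finType) (r : rel T) (r' : rel T') (f : T -> T') x y :
  (forall u v, r u v -> r' (f u) (f v)) -> connect r x y -> connect r' (f x) (f y).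
Proof.
move=> hom /connectP[q]; elim: q x => [|z q IH] x /=; first by move=> _ ->; apply: connect0.
case/andP=> xz pth lst; apply: connect_trans (connect1 (hom _ _ xz)) _.
exact: IH pth lst.
Qed.

Section Refinement.
Variables (n : nat) (e : rel 'I_n).
Local Notation V := 'I_n.

(** The old colour of a vertex is not part of its new one; as the first colouring is constant, each
    round refines the previous one anyway ([color_mono]). Only equality of colours within a round
    matters, so an algorithm may rename them. *)
Definition color_refinement (col : nat -> V -> nat) : Prop :=
  (forall u v, col 0 u = col 0 v) /\
  forall t u v, t < n -> (col t.+1 u = col t.+1 v <->
    forall k, #|[set w | e u w & col t w == k]| = #|[set w | e v w & col t w == k]|).

Variable col : nat -> V -> nat.
Hypothesis cr : color_refinement col.

Lemma color_invariant t phi x : t <= n -> automorphism e phi -> col t (phi x) = col t x.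
Proof.
move=> tn aut; elim: t tn x => [|t IH] tn x; first exact: (proj1 cr).
apply/((proj2 cr) t _ _ tn) => k.
rewrite -[RHS](card_imset _ (@perm_inj _ phi)); apply: eq_card => w.
apply/idP/imsetP => [|[z]]; rewrite !inE.
  case/andP=> exw cw; exists (phi^-1%g w); last by rewrite permKV.
  by rewrite inE -aut permKV exw /= -(IH (ltnW tn)) permKV.
by case/andP=> exz cz ->; rewrite aut exz IH // ltnW.
Qed.

(** By induction every class of the later colouring lies in a class of the earlier one, so the
    number of neighbours in an earlier class is a sum of numbers for later classes. *)
Lemma color_mono t u v : t < n -> col t.+1 u = col t.+1 v -> col t u = col t v.
Proof.
elim: t u v => [|t IH] u v tn; first by move=> _; apply: (proj1 cr).
move/((proj2 cr) _ _ _ tn) => E; apply/((proj2 cr) _ _ _ (ltnW tn)) => k.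
pose M := (\max_w col t.+1 w).+1.
have bd w : col t.+1 w < M by rewrite ltnS leq_bigmax.
rewrite (card_fibers _ bd) [RHS](card_fibers _ bd); apply: eq_bigr => k' _.
have [/existsP[w0 /andP[/eqP w0k' /eqP w0k]]|no] :=
  boolP [exists w, (col t.+1 w == k') && (col t w == k)].
  have aux z : [set w in [set w | e z w & col t w == k] | col t.+1 w == k'] =
      [set w | e z w & col t.+1 w == k'].
    apply/setP=> w; rewrite !inE; case: (col t.+1 w =P k') => [E'|]; rewrite ?andbF // !andbT.
    by rewrite (IH w w0 (ltnW tn)) ?E' // w0k eqxx andbT.
  by rewrite !aux.
have aux z : [set w in [set w | e z w & col t w == k] | col t.+1 w == k'] = set0.
  apply/setP=> w; rewrite !inE; apply/negbTE; apply: contra no => /andP[/andP[_ ck] ck'].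
  by apply/existsP; exists w; rewrite ck ck'.
by rewrite !aux.
Qed.

Hypothesis fe : forest e.

Definition within (A : {set V}) : rel V := [rel x y | [&& x \in A, y \in A & e x y]].

(** Two neighbours in the connected set [A] would be joined by a path inside [A], which closes a
    cycle through [w]. *)
Lemma attach_uniq (A : {set V}) a w x y :
  (forall z, z \in A -> connect (within A) a z) ->
  w \notin A -> x \in A -> y \in A -> e w x -> e w y -> x = y.
Proof.
move=> con wA xA yA wx wy; apply/eqP; apply: contraT => xy.
have sA : connect_sym (within A).
  by apply: sym_connect_sym => u v; rewrite /within /= andbCA (forest_sym fe).
have/connectP[q0 pq0 lq0] : connect (within A) x y.
  by apply: connect_trans (con _ yA); rewrite sA con.
case/shortenP: pq0 lq0 => q pq uq _ lq.
have allA z : z \in x :: q -> z \in A.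
  have : path (within A) x q && (x \in A) by rewrite pq.
  elim: (q) (x) => [|u r IH] v /=; first by rewrite inE => vA /eqP->.
  case/andP=> /andP[/and3P[vA uA _] pr] _; rewrite inE => /orP[/eqP-> //|].
  by apply: IH; rewrite pr.
have/negP[] : ~~ path.cycle e (w :: x :: q).
  apply: (proj2 fe) => /=.
    rewrite -/(uniq (x :: q)) in uq *.
    by move: uq => /= ->; rewrite andbT; apply: contra wA => /allA.
  by case: (q) lq xy => [|? ?] //= ->; rewrite eqxx.
rewrite /= rcons_path wx -lq (forest_sym fe y) wy andbT /=.
by apply: sub_path pq => u v /and3P[].
Qed.

(** Each new vertex costs one round, since equal colours in a round only control the colours of the
    neighbours in the round before. This explains the index [n - #|A|], and why [n] rounds
    suffice. *)
Definition partial_iso (a b : V) (A : {set V}) (phi : V -> V) : Prop :=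
  [/\ a \in A, phi a = b, {in A &, injective phi},
      {in A &, forall x y, e (phi x) (phi y) = e x y} &
      (forall x, x \in A -> col (n - #|A|) (phi x) = col (n - #|A|) x) /\
      (forall x, x \in A -> connect (within A) a x)].

Definition edge_closed (A : {set V}) := forall x y, x \in A -> e x y -> y \in A.

Lemma partial_iso_image a b A phi : partial_iso a b A phi ->
  forall x, x \in phi @: A -> connect (within (phi @: A)) b x.
Proof.
case=> aA <- _ edg [_ con] _ /imsetP[x xA ->].
apply: (connect_homo_map _ (con x xA)) => u v /and3P[uA vA uv].
by rewrite /within /= !imset_f // edg.
Qed.

(** [v] and [phi v] have equally many neighbours of the colour of [z], and equally many of these are
    already matched; so if one side has an unmatched one, the other has one too. *)
Lemma partial_iso_extend a b A phi v z : partial_iso a b A phi -> v \in A ->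
  (e v z && (z \notin A)) || (e (phi v) z && (z \notin phi @: A)) ->
  exists w w', [/\ w \notin A, w' \notin phi @: A, e v w, e (phi v) w' &
    col (n - #|A|.+1) w' = col (n - #|A|.+1) w].
Proof.
move=> pi vA ex; have [aA phia inj edg [cA con]] := pi.
have ltA : #|A| < n.
  have leA : #|A| <= n by have := max_card (mem A); rewrite card_ord.
  rewrite ltn_neqAle leA andbT; apply/eqP => En.
  have fullA : A = setT by apply/eqP; rewrite eqEcard subsetT cardsT card_ord En leqnn.
  have fullB : phi @: A = setT.
    by apply/eqP; rewrite eqEcard subsetT cardsT card_ord card_in_imset // En leqnn.
  by move: ex; rewrite fullB fullA !inE !andbF.
have sE : n - #|A| = (n - #|A|.+1).+1 by rewrite -subSn.
set s := n - #|A|.+1 in sE *; have sn : s < n by rewrite /s; lia.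
have cA' x : x \in A -> col s (phi x) = col s x.
  by move=> xA; apply: color_mono sn _; rewrite -sE cA.
have cnt k : #|[set w | e v w & col s w == k] :\: A| =
    #|[set w | e (phi v) w & col s w == k] :\: phi @: A|.
  have E : #|[set w | e (phi v) w & col s w == k]| = #|[set w | e v w & col s w == k]|.
    by apply: ((proj2 cr) _ _ _ sn).1; rewrite -sE cA.
  have EA : #|[set w | e v w & col s w == k] :&: A| =
      #|[set w | e (phi v) w & col s w == k] :&: phi @: A|.
    have injI : {in [set w | e v w & col s w == k] :&: A &, injective phi}.
      by move=> x y /setIP[_ xA] /setIP[_ yA]; apply: inj.
    rewrite -(card_in_imset injI); apply: eq_card => w; apply/imsetP/setIP.
      by case=> x; rewrite !inE => /andP[/andP[ex' cx] xA] ->; rewrite edg // ex' cA' // cx imset_f.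
    case; rewrite inE => /andP[ew cw] /imsetP[x xA Ew]; rewrite Ew in ew cw.
    by exists x; rewrite // !inE xA -edg // ew -cA' // cw.
  by apply/eqP; rewrite -(eqn_add2l #|[set w | e v w & col s w == k] :&: A|) cardsID EA cardsID E.
pose k := col s z.
have [w wP] : exists w, w \in [set w | e v w & col s w == k] :\: A.
  apply/set0Pn; rewrite -card_gt0; case/orP: ex => /andP[ez zA]; last rewrite cnt;
  by rewrite card_gt0; apply/set0Pn; exists z; rewrite !inE zA ez /k eqxx.
have [w' wP'] : exists w, w \in [set w | e (phi v) w & col s w == k] :\: phi @: A.
  by apply/set0Pn; rewrite -card_gt0 -cnt card_gt0; apply/set0Pn; exists w.
exists w, w'; move: wP wP'; rewrite !inE => /and3P[wA vw /eqP cw] /and3P[wB vw' /eqP cw'].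
by split=> //; rewrite cw cw'.
Qed.

(** Any unmatched neighbours of equal colour may be paired: by [attach_uniq] a new vertex has only
    one edge to the matched part, so no further adjacency can be violated. *)
Lemma partial_iso_closed a b A phi : partial_iso a b A phi ->
  exists A' phi', [/\ partial_iso a b A' phi', edge_closed A' & edge_closed (phi' @: A')].
Proof.
have [k] := ubnP (n - #|A|); elim: k A phi => // k IH A phi ltk pi.
have [aA phia inj edg [cA con]] := pi.
have [/existsP[v /existsP[z /andP[vA ex]]]|no] := boolP [exists v, exists z,
  (v \in A) && ((e v z && (z \notin A)) || (e (phi v) z && (z \notin phi @: A)))]; last first.
  have {}no v z : v \in A -> (e v z && (z \notin A)) || (e (phi v) z && (z \notin phi @: A)) -> False.
    by move=> vA ex; case/negP: no; apply/existsP; exists v; apply/existsP; exists z; rewrite vA ex.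
  exists A, phi; split=> // [x y xA xy|x y /imsetP[v vA ->] xy]; apply: contraT => yN.
    by case: (no x y xA); rewrite xy yN.
  by case: (no v y vA); rewrite xy yN orbT.
have [w [w' [wA wB vw vw' cw]]] := partial_iso_extend pi vA ex.
have conB := partial_iso_image pi.
pose phi' x := if x == w then w' else phi x.
have phiA x : x \in A -> phi' x = phi x.
  by move=> xA; rewrite /phi' (negPf (_ : x != w)) //; apply: contraNneq wA => <-.
have phiw : phi' w = w' by rewrite /phi' eqxx.
have cardA : #|w |: A| = #|A|.+1 by rewrite cardsU1 wA.
have ltA : #|A| < n by have := max_card (mem (w |: A)); rewrite card_ord cardA.
have es := forest_sym fe.
have ew x : x \in A -> e x w = (x == v).
  move=> xA; apply/idP/eqP => [xw|->//].
  by apply: (attach_uniq con wA xA vA); rewrite es.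
have ew' x : x \in A -> e (phi x) w' = (x == v).
  move=> xA; apply/idP/eqP => [xw|->//]; apply: inj => //.
  by apply: (attach_uniq conB wB); rewrite ?imset_f // es.
apply: (IH (w |: A) phi'); first by rewrite cardA; lia.
split.
- by rewrite !inE aA orbT.
- by rewrite phiA.
- move=> x y; rewrite !inE => /orP[/eqP->|xA] /orP[/eqP->|yA] //; rewrite ?phiw !phiA //.
  + by move=> E; rewrite E imset_f in wB.
  + by move=> E; rewrite -E imset_f in wB.
  + exact: inj.
- move=> x y; rewrite !inE => /orP[/eqP->|xA] /orP[/eqP->|yA]; rewrite ?phiw ?phiA //.
  + by rewrite !(forest_irr fe).
  + by rewrite es ew' // es ew.
  + by rewrite ew' // ew.
  + exact: edg.
- split=> x; rewrite !inE ?cardA.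
    case/orP=> [/eqP->|xA]; first by rewrite phiw.
    rewrite phiA //; apply: color_mono; first by lia.
    by rewrite (_ : (_ - _).+1 = n - #|A|) ?cA // -subSn.
  have sub : subrel (connect (within A)) (connect (within (w |: A))).
    apply: connect_sub => u u' /and3P[uA uA' uu']; apply: connect1.
    by rewrite /within /= !inE uA uA' uu' !orbT.
  case/orP=> [/eqP->|xA]; last by apply: sub; apply: con.
  apply: (connect_trans (sub _ _ (con v vA))); apply: connect1.
  by rewrite /within /= !inE vA vw eqxx !orbT.
Qed.

Lemma edge_closed_connect A x y : edge_closed A -> x \in A -> connect e x y -> y \in A.
Proof.
move=> clA xA /connectP[q]; elim: q x xA => [|z q IH] x xA /=; first by move=> _ ->.
by case/andP=> /(clA _ _ xA); apply: IH.
Qed.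

(** A closed partial isomorphism matches the component of [a] with that of [b]. These coincide, so
    the identity extends it to the other components. *)
Lemma refinement_aut a b : col n a = col n b -> connect e a b ->
  exists phi : {perm V}, automorphism e phi /\ phi a = b.
Proof.
move=> cab ab.
have pi0 : partial_iso a b [set a] (fun=> b).
  split; rewrite ?inE //.
  - by move=> x y; rewrite !inE => /eqP-> /eqP->.
  - by move=> x y; rewrite !inE => /eqP-> /eqP->; rewrite !(forest_irr fe).
  - split=> x; rewrite inE => /eqP->; last exact: connect0.
    have n0 : 0 < n by apply: leq_ltn_trans (ltn_ord a).
    by rewrite cards1; apply: color_mono; rewrite subn1 prednK //; lia.
have [A [phi [[aA phia inj edg [_ con]] clA clB]]] := partial_iso_closed pi0.
have es := forest_sym fe; have cs : connect_sym e := sym_connect_sym es.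
have sub : subrel (connect (within A)) (connect e).
  by apply: connect_sub => u v /and3P[_ _ uv]; apply: connect1.
have bA : b \in A by apply: edge_closed_connect clA aA ab.
have bB : b \in phi @: A by rewrite -phia imset_f.
have BA : phi @: A = A.
  apply/setP=> x; apply/idP/idP => [/imsetP[y yA ->]|xA].
    apply: (edge_closed_connect clA bA).
    have := con y yA; rewrite -phia; set f := phi => cy.
    have : connect (within (f @: A)) (f a) (f y).
      apply: (connect_homo_map _ cy) => u v /and3P[uA vA uv].
      by rewrite /within /= !imset_f // edg.
    apply: connect_sub => u v /and3P[_ _ uv]; exact: connect1.
  apply: (edge_closed_connect clB bB).
  by rewrite cs in ab; apply: connect_trans ab _; apply: sub; apply: con.
have phiA x : x \in A -> phi x \in A by move=> xA; rewrite -BA imset_f.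
pose f x := if x \in A then phi x else x.
have finj : injective f.
  move=> x y; rewrite /f; case: ifP => xA; case: ifP => yA //.
  - exact: inj.
  - by move=> E; rewrite -E phiA in yA.
  - by move=> E; rewrite E phiA in xA.
exists (perm finj); split; last by rewrite permE /f aA.
move=> x y; rewrite !permE /f; case: ifP => xA; case: ifP => yA //.
- exact: edg.
- apply/idP/idP => H; last by rewrite (clA _ _ xA H) in yA.
  by rewrite (clA _ _ (phiA _ xA) H) in yA.
- apply/idP/idP => H; rewrite es in H; last by rewrite (clA _ _ yA H) in xA.
  by rewrite (clA _ _ (phiA _ yA) H) in xA.
Qed.

End Refinement.

(** * Heights, parents and the exchange of branches *)

Section Height.
Variables (n : nat) (e : rel 'I_n).
Hypothesis fe : forest e.
Local Notation V := 'I_n.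

(** A downward closed predicate holds exactly below the number of indices at which it holds; this
    identifies the layers with the sets of vertices above a given height. *)
Lemma sum_initial (p : pred nat) m k : (forall i, p i.+1 -> p i) -> k < m ->
  p k = (k < \sum_(i < m) p i).
Proof.
move=> dec; have down i j : i <= j -> p j -> p i.
  by move/subnK <-; elim: (j - i) => //= d IH /dec.
elim: m k => // m IH k; rewrite ltnS leq_eqVlt big_ord_recr /= => /orP[/eqP->|km].
  have full : (p m : bool) -> \sum_(i < m) p i = m.
    move=> pm; rewrite (eq_bigr (fun=> 1)) ?sum1_card ?card_ord // => i _.
    by rewrite (down i m) // ltnW.
  have le : \sum_(i < m) p i <= m.
    by rewrite -[m in _ <= m]card_ord -sum1_card; apply: leq_sum => i _; case: (p i).
  case pm: (p m); first by rewrite full // addn1 leqnn.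
  by rewrite addn0 ltnNge le.
rewrite IH //; case pm: (p m); last by rewrite addn0.
have -> : \sum_(i < m) p i = m.
  rewrite (eq_bigr (fun=> 1)) ?sum1_card ?card_ord // => i _.
  by rewrite (down i m) // ltnW.
by rewrite addn1 km ltnS ltnW.
Qed.

(* An invariant substitute for a root: a vertex has at most one neighbour that
   survives at least as long as itself when vertices of degree at most 1 are
   repeatedly removed. *)
Definition layer k : {set V} :=
  iter k (fun X : {set V} => [set v in X | 2 <= #|[set w in X | e v w]|]) setT.

Lemma layer_sub k v : v \in layer k.+1 -> v \in layer k.
Proof. by rewrite /= inE => /andP[]. Qed.

Lemma card_layer k : k <= n -> #|layer k| <= n - k.
Proof.
elim: k => [|k IH] kn; first by rewrite cardsT card_ord subn0.
have := IH (ltnW kn); have [->|/set0Pn[x0 x0X]] := eqVneq (layer k.+1) set0.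
  by rewrite cards0.
suff : #|layer k.+1| < #|layer k| by lia.
have sub : layer k.+1 \subset layer k by apply/subsetP => v; apply: layer_sub.
rewrite proper_card // properEneq sub andbT; apply/eqP => E.
apply: (@forest_low_degree _ _ fe (layer k.+1) x0 x0X) => x xX.
have := xX; rewrite {1}/layer iterS -/(layer k) inE -E => /andP[_ /card_gt1P[y [z []]]].
by rewrite !inE => /andP[yX xy] /andP[zX xz] yz; exists y, z; rewrite !inE.
Qed.

Lemma layer_aut phi k v : automorphism e phi -> (phi v \in layer k) = (v \in layer k).
Proof.
move=> aut; elim: k v => [|k IH] v; first by rewrite !inE.
rewrite /= !inE IH; congr (_ && (_ <= _)).
rewrite -[RHS](card_imset _ (@perm_inj _ phi)); apply: eq_card => w.
apply/idP/imsetP => [|[z]]; rewrite !inE.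
  case/andP=> wX ew; exists (phi^-1%g w); last by rewrite permKV.
  by rewrite inE -aut permKV ew andbT -IH permKV.
by case/andP=> zX ez ->; rewrite aut ez IH zX.
Qed.

Definition height v := \sum_(k < n) (v \in layer k).

Lemma height_aut phi v : automorphism e phi -> height (phi v) = height v.
Proof. by move=> aut; apply: eq_bigr => k _; rewrite layer_aut. Qed.

(** Two neighbours at least as high as [v] would let [v] survive one round more than its height
    allows. *)
Lemma height_up_uniq v w w' : e v w -> e v w' -> height v <= height w ->
  height v <= height w' -> w = w'.
Proof.
move=> vw vw' hw hw'; have n0 : 0 < n by apply: leq_ltn_trans (ltn_ord v).
have hP k u : k < n -> (u \in layer k) = (k < height u).
  by move=> kn; rewrite (@sum_initial (fun k => u \in layer k) n) // => i /layer_sub.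
have h0 : 0 < height v by rewrite -hP // inE.
have hn : height v <= n.
  by rewrite -[n in _ <= n]card_ord -sum1_card; apply: leq_sum => i _; case: (_ \in _).
have top : v \notin layer (height v).
  have [hlt|] := ltnP (height v) n; first by rewrite hP // ltnn.
  move=> nh; have -> : height v = n by lia.
  by have := card_layer (leqnn n); rewrite subnn leqn0 cards_eq0 => /eqP->; rewrite inE.
apply/eqP; apply: contraNT top => ww'.
case E: (height v) h0 hn hw hw' => [|t] // _ tn hw hw'.
rewrite /= inE hP // E leqnn /=; apply/card_gt1P; exists w, w'; split=> //.
  by rewrite !inE hP // hw vw.
by rewrite !inE hP // hw' vw'.
Qed.

(** An edge is charged to an endpoint that is not higher than the other one; by [height_up_uniq]
    each vertex is charged once. This bounds the length of the edge list and the number of peeling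
    rounds. *)
Lemma card_edges : #|[set uv : V * V | e uv.1 uv.2]| <= 2 * n.
Proof.
pose up v := odflt v [pick w | e v w && (height v <= height w)].
have upE u v : e u v -> height u <= height v -> up u = v.
  move=> uv h; rewrite /up; case: pickP => [w /andP[uw h']|/(_ v)] /=; last by rewrite uv h.
  exact: height_up_uniq h' h.
apply: (@leq_trans #|[set (u, up u) | u in V] :|: [set (up u, u) | u in V]|).
  apply: subset_leq_card; apply/subsetP=> -[u v]; rewrite inE /= => uv.
  rewrite inE; case: (leqP (height u) (height v)) => [h|/ltnW h]; apply/orP.
    by left; apply/imsetP; exists u; rewrite // (upE _ _ uv).
  by right; apply/imsetP; exists v; rewrite // (upE v u) // (forest_sym fe).
apply: leq_trans (leq_card_setU _ _) _; rewrite mul2n -addnn.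
by apply: leq_add; apply: leq_trans (leq_imset_card _ _) _; rewrite card_ord.
Qed.

(** The fixed points are the tops: a single centre of a component, or the two ends of a central
    edge. *)
Definition parent v := odflt v [pick w | e v w && (height v < height w)].

Lemma parentP v : parent v != v -> e v (parent v) /\ height v < height (parent v).
Proof. by rewrite /parent; case: pickP => [w /andP[]|] //=; rewrite eqxx. Qed.

Lemma parent_eq v w : e v w -> height v < height w -> parent v = w.
Proof.
move=> vw h; rewrite /parent; case: pickP => [z /andP[vz h']|/(_ w)] /=; last by rewrite vw h.
by apply: (height_up_uniq vz vw); apply: ltnW.
Qed.

Lemma parent_aut phi v : automorphism e phi -> parent (phi v) = phi (parent v).
Proof.
move=> aut; have [pv|/parentP[ev hv]] := eqVneq (parent v) v; last first.
  by apply: parent_eq; rewrite ?aut // !height_aut.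
rewrite pv; apply/eqP; apply: contraT => /parentP[ev hv].
have := pv; rewrite (@parent_eq v (phi^-1%g (parent (phi v)))).
- by move=> E; rewrite -[parent (phi v)](permKV phi) E ltnn in hv.
- by rewrite -aut permKV.
- by rewrite -(height_aut v aut) -(height_aut (phi^-1%g _) aut) permKV.
Qed.

Lemma parent_cases u v : e u v -> [\/ parent u = v, parent v = u |
  [/\ height u = height v, parent u = u & parent v = v]].
Proof.
move=> uv; have vu : e v u by rewrite (forest_sym fe).
case: (ltngtP (height u) (height v)) => h.
- by constructor 1; apply: parent_eq.
- by constructor 2; apply: parent_eq.
constructor 3; split=> //; apply/eqP; apply: contraT => /parentP[ep hp].
  by have E := height_up_uniq ep uv (ltnW hp) (eq_leq h); rewrite E h ltnn in hp.
by have E := height_up_uniq ep vu (ltnW hp) (eq_leq (esym h)); rewrite E h ltnn in hp.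
Qed.

Lemma height_fconnect u v : fconnect parent u v -> u = v \/ height u < height v.
Proof.
move/iter_findex <-; elim: (findex _ _ _) => [|k IH]; [by left|rewrite iterS].
have [->//|/parentP[_ h]] := eqVneq (parent (iter k parent u)) (iter k parent u).
by right; case: IH => [{1}->//|h']; apply: ltn_trans h' h.
Qed.

Definition below w : {set V} := [set x | fconnect parent x w].

Lemma below_height w x : x \in below w -> x = w \/ height x < height w.
Proof. by rewrite inE => /height_fconnect. Qed.

Lemma below_aut phi w x : automorphism e phi -> x \in below w -> phi x \in below (phi w).
Proof.
move=> aut; rewrite !inE; apply: connect_homo_map => u v /eqP <-.
by rewrite /= parent_aut.
Qed.

Lemma below_step w x : x \in below w -> x != w -> parent x \in below w.
Proof.
rewrite !inE => /connectP[[|z q] /= pth ->]; first by rewrite eqxx.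
by case/andP: pth => /eqP-> pth _; apply/connectP; exists q.
Qed.

(** Every edge joins a vertex to its parent or joins two tops, so only an edge at [w] can leave the
    branch hanging from [w]. *)
Lemma below_exit w x y : e x y -> x \in below w -> y \notin below w -> x = w /\ height w <= height y.
Proof.
move=> xy xw yw; case: (parent_cases xy) => [px|py|[h px _]].
- have xE : x = w by apply/eqP; apply: contraNT yw => /(below_step xw); rewrite px.
  have : parent w != w by apply: contraNneq yw; rewrite -px xE => ->; rewrite inE connect0.
  by rewrite -xE => /parentP[_]; rewrite px => /ltnW.
- by case/negP: yw; move: xw; rewrite !inE -py; apply: connect_trans (fconnect1 _ _).
- suff xE : x = w by rewrite -h xE.
  by move: xw; rewrite inE => xw; apply/esym/(fconnect_fixed xw px).
Qed.

Lemma below_disjoint w1 w2 x : height w1 = height w2 -> x \in below w1 -> x \in below w2 -> w1 = w2.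
Proof.
move=> h; rewrite !inE => /iter_findex E1 /iter_findex E2.
move: (findex _ _ _) (findex _ _ _) E1 E2 => j i E1 E2.
have le u v i' j' : iter i' parent x = u -> iter j' parent x = v -> i' <= j' ->
    height u = height v -> u = v.
  move=> Eu Ev /subnK ij huv.
  have : fconnect parent u v by rewrite -Ev -ij iterD Eu fconnect_iter.
  by case/height_fconnect => //; rewrite huv ltnn.
case: (leqP i j) => [|/ltnW] ij; first exact: le E1 E2 ij h.
by apply/esym; apply: le E2 E1 ij (esym h).
Qed.

(* [w1] and [w2] are siblings or the two ends of a central edge, so that at most
   one edge leaves [below w1], and it fits [below w2]. *)
Lemma exchange_below (psi : {perm V}) w1 w2 : automorphism e psi -> psi w1 = w2 -> w1 != w2 ->
  (parent w1 = parent w2 \/ e w1 w2) ->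
  exists chi : {perm V}, [/\ automorphism e chi,
    forall x, x \in below w1 -> chi x = psi x,
    forall x, x \in below w1 -> chi (psi x) = x &
    forall x, x \notin below w1 -> x \notin below w2 -> chi x = x].
Proof.
move=> aut psiw w12 sib; have es := forest_sym fe.
have hw : height w1 = height w2 by rewrite -psiw height_aut.
have disj x : x \in below w1 -> x \notin below w2.
  by move=> x1; apply: contra w12 => x2; apply/eqP/(below_disjoint hw x1 x2).
have psi1 x : x \in below w1 -> psi x \in below w2.
  by rewrite -psiw; apply: below_aut.
have aut' : automorphism e psi^-1%g by move=> x y; rewrite -aut !permKV.
have psi2 x : x \in below w2 -> psi^-1%g x \in below w1.
  by move/(below_aut aut'); rewrite -psiw permK.
pose f x := if x \in below w1 then psi x else if x \in below w2 then psi^-1%g x else x.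
have f1 x : x \in below w1 -> f x = psi x by rewrite /f => ->.
have f2 x : x \in below w2 -> f x = psi^-1%g x.
  by move=> x2; rewrite /f x2 ifN //; apply/negP => /disj; rewrite x2.
have f0 x : x \notin below w1 -> x \notin below w2 -> f x = x.
  by rewrite /f => /negPf-> /negPf->.
have ff x : f (f x) = x.
  have [x1|x1] := boolP (x \in below w1); first by rewrite (f1 x) // f2 ?psi1 // permK.
  have [x2|x2] := boolP (x \in below w2); first by rewrite (f2 x) // f1 ?psi2 // permKV.
  by rewrite !f0.
(* Such a neighbour can only be the common parent; the ends of a central edge have none. *)
have out y : y \notin below w1 -> y \notin below w2 -> e w1 y = e w2 y.
  move=> y1 y2.
  have aux u v : (parent u = parent v \/ e u v) -> height u = height v -> u != v ->
      y \notin below u -> y \notin below v -> e u y -> e v y.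
    move=> uv h nuv yu yv uy.
    have uu : u \in below u by rewrite inE connect0.
    have [_ hy] := below_exit uy uu yu.
    case: uv => [pp|uv]; last first.
      have E := height_up_uniq uy uv hy (eq_leq h).
      by rewrite E inE connect0 in yv.
    case: (parent_cases uy) => [pu|py|[_ pu _]].
    + have : parent v != v by rewrite -pp pu; apply: contraNneq yv => ->; rewrite inE connect0.
      by case/parentP; rewrite -pp pu.
    + by case/negP: yu; rewrite inE -py fconnect1.
    + have : parent v != v by rewrite -pp pu.
      by case/parentP => _; rewrite -pp pu h ltnn.
  apply/idP/idP; first by apply: aux.
  apply: aux; rewrite // 1?eq_sym //.
  by case: sib => [->|w]; [left|right; rewrite es].
have cross x y : x \in below w1 -> y \in below w2 -> e x y -> x = w1 /\ y = w2.
  move=> x1 y2 xy.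
  have [-> _] : x = w1 /\ height w1 <= height y.
    by apply: below_exit xy x1 _; apply/negP => /disj; rewrite y2.
  have [-> _] // : y = w2 /\ height w2 <= height x.
  by apply: below_exit y2 (disj _ x1); rewrite es.
have hom x y : e x y -> e (f x) (f y).
  move=> xy; have yx : e y x by rewrite es.
  have [x1|x1] := boolP (x \in below w1); have [y1|y1] := boolP (y \in below w1).
  - by rewrite !f1 // aut.
  - have [y2|y2] := boolP (y \in below w2).
      have [Ex Ey] := cross x y x1 y2 xy.
      by rewrite f1 // f2 // Ex Ey -psiw permK psiw es -Ex -Ey.
    rewrite f1 // f0 //; have [Ex _] := below_exit xy x1 y1.
    by rewrite Ex psiw -out // -Ex.
  - have [x2|x2] := boolP (x \in below w2).
      have [Ey Ex] := cross y x y1 x2 yx.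
      by rewrite f2 // f1 // Ex Ey -psiw permK psiw es -Ex -Ey.
    rewrite f0 // f1 //; have [Ey _] := below_exit yx y1 x1.
    by rewrite Ey psiw es -out // -Ey.
  - have [x2|x2] := boolP (x \in below w2); have [y2|y2] := boolP (y \in below w2).
    + by rewrite !f2 // aut'.
    + rewrite f2 // f0 //; have [Ex _] := below_exit xy x2 y2.
      by rewrite Ex -{1}psiw permK out // -Ex.
    + rewrite f0 // f2 //; have [Ey _] := below_exit yx y2 x2.
      by rewrite Ey -{1}psiw permK es out // -Ey.
    + by rewrite !f0.
exists (perm (can_inj ff)); split.
- move=> x y; rewrite !permE; apply/idP/idP; last exact: hom.
  by move/hom; rewrite !ff.
- by move=> x x1; rewrite permE f1.
- by move=> x x1; rewrite permE f2 ?psi1 // permK.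
- by move=> x x1 x2; rewrite permE f0.
Qed.

Lemma top_fixed x : let N := (\max_v height v).+1 in parent (iter N parent x) = iter N parent x.
Proof.
move=> N; have H k : parent (iter k parent x) = iter k parent x \/ k <= height (iter k parent x).
  elim: k => [|k [E|IH]]; [by right|by left; rewrite iterS !E|].
  have [E|/parentP[_ h]] := eqVneq (parent (iter k parent x)) (iter k parent x).
    by left; rewrite iterS !E.
  by right; rewrite iterS; apply: leq_ltn_trans IH h.
by case: (H N) => //; rewrite leqNgt ltnS leq_bigmax.
Qed.

(** Climbing from [x] and [b] in parallel, [psi] maps one vertex to the other at every step. The
    branches to be exchanged hang from the last two distinct vertices: these have the same parent,
    or they are two tops of one component and hence the ends of a central edge. *)
Lemma ex_exchange (psi : {perm V}) x b : automorphism e psi -> psi x = b -> x != b -> connect e x b ->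
  exists w1 w2 (chi : {perm V}),
    [/\ automorphism e chi, chi x = b, chi b = x, height w1 = height w2 &
     [/\ w1 != w2, x \in below w1, b \in below w2 &
         forall y, y \notin below w1 -> y \notin below w2 -> chi y = y]].
Proof.
move=> aut psix xb con.
have it k : psi (iter k parent x) = iter k parent b.
  by elim: k => //= k <-; rewrite parent_aut.
suff [k [w12 sib]] : exists k, iter k parent x != iter k parent b /\
    (parent (iter k parent x) = parent (iter k parent b) \/ e (iter k parent x) (iter k parent b)).
  have [chi [ca c1 c2 c0]] := exchange_below aut (it k) w12 sib.
  have x1 : x \in below (iter k parent x) by rewrite inE fconnect_iter.
  exists (iter k parent x), (iter k parent b), chi; split=> //.
  - by rewrite c1.
  - by rewrite -psix c2.
  - by rewrite -it height_aut.
  - by split=> //; rewrite inE fconnect_iter.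
have [N fixN] : exists N, forall y, parent (iter N parent y) = iter N parent y.
  by exists (\max_v height v).+1 => y; apply: top_fixed.
have [E|nE] := eqVneq (iter N parent x) (iter N parent b).
  have ex : exists k, iter k parent x == iter k parent b by exists N; rewrite E.
  case: (ex_minnP ex) => -[|k] /eqP Ek mink; first by rewrite /= in Ek; rewrite Ek eqxx in xb.
  exists k; split; last by left.
  by apply/negP => /mink; rewrite ltnn.
exists N; split=> //; right.
have tops u v : e u v -> iter N parent u = iter N parent v \/
    (e (iter N parent u) (iter N parent v) /\ height (iter N parent u) = height (iter N parent v)).
  have fixp w : parent w = w -> iter N parent w = w by move=> pw; elim: (N) => //= k ->.
  move=> uv; case: (parent_cases uv) => [<-|<-|[h pu pv]].
  - by left; rewrite -iterSr iterS fixN.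
  - by left; rewrite -iterSr iterS fixN.
  - by right; rewrite !fixp.
have : iter N parent x = iter N parent b \/
    (e (iter N parent x) (iter N parent b) /\ height (iter N parent x) = height (iter N parent b)).
  move: con => /connectP[q]; elim: q {psix xb it nE} x => [|y q IH] x /=; first by move=> _ ->; left.
  case/andP=> xy pth lst; have [E|[E h]] := IH y pth lst; have [E'|[E' h']] := tops x y xy.
  - by left; rewrite E' E.
  - by right; rewrite -E.
  - by right; rewrite E'.
  - left; apply: (@height_up_uniq (iter N parent y)) => //.
    + by rewrite (forest_sym fe).
    + by rewrite h'.
    + by rewrite h.
by case=> [E|[]//]; rewrite E eqxx in nE.
Qed.

End Height.

(** * Forests with a balanced factor *)

Lemma sum_eq_pointwise (T : finType) (a b : T -> nat) :
  (forall v, a v <= b v) -> \sum_v b v <= \sum_v a v -> forall v, a v = b v.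
Proof.
move=> ab; move=> le v; apply/eqP; rewrite eqn_leq ab /=.
move: le; rewrite (bigD1 v) //= [X in _ <= X](bigD1 v) //=.
have : \sum_(i | i != v) a i <= \sum_(i | i != v) b i by apply: leq_sum.
by lia.
Qed.

Section Sufficiency.
Variables (n : nat) (e : rel 'I_n).
Hypothesis fe : forest e.
Local Notation V := 'I_n.

Lemma prolong_end p a b z : pcover e p -> succ p b = b -> a != b ->
  prolong p a b z = if z == a then b else p z.
Proof.
move=> pc sb ab; rewrite /prolong; case: eqP => // _; case: eqP => // pz.
by rewrite pz (succ_id pc sb pz).
Qed.

Lemma path_rel_prolong p a b x y : pcover e p -> succ p b = b -> p a = a -> a != b ->
  path_rel (prolong p a b) x y =
  [|| path_rel p x y, (x == a) && (y == b) | (x == b) && (y == a)].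
Proof.
move=> pc sb pa ab; rewrite /path_rel /= !(prolong_end _ pc sb ab).
have pb z : z != b -> (p z == b) = false.
  by move=> zb; apply: contraNF zb => /eqP/(succ_id pc sb)->.
have [->|xa] := eqVneq x a; have [->|ya] := eqVneq y a.
- by rewrite /= (negPf ab).
- rewrite pa (eq_sym b y) (negPf ab) andbF orbF !(eq_sym a y) (negPf ya) /=.
  have [->|yb] := eqVneq y b; last by rewrite orbF.
  by rewrite orbT.
- rewrite pa andbT (eq_sym b x) !(eq_sym a x) (negPf xa) (negPf ab) andbF /= orbF.
  have [->|xb] := eqVneq x b; last by rewrite orbF.
  by rewrite /= ?xa !orbT.
- by rewrite !andbF !orbF.
Qed.

Lemma low_degree_vertex (X : {set V}) x0 : x0 \in X ->
  exists2 v, v \in X & forall y z, y \in X -> z \in X -> e v y -> e v z -> y = z.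
Proof.
move=> x0X; apply: NNPP => no; apply: (forest_low_degree fe x0X) => x xX.
apply: NNPP => no'; apply: no; exists x => // y z yX zX xy xz.
by apply/eqP; apply: contraT => yz; case: no'; exists y, z.
Qed.

(** Vertices are added in an order in which each has at most one neighbour among the earlier ones.
    As degrees are at most 2, that neighbour is still the start or the end of its path, and the new
    vertex is put before or behind it. *)
Lemma orient (F : rel V) : symmetric F -> subrel F e -> (forall v, #|F v| <= 2) ->
  exists p, pcover e p /\ forall u v, path_rel p u v = F u v.
Proof.
move=> Fs Fe F2.
suff H k (X : {set V}) : #|X| <= k ->
    exists p, pcover e p /\ forall u v, path_rel p u v = [&& F u v, u \in X & v \in X].
  have [p [pc E]] := H #|[set: V]| setT (leqnn _); exists p; split=> // u v.
  by rewrite E !inE !andbT.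
elim: k X => [|k IH] X Xk.
  exists id; split; first by split=> [x|x y|x] //=; rewrite eqxx.
  move=> u v; move: Xk; rewrite leqn0 cards_eq0 => /eqP->; rewrite !inE !andbF /path_rel /=.
  by case: eqVneq.
have [->|/set0Pn[x0 x0X]] := eqVneq X set0.
  by apply: IH; rewrite cards0.
have [v vX low] := low_degree_vertex x0X.
have [|p [pc pF]] := IH (X :\ v).
  by move: Xk; rewrite (cardsD1 v X) vX.
have nv w : path_rel p v w = false by rewrite pF !inE eqxx /= andbF.
have pv : p v = v.
  by apply/eqP; apply: contraFT (nv (p v)) => pv; rewrite (path_rel_nbrs _ _ pc) eqxx pv.
have sv : succ p v = v.
  by apply/eqP; apply: contraFT (nv (succ p v)) => sv; rewrite (path_rel_nbrs _ _ pc) eqxx sv orbT.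
have Fv w : F v w -> v != w by move/Fe/(forest_neq fe).
have [/existsP[u /andP[uX Fvu]]|no] := boolP [exists u, (u \in X) && F v u]; last first.
  exists p; split=> // x y; rewrite pF !inE.
  have {}no w : w \in X -> F v w = false.
    by move=> wX; apply: contraNF no => Fw; apply/existsP; exists w; rewrite wX.
  have [->|xv] := eqVneq x v; have [->|yv] := eqVneq y v; rewrite //= ?andbF.
  - by rewrite no.
  - by case yX: (y \in X); rewrite ?andbF // no.
  - by case xX: (x \in X); rewrite ?andbF // Fs no.
have vu := Fv u Fvu.
have onlyu w : w \in X -> F v w -> w = u.
  by move=> wX Fw; apply: low => //; apply: Fe.
have target x y : [|| [&& F x y, x \in X :\ v & y \in X :\ v], (x == v) && (y == u) | (x == u) && (y == v)]
    = [&& F x y, x \in X & y \in X].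
  rewrite !inE; have [->|xv] := eqVneq x v; have [->|yv] := eqVneq y v; rewrite /= ?andbF ?orbF ?andbT /=.
  - rewrite (negPf vu) /=; apply/esym/negbTE; apply/negP => /and3P[/Fv]; by rewrite eqxx.
  - rewrite vX /=; apply/eqP/andP => [->|[Fy yX]]; first by rewrite Fvu uX.
    exact: onlyu.
  - rewrite vX andbT; apply/eqP/andP => [->|[Fx xX]]; first by rewrite Fs Fvu uX.
    by apply: onlyu => //; rewrite Fs.
  - by [].
have evu := Fe _ _ Fvu.
have [pu|pu] := eqVneq (p u) u.
  exists (prolong p u v); split.
    by apply: pcover_prolong => //; rewrite ?pv // (forest_sym fe).
  have uv : u != v by rewrite eq_sym.
  move=> x y; rewrite (path_rel_prolong x y pc sv pu uv) pF -target.
  by congr (_ || _); rewrite orbC.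
have su : succ p u = u.
  apply/eqP; apply: contraT => su.
  have := F2 u; rewrite leqNgt => /negP[].
  have Fu v' : path_rel p u v' -> F u v' && (v' != v).
    by rewrite pF !inE => /and3P[-> _ /andP[->]].
  have: v |: [set w | path_rel p u w] \subset [set w | F u w].
    apply/subsetP=> w; rewrite !inE => /orP[/eqP->|/Fu/andP[] //]; by rewrite Fs.
  move/subset_leq_card; rewrite cardsU1 !cardsE (card_path_rel _ pc) pu su !inE.
  have -> : path_rel p u v = false by rewrite path_rel_sym nv.
  by [].
exists (prolong p v u); split.
  apply: pcover_prolong => //; apply/eqP => puv.
  by move: vu; rewrite (succ_id pc sv puv) eqxx.
by move=> x y; rewrite path_rel_prolong // pF -target.
Qed.

(** The degrees in [G], with the degree of each leaf at a star moved to the star. The total is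
    unchanged, but now the upper bounds at the individual vertices can all be attained at once. *)
Definition leaf_count (G : rel V) v :=
  if star_leaf e v then 0 else #|G v| + #|[set w | G v w & star_leaf e w]|.

(** At a star, 4 stands for two path edges that both lead to leaves. *)
Definition leaf_bound v :=
  if star_leaf e v then 0 else if star e v then 4 else demand e v.

Lemma star_leaf_star v w : star_leaf e v -> e v w -> star e w.
Proof.
move=> sl vw; have /eqP d1 : deg e v == 1 by case/andP: sl.
by rewrite -(star_leaf_nbr (forest_sym fe) d1 vw).
Qed.

Lemma star_not_leaf v : star e v -> star_leaf e v = false.
Proof. by move/star_deg => d; rewrite /star_leaf (gtn_eqF d). Qed.

Lemma sum_leaf_count (G : rel V) : symmetric G -> subrel G e ->
  \sum_v #|G v| = \sum_v leaf_count G v.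
Proof.
move=> Gs Ge.
have -> : \sum_v leaf_count G v = \sum_(v | ~~ star_leaf e v) leaf_count G v.
  rewrite [LHS](bigID (star_leaf e)) /= big1 ?add0n // => v sl.
  by rewrite /leaf_count sl.
rewrite [in RHS](eq_bigr (fun v => #|G v| + #|[set w | G v w & star_leaf e w]|)); last first.
  by move=> v /negPf sl; rewrite /leaf_count sl.
rewrite big_split /= [LHS](bigID (star_leaf e)) /= addnC; congr (_ + _).
transitivity (\sum_(v | star_leaf e v) \sum_(w | ~~ star_leaf e w) (G v w : nat)).
  apply: eq_bigr => v sl; rewrite -sum1_card big_mkcond [RHS]big_mkcond /=.
  apply: eq_bigr => w _; rewrite in_rel; case Gvw: (G v w); last by case: ifP.
  by rewrite (star_not_leaf (star_leaf_star sl (Ge _ _ Gvw))).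
rewrite exchange_big; apply: eq_bigr => v sl.
rewrite -sum1_card big_mkcond [RHS]big_mkcond /=; apply: eq_bigr => w _.
by rewrite inE [G w v]Gs; case: (G v w); case: (star_leaf e w).
Qed.

Lemma sum_path_rel p : pcover e p -> \sum_v #|path_rel p v| = 2 * (n - #|starts p|).
Proof.
move=> pc; rewrite (eq_bigr (fun v => (p v != v) + (succ p v != v))); last first.
  by move=> v _; rewrite (card_path_rel v pc).
rewrite big_split /=.
have cardC (q : V -> V) : \sum_(i < n) (q i != i : nat) = n - #|[set x | q x == x]|.
  rewrite -[n in n - _]card_ord -(cardC [set x | q x == x]) addKn -sum1_card [RHS]big_mkcond /=.
  by apply: eq_bigr => i _; rewrite !inE; case: (q i == i).
rewrite !cardC -/(starts p) -/(ends p).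
have := card_ends pc (@pclosed_setT _ p); rewrite !setIT => ->.
by rewrite mul2n -addnn.
Qed.

Lemma leaf_count_bound p v : pcover e p -> leaf_count (path_rel p) v <= leaf_bound v.
Proof.
move=> pc; rewrite /leaf_count /leaf_bound; case: ifP => // nsl.
have le2 : #|path_rel p v| <= 2 by rewrite (card_path_rel _ pc); do 2!case: (_ != _).
have led : #|path_rel p v| <= deg e v.
  by apply: subset_leq_card; apply/subsetP=> w; apply: (path_rel_sub fe pc).
case: ifP => sv.
  have : #|[set w | path_rel p v w & star_leaf e w]| <= #|path_rel p v|.
    by apply: subset_leq_card; apply/subsetP=> w; rewrite inE => /andP[].
  by lia.
rewrite [X in _ + X]eq_card0 ?addn0; last first.
  move=> w; rewrite inE; apply/negbTE/negP => /andP[/(path_rel_sub fe pc) vw sl].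
  by rewrite (star_leaf_star sl) in sv; rewrite // (forest_sym fe).
by rewrite /demand nsl sv orbF; case: ifP => [/eqP d1|_]; [by rewrite /= -d1|case: ifP => [/eqP<-|]].
Qed.

Variables (F : rel V) (lab c : V -> nat).
Hypothesis bF : balanced_factor e F lab c.

Lemma factor_sym : symmetric F. Proof. by case: bF. Qed.
Lemma factor_sub : subrel F e. Proof. by case: bF. Qed.
Lemma factor_deg v : #|F v| = demand e v. Proof. by case: bF. Qed.

Lemma demand0_factor v w : demand e v = 0 -> F v w = false.
Proof. by rewrite -factor_deg => /card0_eq/(_ w); rewrite in_rel. Qed.

Lemma star_demand v : star e v -> demand e v = 0.
Proof. by move=> sv; rewrite /demand (gtn_eqF (star_deg sv)) sv orbT. Qed.

Lemma star_leaf_demand v : star_leaf e v -> demand e v = 0.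
Proof. by move=> sv; rewrite /demand sv; case/andP: sv => ->. Qed.

(** Joining every star to two of its leaves, in addition to the edges of [F], keeps all degrees at
    most 2, so [orient] applies. *)
Lemma factor_cover : exists p, pcover e p /\ forall v, leaf_count (path_rel p) v = leaf_bound v.
Proof.
pose leafn v w := e v w && (deg e w == 1).
pose l1 v := odflt v [pick w | leafn v w].
pose l2 v := odflt v [pick w | leafn v w && (w != l1 v)].
have lP v : star e v -> [/\ leafn v (l1 v), leafn v (l2 v) & l1 v != l2 v].
  case/card_gt1P => [a [b []]]; rewrite !inE -!/(leafn _ _) => va vb ab.
  have L1 : leafn v (l1 v) by rewrite /l1; case: pickP => [//|/(_ a)]; rewrite va.
  rewrite /l2; case: pickP => [w /andP[vw w1]|no] /=; first by rewrite eq_sym.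
  move: (no a) (no b); rewrite va vb /= => /negbFE/eqP Ea /negbFE/eqP Eb.
  by rewrite Ea Eb eqxx in ab.
pose st v w := star e v && ((w == l1 v) || (w == l2 v)).
pose G u v := [|| F u v, st u v | st v u].
have es := forest_sym fe.
have stP u v : st u v -> [/\ e u v, star e u, deg e v = 1 & star_leaf e v].
  case/andP=> su; have [/andP[a1 /eqP d1] /andP[a2 /eqP d2] _] := lP u su.
  by case/orP=> /eqP->; split=> //; rewrite (star_leaf_nbr es (v := u)) // es.
have Gs : symmetric G by move=> u v; rewrite /G factor_sym (orbC (st u v)).
have Ge : subrel G e.
  move=> u v /or3P[/factor_sub //|/stP[] //|/stP[]]; by rewrite es.
have Gcore v w : star e v = false -> star_leaf e v = false -> G v w = F v w.
  move=> sv slv; rewrite /G {1}/st sv /=; case H: (st w v); rewrite ?orbF //.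
  by have [_ _ _] := stP _ _ H; rewrite slv.
have Gstar v w : star e v -> G v w = (w \in [set l1 v; l2 v]).
  move=> sv; rewrite /G (demand0_factor _ (star_demand sv)) /= {1}/st sv !inE /=.
  case H: (st w v); rewrite ?orbF //.
  by have [_ _ d1 _] := stP _ _ H; have := star_deg sv; rewrite d1.
have cardstar v : star e v -> #|G v| = 2.
  move=> sv; rewrite (@eq_card _ _ (mem [set l1 v; l2 v])).
    by rewrite cards2; have [_ _ ->] := lP v sv.
  by move=> w; rewrite in_rel Gstar.
have G2 v : #|G v| <= 2.
  case sv: (star e v); first by rewrite cardstar.
  case slv: (star_leaf e v).
    have d1 : deg e v = 1 by case/andP: slv => /eqP.
    apply: (@leq_trans (deg e v)); last by rewrite d1.
    by apply: subset_leq_card; apply/subsetP=> w; apply: Ge.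
  rewrite (@eq_card _ _ (F v)); first by rewrite factor_deg demand_le.
  by move=> w; rewrite !in_rel Gcore.
have [p [pc pG]] := orient Gs Ge G2; exists p; split=> // v.
have Ec : #|path_rel p v| = #|G v| by apply: eq_card => w; rewrite !in_rel pG.
rewrite /leaf_count /leaf_bound Ec; case: ifP => // slv; case: ifP => sv.
  rewrite cardstar // (@eq_card _ _ (G v)) ?cardstar // => w; rewrite !inE in_rel pG Gstar //.
  case: (boolP (w \in _)) => //=; rewrite !inE => wl.
  by have [|_ _ _ ->] := stP v w; rewrite // /st sv.
rewrite [X in _ + X]eq_card0 ?addn0; last first.
  move=> w; rewrite inE; apply/negbTE/negP => /andP[/(path_rel_sub fe pc) vw sl].
  by rewrite (star_leaf_star sl) in sv; rewrite // es.
by rewrite -factor_deg; apply: eq_card => w; rewrite !in_rel Gcore.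
Qed.

(** Fewest starts means most edges, hence the largest total count; as [factor_cover] meets the bound
    at every vertex, so does every minimum cover. *)
Lemma minp_tight p : minp e p -> forall v, leaf_count (path_rel p) v = leaf_bound v.
Proof.
move=> [pc pmin]; have [q [qc qb]] := factor_cover.
apply: sum_eq_pointwise => [v|]; first exact: leaf_count_bound.
rewrite -(eq_bigr _ (fun v _ => qb v)).
rewrite -!sum_leaf_count; try exact: path_rel_sym; try exact: path_rel_sub.
by rewrite !sum_path_rel // leq_mul2l /=; apply: leq_sub2l; apply: pmin.
Qed.

Lemma minp_core_deg p v : minp e p -> demand e v != 0 -> #|path_rel p v| = demand e v.
Proof.
move=> pm dv; have := minp_tight pm v; rewrite /leaf_count /leaf_bound.
case: ifP => [/star_leaf_demand E|_]; first by rewrite E in dv.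
case: ifP => [/star_demand E|sv]; first by rewrite E in dv.
rewrite [X in _ + X]eq_card0 ?addn0 // => w.
rewrite inE; apply/negbTE/negP => /andP[/(path_rel_sub fe (proj1 pm)) vw sl].
by rewrite (star_leaf_star sl) in sv; rewrite // (forest_sym fe).
Qed.

Lemma minp_star p v : minp e p -> star e v ->
  #|path_rel p v| = 2 /\ forall w, path_rel p v w -> star_leaf e w.
Proof.
move=> pm sv; have := minp_tight pm v; rewrite /leaf_count /leaf_bound star_not_leaf // sv.
have le2 : #|path_rel p v| <= 2.
  by rewrite (card_path_rel _ (proj1 pm)); do 2!case: (_ != _).
have sub : [set w | path_rel p v w & star_leaf e w] \subset path_rel p v.
  by apply/subsetP=> w; rewrite inE => /andP[].
have le := subset_leq_card sub => E.
have aux (a b : nat) : a <= 2 -> b <= a -> a + b = 4 -> a = 2 /\ b = a by lia.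
have [E2 Es] := aux _ _ le2 le E.
split=> // w vw; have := subset_cardP Es sub w; rewrite in_rel vw inE.
by case/andP.
Qed.

(** Where [p] and [F] differ at a vertex, equal degrees give an edge of [p] outside [F] and an edge
    of [F] outside [p]. Both lead to vertices where the two differ again, which is impossible in a
    forest. *)
Lemma minp_core p v w : minp e p -> demand e v != 0 -> path_rel p v w = F v w.
Proof.
move=> pm dv; have pc := proj1 pm; have es := forest_sym fe.
have core x y : demand e x != 0 -> path_rel p x y -> demand e y != 0.
  move=> dx xy; have exy := path_rel_sub fe pc xy.
  rewrite /demand; case: ifP => [/eqP d1|/eqP d1].
    rewrite (star_leaf_nbr es d1 (v := x)); last by rewrite es.
    by case sx: (star e x) => //; rewrite star_demand in dx.
  rewrite (_ : deg e y == 0 = false) /=; last first.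
    by apply: gtn_eqF; apply: (@deg_gt0 _ _ _ x); rewrite es.
  case: ifP => // sy; have [_ /(_ x)] := minp_star pm sy.
  by rewrite path_rel_sym => /(_ xy) /star_leaf_demand E; rewrite E in dx.
have coreF x y : F x y -> demand e y != 0.
  by move=> xy; apply/eqP => /(@demand0_factor _ x); rewrite factor_sym xy.
apply/eqP; apply: contraT => neq; exfalso.
pose X := [set x | (demand e x != 0) && [exists y, path_rel p x y != F x y]].
have vX : v \in X by rewrite inE dv; apply/existsP; exists w.
apply: (forest_low_degree fe vX) => x; rewrite inE => /andP[dx /existsP[y0 ny0]].
have Ec : #|[set y | path_rel p x y]| = #|[set y | F x y]|.
  by rewrite !cardsE minp_core_deg // factor_deg.
have neqs : [set y | path_rel p x y] != [set y | F x y].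
  by apply: contraNneq ny0 => /setP/(_ y0); rewrite !inE => ->.
have [y yP] : exists y, y \in [set y | path_rel p x y] :\: [set y | F x y].
  apply/set0Pn; rewrite setD_eq0; apply: contra neqs => sub.
  by rewrite eqEcard sub Ec leqnn.
have [z zP] : exists z, z \in [set y | F x y] :\: [set y | path_rel p x y].
  apply/set0Pn; rewrite setD_eq0; apply: contra neqs => sub.
  by rewrite eq_sym eqEcard sub Ec leqnn.
move: yP zP; rewrite !inE => /andP[yF yp] /andP[zp zF]; exists y, z; split.
- by apply: contraNneq yF => ->.
- rewrite !inE (core x y) //=; apply/existsP; exists x.
  by rewrite path_rel_sym yp factor_sym (negPf yF).
- rewrite !inE (coreF x z) //=; apply/existsP; exists x.
  by rewrite path_rel_sym (negPf zp) factor_sym zF.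
- exact: path_rel_sub yp.
- exact: factor_sub.
Qed.

Lemma minp_start p v : minp e p -> p v = v -> [\/ demand e v = 1, star_leaf e v | deg e v = 0].
Proof.
move=> pm pv; have pc := proj1 pm.
have le1 : #|path_rel p v| <= 1 by rewrite (card_path_rel _ pc) pv eqxx; case: (_ != _).
have [dv|dv] := eqVneq (demand e v) 0; last first.
  constructor 1; have := minp_core_deg pm dv; have := demand_le e v; lia.
case sv: (star e v); first by have [E _] := minp_star pm sv; rewrite E in le1.
case slv: (star_leaf e v); first by constructor 2.
constructor 3; move: dv; rewrite /demand slv sv orbF; case: ifP => // _.
by case: ifP => // /eqP.
Qed.

Lemma isolated_start p v : pcover e p -> deg e v = 0 -> p v = v.
Proof.
move=> pc d0; apply/eqP; apply: contraT => /(pcover_edge pc).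
by rewrite (forest_sym fe) => /deg_gt0; rewrite d0.
Qed.

(** The path at a star runs from a leaf through the star to a leaf, and its last vertex is the only
    leaf at the star that is not a start. The choice of this leaf is the whole freedom there. *)
Lemma star_missing p v x : minp e p -> star_leaf e x -> e x v ->
  exists2 y, e v y /\ deg e y = 1 & p y != y /\
  forall z, e v z -> deg e z = 1 -> p z != z -> z = y.
Proof.
move=> pm slx xv; have sv := star_leaf_star slx xv; have pc := proj1 pm.
have [c2 sl] := minp_star pm sv.
have sv' : succ p v != v by move: c2; rewrite (card_path_rel _ pc); case: (_ != v) => //; case: (_ != v).
have r : path_rel p v (succ p v) by rewrite (path_rel_nbrs _ _ pc) eqxx sv' orbT.
exists (succ p v).
  split; first exact: path_rel_sub r.
  by have /andP[/eqP] := sl _ r.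
split; first by rewrite succP // eq_sym.
move=> z vz dz pz; apply/esym/(succ_eq pc); last by rewrite eq_sym (forest_neq fe vz).
have ez : e z (p z) by rewrite (forest_sym fe); apply: (pcover_edge pc).
by apply: (deg1_nbr dz ez); rewrite (forest_sym fe).
Qed.

Lemma connect_factor_root p x y : minp e p -> connect F x y -> root_of p x = root_of p y.
Proof.
move=> pm /connectP[q]; elim: q x => [|z q IH] x /=; first by move=> _ ->.
case/andP=> xz pth lst; rewrite -(IH z pth lst).
have dx : demand e x != 0 by apply/eqP => /(demand0_factor z); rewrite xz.
have pc := proj1 pm.
move: xz; rewrite -(minp_core z pm dx) (path_rel_nbrs _ _ pc).
case/orP=> /andP[/eqP-> nv]; first by rewrite (root_of_step fe pc).
by rewrite -{1}(succP nv) (root_of_step fe pc).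
Qed.

Lemma connect_factor_demand x y : connect F x y -> demand e x != 0 -> demand e y != 0.
Proof.
move=> /connectP[q]; elim: q x => [|z q IH] x /=; first by move=> _ ->.
case/andP=> xz pth lst dx; apply: IH pth lst _.
by apply/eqP => /(demand0_factor x); rewrite factor_sym xz.
Qed.

Lemma connect_factor_lab x y : connect F x y -> lab x = lab y.
Proof.
case: bF => _ _ _ labF _ /connectP[q]; elim: q x => [|z q IH] x /=; first by move=> _ ->.
by case/andP=> /labF-> pth lst; apply: IH.
Qed.

Lemma fconnect_factor p x y : minp e p -> demand e x != 0 -> fconnect p x y -> connect F x y.
Proof.
move=> pm dx /connectP[q]; elim: q x dx => [|z q IH] x dx /=; first by move=> _ ->; apply: connect0.
case/andP=> /eqP pxz pth lst; have [E|nE] := eqVneq x z.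
  by apply: IH => //; rewrite E.
have xz : F x z by rewrite -(minp_core z pm dx) /path_rel /= nE pxz eqxx.
apply: connect_trans (connect1 xz) (IH z _ pth lst).
exact: connect_factor_demand (connect1 xz) dx.
Qed.

Lemma factor_leaf_end p x : minp e p -> demand e x = 1 -> p x != x -> succ p x = x.
Proof.
move=> pm dx px; have := minp_core_deg (v := x) pm; rewrite dx => /(_ isT).
by rewrite (card_path_rel _ (proj1 pm)) px; case: eqP.
Qed.

Lemma transport_minp p phi : minp e p -> automorphism e phi ->
  exists q, minp e q /\ starts q = phi @: starts p.
Proof.
move=> [pc pmin] aut; pose q x := phi (p (phi^-1%g x)).
have qE x : q (phi x) = phi (p x) by rewrite /q permK.
have phiE y : exists x, y = phi x by exists (phi^-1%g y); rewrite permKV.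
have sq : starts q = phi @: starts p.
  apply/setP=> y; have [x ->] := phiE y; rewrite inE qE (inj_eq perm_inj).
  by rewrite (mem_imset _ _ (@perm_inj _ phi)) inE.
exists q; split=> //; split; last by move=> r rc; rewrite sq (card_imset _ (@perm_inj _ phi)); apply: pmin.
split.
- by move=> y; have [x ->] := phiE y; rewrite qE (inj_eq perm_inj) aut; apply: (pcover_edge pc).
- move=> y y'; have [x ->] := phiE y; have [x' ->] := phiE y'; rewrite !qE !(inj_eq perm_inj).
  by move=> px px' /perm_inj E; congr (phi _); apply: (pcover_inj pc).
- by move=> y; have [x ->] := phiE y; rewrite !qE => /perm_inj/(pcover_asym pc)->.
Qed.

Lemma tperm_leaves_aut v x y : e v x -> e v y -> deg e x = 1 -> deg e y = 1 ->
  automorphism e (tperm x y).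
Proof.
move=> vx vy dx dy a b; have es := forest_sym fe.
have only z u : e v z -> deg e z = 1 -> e z u = (u == v).
  move=> vz dz; apply/idP/eqP => [zu|->]; last by rewrite es.
  by apply: (deg1_nbr dz zu); rewrite es.
have xv : x != v by rewrite eq_sym (forest_neq fe).
have yv : y != v by rewrite eq_sym (forest_neq fe).
have tv : tperm x y v = v by rewrite tpermD.
have ex z : e x (tperm x y z) = e x z /\ e y (tperm x y z) = e y z.
  by rewrite !(only x) // !(only y) // -{1 3}tv !(inj_eq perm_inj).
have exy z : e x z = e y z by rewrite (only x) // (only y).
case: (tpermP x y a) => [->|->|/eqP ax /eqP ay].
- by rewrite (ex b).2 -exy.
- by rewrite (ex b).1 exy.
- case: (tpermP x y b) => [->|->|//]; first by rewrite ![e a _]es exy.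
  by rewrite ![e a _]es exy.
Qed.


Variable col : nat -> V -> nat.
Hypothesis cr : color_refinement e col.
Hypothesis c_col : forall v, c v = col n v.

Definition summit x := \max_(y | connect F x y) height e y.

(** A potential for turning one minimum set into another. Exchanging the halves of a path repairs
    its ends but may spoil up to [n] vertices on paths with lower summits; in base [n.+1] these
    weigh less together than one repaired vertex. *)
Definition weight x := if demand e x == 1 then n.+1 ^ (summit x).+1 else 1.

Lemma weight_gt0 x : 0 < weight x.
Proof. by rewrite /weight; case: ifP => // _; rewrite expn_gt0. Qed.

Lemma factor_connect_below w1 x y : connect F x y -> x \in below e w1 -> y \notin below e w1 ->
  connect F x w1.
Proof.
move=> /connectP[q]; elim: q x => [|z q IH] x /=; first by move=> _ -> ->.
case/andP=> xz pth lst xw yw; have [zw|zw] := boolP (z \in below e w1).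
  exact: connect_trans (connect1 xz) (IH z pth lst zw yw).
by have [->] := below_exit fe (factor_sub xz) xw zw; rewrite connect0.
Qed.

(** Another path that meets the branch of [w] stays strictly below [w], since leaving the branch
    would mean passing through [w], which belongs to the path of [x]. *)
Lemma summit_below w x y : y \in below e w -> connect F x w -> ~~ connect F x y ->
  summit y < summit x.
Proof.
move=> yw xw xy; have Fs := sym_connect_sym factor_sym.
have yNw : ~~ connect F y w.
  by apply: contra xy => yw'; apply: connect_trans xw _; rewrite Fs.
have low z : connect F y z -> height e z < height e w.
  move=> yz; have [zw|zw] := boolP (z \in below e w).
    by have [E|//] := below_height zw; rewrite -E yz in yNw.
  by case/negP: yNw; apply: factor_connect_below yz yw zw.
have hw0 : 0 < height e w by apply: leq_ltn_trans (low y (connect0 _ _)).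
apply: (@leq_trans (height e w)); last exact: (leq_bigmax_cond _ xw).
rewrite -(prednK hw0) ltnS; apply/bigmax_leqP => z /low; lia.
Qed.

Lemma sum_weight_lt (A B : {set V}) x k : x \in A -> x \notin B -> n * k < weight x ->
  (forall z, z \in B -> z \in A \/ weight z <= k) ->
  \sum_(z in B) weight z < \sum_(z in A) weight z.
Proof.
move=> xA xB kx low; rewrite (big_setD1 x xA) /= (big_setID (A :\ x)) /=.
have le1 : \sum_(z in B :&: (A :\ x)) weight z <= \sum_(z in A :\ x) weight z.
  by rewrite [X in _ <= X](big_setID B) /= setIC leq_addr.
have le2 : \sum_(z in B :\: (A :\ x)) weight z <= n * k.
  apply: (@leq_trans (\sum_(z in B :\: (A :\ x)) k)).
    apply: leq_sum => z; rewrite !inE negb_and negbK => /andP[H zB].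
    have [zA|//] := low z zB; case/orP: H => [/eqP E|]; last by rewrite zA.
    by rewrite E (negPf xB) in zB.
  rewrite sum_nat_const leq_mul2r; apply/orP; right.
  by have := max_card (mem (B :\: (A :\ x))); rewrite card_ord.
by apply: leq_ltn_trans (leq_add le1 le2) _; rewrite addnC ltn_add2r.
Qed.

(** Transposing [x] with the leaf that [p1] leaves out repairs [x] and spoils nothing, because [x]
    is the only leaf there that [p2] leaves out. *)
Lemma star_step p1 p2 x : minp e p1 -> minp e p2 -> p1 x = x -> p2 x != x -> star_leaf e x ->
  exists phi : {perm V}, automorphism e phi /\
   \sum_(z in phi @: starts p1 :\: starts p2) weight z <
   \sum_(z in starts p1 :\: starts p2) weight z.
Proof.
move=> pm1 pm2 p1x p2x sl; have es := forest_sym fe.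
have d1 : deg e x = 1 by case/andP: sl => /eqP.
have/card_gt0P[v] : 0 < deg e x by rewrite d1.
rewrite in_rel => xv; have vx : e v x by rewrite es.
have [y1 [vy1 dy1] [p1y1 _]] := star_missing pm1 sl xv.
have [y2 _ [_ un2]] := star_missing pm2 sl xv.
have y1x : y1 != x by apply: contraNneq p1y1 => ->; rewrite p1x.
have p2y1 : p2 y1 = y1.
  apply/eqP; apply: contraT => /(un2 _ vy1 dy1) E.
  by rewrite E -(un2 x vx d1 p2x) eqxx in y1x.
exists (tperm x y1); split; first exact: (tperm_leaves_aut vx vy1).
have imP z : z \in tperm x y1 @: starts p1 :\: starts p2 -> z \in starts p1 :\: starts p2 /\ z != x.
  rewrite !inE => /andP[zS2 /imsetP[w]]; rewrite inE => /eqP pw zE.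
  move: zE zS2; case: tpermP => [_ ->|Ew _ _|wx wy -> ->]; first by rewrite p2y1 eqxx.
    by rewrite -Ew pw eqxx in p1y1.
  by rewrite pw eqxx; split=> //; apply/eqP.
apply: (@sum_weight_lt _ _ x 0).
- by rewrite !inE p1x eqxx p2x.
- by apply/negP => /imP[]; rewrite eqxx.
- by rewrite muln0 weight_gt0.
- by move=> z /imP[zA _]; left.
Qed.

(* The automorphism exchanging the two halves of a path only disturbs lighter
   vertices. *)
Lemma core_step p1 p2 x : minp e p1 -> minp e p2 -> p1 x = x -> p2 x != x -> demand e x = 1 ->
  exists phi : {perm V}, automorphism e phi /\
   \sum_(z in phi @: starts p1 :\: starts p2) weight z <
   \sum_(z in starts p1 :\: starts p2) weight z.
Proof.
move=> pm1 pm2 p1x p2x dx; have pc1 := proj1 pm1; have pc2 := proj1 pm2.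
have dx0 : demand e x != 0 by rewrite dx.
have [xb p2b] := root_ofP fe pc2 x; set b := root_of p2 x in xb p2b.
have Fxb := fconnect_factor pm2 dx0 xb.
have Fs := sym_connect_sym factor_sym.
have bx : b != x by apply: contraNneq p2x => <-; rewrite p2b.
have rx : root_of p1 x = x := root_of_fixed fe pc1 p1x.
have p1b : p1 b != b.
  apply: contraNneq bx => p1b; have := connect_factor_root pm1 Fxb.
  by rewrite rx (root_of_fixed fe pc1 p1b) => ->.
have db0 := connect_factor_demand Fxb dx0.
have db : demand e b = 1.
  have [//|sl|d0] := minp_start pm2 p2b; first by rewrite star_leaf_demand in db0.
  by rewrite /demand d0 in db0.
(* A vertex of demand 1 is the start or the end of its path in [p1], and there is only one of
   each. *)
have third y : demand e y = 1 -> connect F x y -> y = x \/ y = b.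
  move=> dy xy; have E := connect_factor_root pm1 xy.
  have [p1y|p1y] := eqVneq (p1 y) y; first by left; rewrite -rx E (root_of_fixed fe pc1 p1y).
  right; apply: (end_uniq fe pc1); rewrite ?(factor_leaf_end pm1) //.
  by rewrite -E (connect_factor_root pm1 Fxb).
have exb : connect e x b.
  by apply: (connect_sub _ Fxb) => u v /factor_sub uv; apply: connect1.
have cxb : col n x = col n b.
  case: bF => _ _ _ _ labc; rewrite -!c_col -!labc //; exact: connect_factor_lab.
have [psi [aut psix]] := refinement_aut cr fe cxb exb.
have xb' : x != b by rewrite eq_sym.
have [w1 [w2 [chi [caut cx cb hw [w12 x1 b2 c0]]]]] := ex_exchange fe aut psix xb' exb.
have b1 : b \notin below e w1.
  by apply: contra w12 => b1; rewrite (below_disjoint hw b1 b2).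
have x2 : x \notin below e w2.
  by apply: contra w12 => x2; rewrite (below_disjoint hw x1 x2).
have Fxw1 := factor_connect_below Fxb x1 b1.
have Fbx : connect F b x by rewrite Fs.
have Fxw2 : connect F x w2 := connect_trans Fxb (factor_connect_below Fbx b2 x2).
exists chi; split=> //.
have imN z : z \in chi @: starts p1 :\: starts p2 -> z != x /\ z != b.
  rewrite inE => /andP[zS2 /imsetP[w wS1 zE]]; split; last first.
    by apply: contraNneq zS2 => ->; rewrite inE p2b.
  apply/eqP => zx; rewrite zx -cb in zE; have wb := perm_inj zE.
  by move: wS1; rewrite -wb inE (negPf p1b).
apply: (@sum_weight_lt _ _ x (n.+1 ^ summit x)).
- by rewrite !inE p1x eqxx p2x.
- by apply/negP => /imN[]; rewrite eqxx.
- by rewrite /weight dx eqxx expnS ltn_mul2r expn_gt0 ltnS leqnn.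
move=> z zA; have [zx zb] := imN z zA.
have light w : connect F x w -> z \in below e w -> weight z <= n.+1 ^ summit x.
  move=> xw zw; rewrite /weight; case: ifP => [/eqP dz|_]; last by rewrite expn_gt0.
  rewrite leq_exp2l //; last first.
    by rewrite ltnS; apply: leq_ltn_trans (ltn_ord x).
  apply: summit_below zw xw _; apply/negP => /(third z dz)[] E.
    by rewrite E eqxx in zx.
  by rewrite E eqxx in zb.
have [z1|z1] := boolP (z \in below e w1); first by right; apply: light z1.
have [z2|z2] := boolP (z \in below e w2); first by right; apply: light z2.
left; move: zA; rewrite !inE => /andP[-> /imsetP[w]]; rewrite inE => p1w.
by rewrite -{1}(c0 z z1 z2) => /perm_inj ->.
Qed.

Lemma minp_iso p1 p2 : minp e p1 -> minp e p2 ->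
  exists phi : {perm V}, automorphism e phi /\ phi @: starts p1 = starts p2.
Proof.
move=> pm1 pm2; have [k] := ubnP (\sum_(z in starts p1 :\: starts p2) weight z).
elim: k p1 pm1 => // k IH p1 pm1 ltk.
have [E|/set0Pn[x]] := eqVneq (starts p1 :\: starts p2) set0.
  exists 1%g; split; first by move=> x y; rewrite !perm1.
  have -> : (1%g : {perm V}) @: starts p1 = starts p1.
    by rewrite -[RHS]imset_id; apply: eq_imset => x; rewrite perm1.
  apply/eqP; rewrite eqEcard -setD_eq0 E eqxx /=.
  by apply: (proj2 pm2); case: pm1.
rewrite !inE => /andP[p2x /eqP p1x].
have [phi [aut lt]] : exists phi : {perm V}, automorphism e phi /\
   \sum_(z in phi @: starts p1 :\: starts p2) weight z <
   \sum_(z in starts p1 :\: starts p2) weight z.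
  have [dx|sl|d0] := minp_start pm1 p1x; [exact: core_step pm1 pm2 p1x p2x dx|exact: star_step pm1 pm2 p1x p2x sl|].
  by rewrite (isolated_start (proj1 pm2) d0) eqxx in p2x.
have [q [qm qE]] := transport_minp pm1 aut.
have [|psi [aut2 <-]] := IH q qm; first by rewrite qE; lia.
exists (phi * psi)%g; split; first by move=> y z; rewrite !permM aut2 aut.
rewrite qE -imset_comp; apply: eq_imset => y; exact: permM.
Qed.

End Sufficiency.

Lemma iso_unique_balanced n (e : rel 'I_n) (col : nat -> 'I_n -> nat) :
  forest e -> color_refinement e col ->
  (iso_unique_zf e <-> exists F lab, balanced_factor e F lab (col n)).
Proof.
move=> fe cr; split=> [iso|[F [lab bF]] A B].
  apply: iso_balanced_factor => // k phi aut x.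
  by rewrite (color_invariant cr x (leqnn n) aut).
move=> /(min_zero_forcingP fe)[p1 [pm1 ->]] /(min_zero_forcingP fe)[p2 [pm2 ->]].
have [phi [aut E]] := minp_iso fe bF cr (fun v => erefl) pm1 pm2.
by exists phi.
Qed.

(** * A language compiled to the RAM *)

(* Registers [x < 32] live in cell [x], entry [i] of array [j < 16] in cell
   [64 + 16 * i + j]; cells 32 and 33 are scratch, and the bound and the counter
   of a loop at nesting depth [d] are kept in cells [40 + 2 * d] and
   [41 + 2 * d]. *)
Inductive cmd : Type :=
| CConst (x k : nat)
| CAdd (x y z : nat)
| CSub (x y z : nat)
| CGet (x j y : nat)
| CPut (j x y : nat)
| CSeq (c1 c2 : cmd)
| CIf (x : nat) (c1 c2 : cmd)
| CFor (i x : nat) (c : cmd).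

Record state := State { rg : nat -> nat; ar : nat -> nat -> nat }.

Definition setr (s : state) (x v : nat) : state :=
  State (fun y => if y == x then v else rg s y) (ar s).

Definition seta (s : state) (j i v : nat) : state :=
  State (rg s) (fun j' => if j' == j then (fun i' => if i' == i then v else ar s j i') else ar s j').

Fixpoint loop (f : state -> state * nat) (i k len : nat) (s : state) : state * nat :=
  if len is l.+1 then
    let q := f (setr s i k) in
    let r := loop f i k.+1 l q.1 in
    (r.1, 7 + q.2 + r.2)
  else (s, 2).

(** The second component is the exact number of machine steps of the compiled code: six instructions
    compute an array address, and a loop round has four instructions before the body and three after
    it. *)
Fixpoint exec (c : cmd) (s : state) : state * nat :=
  match c with
  | CConst x k => (setr s x k, 1)
  | CAdd x y z => (setr s x (rg s y + rg s z), 1)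
  | CSub x y z => (setr s x (rg s y - rg s z), 1)
  | CGet x j y => (setr s x (ar s j (rg s y)), 7)
  | CPut j x y => (seta s j (rg s x) (rg s y), 7)
  | CSeq c1 c2 => let q := exec c1 s in let r := exec c2 q.1 in (r.1, q.2 + r.2)
  | CIf x c1 c2 =>
      if rg s x == 0 then let q := exec c2 s in (q.1, q.2.+1)
      else let q := exec c1 s in (q.1, q.2.+2)
  | CFor i x c => let r := loop (exec c) i 0 (rg s x) s in (r.1, 3 + r.2)
  end.

(** The machine cannot multiply; four doublings yield the factor 16. *)
Definition addr_code (y j : nat) : program :=
  [:: IAdd 32 y y; IAdd 32 32 32; IAdd 32 32 32; IAdd 32 32 32;
      IConst 33 (64 + j); IAdd 32 32 33].

Fixpoint compile (d off : nat) (c : cmd) : program :=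
  match c with
  | CConst x k => [:: IConst x k]
  | CAdd x y z => [:: IAdd x y z]
  | CSub x y z => [:: ISub x y z]
  | CGet x j y => addr_code y j ++ [:: ILoad x 32]
  | CPut j x y => addr_code x j ++ [:: IStore 32 y]
  | CSeq c1 c2 => let p1 := compile d off c1 in p1 ++ compile d (off + size p1) c2
  | CIf x c1 c2 =>
      let p1 := compile d off.+1 c1 in
      let off2 := off.+1 + size p1 + 1 in
      let p2 := compile d off2 c2 in
      IJz x off2 :: p1 ++ IJmp (off2 + size p2) :: p2
  | CFor i x c =>
      let p := compile d.+1 (off + 7) c in
      [:: IConst 32 0; IAdd (40 + 2 * d) x 32; IConst (41 + 2 * d) 0;
          ISub 32 (40 + 2 * d) (41 + 2 * d); IJz 32 (off + 10 + size p);
          IConst 32 0; IAdd i (41 + 2 * d) 32]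
      ++ p ++ [:: IConst 32 1; IAdd (41 + 2 * d) (41 + 2 * d) 32; IJmp (off + 3)]
  end.

(** The bound 12 keeps the cells of all loops below 64, where the arrays begin. *)
Fixpoint wf (d : nat) (c : cmd) : bool :=
  match c with
  | CConst x k => x < 32
  | CAdd x y z | CSub x y z => [&& x < 32, y < 32 & z < 32]
  | CGet x j y | CPut j x y => [&& x < 32, y < 32 & j < 16]
  | CSeq c1 c2 => wf d c1 && wf d c2
  | CIf x c1 c2 => [&& x < 32, wf d c1 & wf d c2]
  | CFor i x c => [&& i < 32, x < 32, d < 12 & wf d.+1 c]
  end.

Definition code_at (P : program) (off : nat) (p : program) : Prop :=
  forall k, k < size p -> nth IHalt P (off + k) = nth IHalt p k.

Lemma code_at_cons P off i p : code_at P off (i :: p) ->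
  nth IHalt P off = i /\ code_at P off.+1 p.
Proof.
move=> H; split; first by have := H 0 isT; rewrite addn0.
by move=> k ks; have := H k.+1 ks; rewrite addnS.
Qed.

Lemma code_at_cat P off p1 p2 : code_at P off (p1 ++ p2) ->
  code_at P off p1 /\ code_at P (off + size p1) p2.
Proof.
move=> H; split=> k ks.
  by rewrite H ?nth_cat ?ks // size_cat ltn_addr.
by rewrite -addnA H ?size_cat ?ltn_add2l // nth_cat ltnNge leq_addr addKn.
Qed.

#[local] Arguments run : simpl never.

Lemma run_trans P k1 k2 c c1 c2 : run P k1 c = c1 -> run P k2 c1 = c2 -> run P (k1 + k2) c = c2.
Proof. by rewrite /run addnC iterD => -> ->. Qed.

Lemma run_one P pc m c : step P (pc, m) = c -> run P 1 (pc, m) = c.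
Proof. by []. Qed.

Definition sim (m : memory) (s : state) : Prop :=
  (forall x, x < 32 -> m x = rg s x) /\
  forall j i, j < 16 -> m (64 + 16 * i + j) = ar s j i.

Lemma sim_scratch m m' s : (forall z, z < 32 \/ 64 <= z -> m' z = m z) -> sim m s -> sim m' s.
Proof.
move=> E [H1 H2]; split=> [x xU|j i jJ]; first by rewrite E ?H1 //; left.
by rewrite E ?H2 //; right; lia.
Qed.

Lemma sim_setr m s x v : x < 32 -> sim m s -> sim (upd m x v) (setr s x v).
Proof.
move=> xU [H1 H2]; split=> [y yU|j i jJ]; rewrite /upd /=; first by case: eqP => // _; apply: H1.
by rewrite ifN ?H2 //; apply/eqP; lia.
Qed.

Lemma sim_seta m s j i v : j < 16 -> sim m s -> sim (upd m (64 + 16 * i + j) v) (seta s j i v).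
Proof.
move=> jJ [H1 H2]; split=> [y yU|j' i' jJ']; rewrite /upd /=.
  by rewrite ifN ?H1 //; apply/eqP; lia.
have [->|jj] := eqVneq j' j.
  have [->|ii] := eqVneq i' i; first by rewrite eqxx.
  by rewrite ifN ?H2 //; apply/eqP; move/eqP: ii; lia.
by rewrite ifN ?H2 //; apply/eqP; move/eqP: jj; lia.
Qed.

Lemma run_addr P off y j m : code_at P off (addr_code y j) -> y < 32 ->
  exists m', [/\ run P 6 (off, m) = (off + 6, m'), m' 32 = 64 + 16 * m y + j &
    forall z, z != 32 -> z != 33 -> m' z = m z].
Proof.
move=> /code_at_cons[h0 /code_at_cons[h1 /code_at_cons[h2 /code_at_cons[h3
  /code_at_cons[h4 /code_at_cons[h5 _]]]]]] yU.
eexists; split.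
- by rewrite /run /= /step /fetch h0 h1 h2 h3 h4 h5; congr (_, _); lia.
- by rewrite /upd /=; lia.
- by move=> z /negPf z32 /negPf z33; rewrite /upd z32 z33.
Qed.

(** The last clause protects the bounds and counters of the enclosing loops. As these are private
    copies, a body may overwrite the loop variable and the register holding the bound. *)
Lemma compile_correct c : forall d P off m s, d <= 12 -> wf d c -> code_at P off (compile d off c) -> sim m s ->
  exists m', [/\ run P (exec c s).2 (off, m) = (off + size (compile d off c), m'),
    sim m' (exec c s).1 &
    forall y, 40 <= y < 40 + 2 * d -> m' y = m y].
Proof.
elim: c => [x k|x y z|x y z|x j y|j x y|c1 IH1 c2 IH2|x c1 IH1 c2 IH2|i x c IH] d P off m s dd /=.
- move=> xU /code_at_cons[h _] sm; exists (upd m x k); split.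
  + by rewrite addn1; apply: run_one; rewrite /step /fetch h.
  + exact: sim_setr.
  + by move=> y yd; rewrite /upd ifN //; apply/eqP; lia.
- move=> /and3P[xU yU zU] /code_at_cons[h _] sm; exists (upd m x (m y + m z)); split.
  + by rewrite addn1; apply: run_one; rewrite /step /fetch h.
  + by rewrite !(proj1 sm) //; apply: sim_setr.
  + by move=> w wd; rewrite /upd ifN //; apply/eqP; lia.
- move=> /and3P[xU yU zU] /code_at_cons[h _] sm; exists (upd m x (m y - m z)); split.
  + by rewrite addn1; apply: run_one; rewrite /step /fetch h.
  + by rewrite !(proj1 sm) //; apply: sim_setr.
  + by move=> w wd; rewrite /upd ifN //; apply/eqP; lia.
- move=> /and3P[xU yU jJ] hc sm.
  have {hc} : code_at P off (addr_code y j ++ [:: ILoad x 32]) := hc.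
  move=> /code_at_cat[ha /code_at_cons[h _]].
  have [m1 [r1 v1 k1]] := run_addr m ha yU.
  have sm1 : sim m1 s by apply: sim_scratch sm => z zz; apply: k1; apply/eqP; lia.
  exists (upd m1 x (m1 (m1 32))); split.
  + apply: (run_trans (k1 := 6) (k2 := 1) r1); apply: run_one.
    by rewrite /step /fetch h /= -addnS.
  + by rewrite v1 (proj2 sm1) // (proj1 sm) //; apply: sim_setr.
  + by move=> w wd; rewrite /upd ifN ?k1 //; apply/eqP; lia.
- move=> /and3P[xU yU jJ] hc sm.
  have {hc} : code_at P off (addr_code x j ++ [:: IStore 32 y]) := hc.
  move=> /code_at_cat[ha /code_at_cons[h _]].
  have [m1 [r1 v1 k1]] := run_addr m ha xU.
  have sm1 : sim m1 s by apply: sim_scratch sm => z zz; apply: k1; apply/eqP; lia.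
  exists (upd m1 (m1 32) (m1 y)); split.
  + apply: (run_trans (k1 := 6) (k2 := 1) r1); apply: run_one.
    by rewrite /step /fetch h /= -addnS.
  + by rewrite v1 (proj1 sm) // (proj1 sm1) //; apply: sim_seta.
  + by move=> w wd; rewrite /upd v1 ifN ?k1 //; apply/eqP; lia.
- move=> /andP[w1 w2] /code_at_cat[h1 h2] sm.
  have [m1 [r1 s1 k1]] := IH1 d P off m s dd w1 h1 sm.
  have [m2 [r2 s2 k2]] := IH2 d P _ m1 _ dd w2 h2 s1.
  exists m2; split=> //; last by move=> y yd; rewrite k2 // k1.
  by rewrite size_cat addnA; apply: run_trans r1 r2.
- move=> /and3P[xU w1 w2] /code_at_cons[h /code_at_cat[h1 /code_at_cons[h' h2]]] sm.
  case: ifP => x0 /=.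
    move: h2; set off2 := off.+1 + size _ + 1.
    rewrite -[(off.+1 + _).+1]addn1 -/off2 => h2.
    have [m2 [r2 s2 k2]] := IH2 d P off2 m s dd w2 h2 sm.
    exists m2; split=> //.
    suff : run P (1 + (exec c2 s).2) (off, m) = (off2 + size (compile d off2 c2), m2).
      rewrite add1n => ->; congr (_, _).
      by rewrite size_cat /=; lia.
    apply: run_trans _ r2; apply: run_one.
    by rewrite /step /fetch h (proj1 sm) // x0 /off2.
  have [m1 [r1 s1 k1]] := IH1 d P off.+1 m s dd w1 h1 sm.
  exists m1; split=> //.
  rewrite -[X in X.+2]addn0 -addn2 addnC -[2 in X in X + _]/(1 + 1).
  rewrite -addnA; apply: (@run_trans _ _ _ _ (off.+1, m)).
    by apply: run_one; rewrite /step /fetch h (proj1 sm) // x0.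
  rewrite addn0 addnC; apply: run_trans r1 _; apply: run_one.
  rewrite /step /fetch h' size_cat /=; congr (_, _); lia.
- move=> /and4P[iU xU d12 wc] /code_at_cons[h0 /code_at_cons[h1 /code_at_cons[h2
    /code_at_cons[h3 /code_at_cons[h4 /code_at_cons[h5 /code_at_cons[h6 /code_at_cat[hc
    /code_at_cons[e0 /code_at_cons[e1 /code_at_cons[e2 _]]]]]]]]]]] sm.
  have E7 : off.+4.+3 = off + 7 by lia.
  rewrite E7 in hc e0 e1 e2.
  pose lim := 40 + 2 * d; pose cnt := 41 + 2 * d.
  set p := compile d.+1 (off + 7) c in h4 hc e0 e1 e2 *.
  have cl : cnt != lim by apply/eqP; rewrite /cnt /lim; lia.
  have main len : forall k s0 m0, sim m0 s0 -> m0 cnt = k -> m0 lim = k + len ->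
    exists m', [/\ run P (loop (exec c) i k len s0).2 (off + 3, m0) = (off + 10 + size p, m'),
      sim m' (loop (exec c) i k len s0).1 & forall y, 40 <= y < 40 + 2 * d -> m' y = m0 y].
    elim: len => [|len IHl] k s0 m0 sm0 mc ml /=.
      exists (upd m0 32 0); split.
      - rewrite /run /= /step /fetch !addn3 h3 -/lim -/cnt mc ml addn0 subnn h4 /=.
        by rewrite /upd /=.
      - by apply: sim_scratch sm0 => z zz; rewrite /upd ifN //; apply/eqP; lia.
      - by move=> y yd; rewrite /upd ifN //; apply/eqP; lia.
    pose m1 := upd (upd (upd m0 32 len.+1) 32 0) i k.
    have r1 : run P 4 (off + 3, m0) = (off + 7, m1).
      rewrite /run /= /step /fetch !addn3 h3 -/lim -/cnt mc ml h4 /=.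
      rewrite {1}/upd /= addKn /= h5 h6 -/cnt.
      rewrite (_ : off.+4.+3 = off + 7); last by lia.
      have -> // : upd (upd m0 32 len.+1) 32 0 cnt + upd (upd m0 32 len.+1) 32 0 32 = k.
      have c32 : (cnt == 32) = false by apply/eqP; rewrite /cnt; lia.
      by rewrite /upd c32 /= mc addn0.
    have s1 : sim m1 (setr s0 i k).
      apply: sim_setr => //.
      by apply: sim_scratch sm0 => z zz; rewrite /upd !ifN //; apply/eqP; lia.
    have [m2 [r2 s2 k2]] := IH d.+1 P (off + 7) m1 _ d12 wc hc s1.
    have m1E y : 40 <= y -> m1 y = m0 y.
      by move=> y40; rewrite /m1 /upd !ifN //; apply/eqP; lia.
    have m2c : m2 cnt = k by rewrite k2 ?m1E // /cnt; lia.
    have m2l : m2 lim = k + len.+1 by rewrite k2 ?m1E // /lim; lia.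
    pose m3 := upd (upd m2 32 1) cnt k.+1.
    have r3 : run P 3 (off + 7 + size p, m2) = (off + 3, m3).
      rewrite /run /= /step /fetch e0 e1 e2 -/cnt /m3.
      have -> // : upd m2 32 1 cnt + upd m2 32 1 32 = k.+1.
      have c32 : (cnt == 32) = false by apply/eqP; rewrite /cnt; lia.
      by rewrite /upd c32 m2c addn1.
    have s3 : sim m3 (exec c (setr s0 i k)).1.
      apply: sim_scratch s2 => z zz; rewrite /m3 /upd !ifN //; apply/eqP; rewrite /cnt; lia.
    have [||m4 [r4 s4 k4]] := IHl k.+1 _ m3 s3.
    - by rewrite /m3 /upd eqxx.
    - have l1 : (lim == cnt) = false by rewrite eq_sym (negPf cl).
      have l2 : (lim == 32) = false by apply/eqP; rewrite /lim; lia.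
      by rewrite /m3 /upd l1 l2 m2l addSnnS.
    exists m4; split=> //.
      rewrite (_ : 7 + _ + _ = 4 + ((exec c (setr s0 i k)).2 +
        (3 + (loop (exec c) i k.+1 len (exec c (setr s0 i k)).1).2))); last by lia.
      by apply: run_trans r1 _; apply: run_trans r2 _; apply: run_trans r3 _.
    move=> y yd; rewrite k4 // /m3 /upd !ifN; [|by apply/eqP; lia|by apply/eqP; rewrite /cnt; lia].
    by rewrite k2 ?m1E //; lia.
  pose m1 := upd (upd (upd m 32 0) lim (rg s x)) cnt 0.
  have r1 : run P 3 (off, m) = (off + 3, m1).
    rewrite /run /= /step /fetch h0 h1 h2 -/lim -/cnt addn3 /m1.
    have -> // : upd m 32 0 x + upd m 32 0 32 = rg s x.
    have x32 : (x == 32) = false by apply/eqP; lia.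
    by rewrite /upd x32 addn0 (proj1 sm).
  have s1 : sim m1 s.
    by apply: sim_scratch sm => z zz; rewrite /m1 /upd !ifN //; rewrite /lim /cnt; apply/eqP; lia.
  have [||m' [r s' k']] := main (rg s x) 0 s m1 s1.
  - by rewrite /m1 /upd eqxx.
  - by rewrite /m1 /upd ifN 1?eq_sym // eqxx.
  exists m'; split=> //.
    rewrite !size_cat /= -/p (_ : off + _ = off + 10 + size p); last by lia.
    exact: run_trans r1 r.
  move=> y yd; rewrite k' // /m1 /upd !ifN //; rewrite /lim /cnt; apply/eqP; lia.
Qed.

(** * Rules for results and running times *)

Definition spec (c : cmd) (s : state) (t : nat) (Q : state -> Prop) : Prop :=
  (exec c s).2 <= t /\ Q (exec c s).1.

Lemma spec_weaken c s t t' (Q Q' : state -> Prop) :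
  spec c s t Q -> t <= t' -> (forall s', Q s' -> Q' s') -> spec c s t' Q'.
Proof. by move=> [H1 H2] tt QQ; split; [apply: leq_trans H1 tt|apply: QQ]. Qed.

Lemma spec_seq c1 c2 s t t1 t2 (Q : state -> Prop) :
  spec c1 s t1 (fun s' => spec c2 s' t2 Q) -> t1 + t2 <= t -> spec (CSeq c1 c2) s t Q.
Proof.
move=> [H1 [H2 H3]] tt; split=> //=; apply: leq_trans tt; exact: leq_add.
Qed.

Fixpoint mod_regs (c : cmd) : seq nat :=
  match c with
  | CConst x _ | CAdd x _ _ | CSub x _ _ | CGet x _ _ => [:: x]
  | CPut _ _ _ => [::]
  | CSeq c1 c2 | CIf _ c1 c2 => mod_regs c1 ++ mod_regs c2
  | CFor i _ c => i :: mod_regs c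
  end.

Fixpoint mod_arrays (c : cmd) : seq nat :=
  match c with
  | CPut j _ _ => [:: j]
  | CConst _ _ | CAdd _ _ _ | CSub _ _ _ | CGet _ _ _ => [::]
  | CSeq c1 c2 | CIf _ c1 c2 => mod_arrays c1 ++ mod_arrays c2
  | CFor i _ c => mod_arrays c
  end.

Definition frame (rs js : seq nat) (s s' : state) : Prop :=
  (forall x, x \notin rs -> rg s' x = rg s x) /\
  (forall j, j \notin js -> ar s' j = ar s j).

Lemma frame_refl rs js s : frame rs js s s. Proof. by []. Qed.

Lemma frame_trans rs js s1 s2 s3 : frame rs js s1 s2 -> frame rs js s2 s3 -> frame rs js s1 s3.
Proof.
by move=> [R1 A1] [R2 A2]; split=> [x xr|j jr]; [rewrite R2 ?R1|rewrite A2 ?A1].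
Qed.

Lemma frame_sub rs js rs' js' s s' : {subset rs <= rs'} -> {subset js <= js'} ->
  frame rs js s s' -> frame rs' js' s s'.
Proof.
move=> sr sj [H1 H2]; split=> [x xr|j jr]; [apply: H1|apply: H2]; apply/negP.
  by move/sr => H; rewrite H in xr.
by move/sj => H; rewrite H in jr.
Qed.

Lemma frame_loop rs js f i k len s : i \in rs -> (forall s, frame rs js s (f s).1) ->
  frame rs js s (loop f i k len s).1.
Proof.
move=> ir Hf; elim: len k s => [|len IH] k s //=.
apply: frame_trans (IH _ _); apply: frame_trans (Hf _).
split=> //= x xr; rewrite ifN //; apply: contraNneq xr => ->; exact: ir.
Qed.

Lemma exec_frame c s : frame (mod_regs c) (mod_arrays c) s (exec c s).1.
Proof.
elim: c s => [x k|x y z|x y z|x j y|j x y|c1 IH1 c2 IH2|x c1 IH1 c2 IH2|i x c IH] s /=;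
  try by split=> //= y'; rewrite inE => /negPf->.
- apply: (@frame_trans _ _ _ (exec c1 s).1).
    by apply: frame_sub (IH1 s) => y; rewrite mem_cat => ->.
  by apply: frame_sub (IH2 _) => y; rewrite mem_cat => ->; rewrite orbT.
- case: ifP => _ /=.
    by apply: frame_sub (IH2 _) => y; rewrite mem_cat => ->; rewrite orbT.
  by apply: frame_sub (IH1 s) => y; rewrite mem_cat => ->.
- apply: frame_loop => [|s']; first exact: mem_head.
  by apply: frame_sub (IH s') => // y; rewrite inE orbC => ->.
Qed.

(** The body may assume the frame condition, so the invariant has to speak only of what the loop
    changes. *)
Lemma spec_for (I : nat -> state -> Prop) i x c s t tb (Q : state -> Prop) :
  I 0 s ->
  (forall k s', k < rg s x -> I k s' ->
     frame (mod_regs (CFor i x c)) (mod_arrays c) s s' ->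
     spec c (setr s' i k) tb (I k.+1)) ->
  5 + rg s x * (7 + tb) <= t ->
  (forall s', I (rg s x) s' -> frame (mod_regs (CFor i x c)) (mod_arrays c) s s' -> Q s') ->
  spec (CFor i x c) s t Q.
Proof.
move=> I0 IS tt HQ; set rs := mod_regs _ in IS HQ *; set js := mod_arrays _ in IS HQ *.
have fr s' k : frame rs js s' (exec c (setr s' i k)).1.
  apply: (@frame_trans _ _ _ (setr s' i k)).
    by split=> //= y; rewrite inE negb_or => /andP[/negPf->].
  by apply: frame_sub (exec_frame c _) => // y; rewrite inE orbC => ->.
have main len : forall k s', k + len = rg s x -> I k s' -> frame rs js s s' ->
    [/\ (loop (exec c) i k len s').2 <= 2 + len * (7 + tb),
        I (k + len) (loop (exec c) i k len s').1 &
        frame rs js s (loop (exec c) i k len s').1].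
  elim: len => [|len IH] k s' kl Ik fs /=; first by rewrite addn0.
  have kx : k < rg s x by rewrite -kl; lia.
  have [t1 I1] := IS k s' kx Ik fs.
  have [||t2 I2 f2] := IH k.+1 (exec c (setr s' i k)).1 _ I1; first by rewrite -kl addSnnS.
    exact: frame_trans fs (fr _ _).
  by rewrite addnS -addSn; split=> //; rewrite mulSn; lia.
have [t1 I1 f1] := main _ 0 s erefl I0 (frame_refl _ _ _).
split; first by rewrite /=; apply: leq_trans tt; lia.
by apply: HQ.
Qed.

(** * The algorithm *)

Local Notation "c1 ;; c2" := (CSeq c1 c2) (at level 70, right associativity).

(* [NSUM] holds the sum of the neighbours of each vertex, which at a vertex of
   degree 1 is its only neighbour. *)
Local Notation rn := 0 (only parsing).
Local Notation rone := 1 (only parsing).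
Local Notation rzero := 2 (only parsing).
Local Notation rm := 3 (only parsing).
Local Notation ra := 4 (only parsing).
Local Notation ri := 5 (only parsing).
Local Notation rj := 6 (only parsing).
Local Notation rb := 7 (only parsing).
Local Notation rt := 8 (only parsing).
Local Notation rw := 9 (only parsing).
Local Notation rD := 10 (only parsing).
Local Notation rr := 11 (only parsing).
Local Notation rx := 12 (only parsing).
Local Notation rc := 13 (only parsing).
Local Notation ry := 14 (only parsing).
Local Notation rf := 15 (only parsing).
Local Notation ru := 16 (only parsing).
Local Notation rv := 17 (only parsing).
Local Notation rd := 18 (only parsing).

Local Notation ADJ := 0 (only parsing).
Local Notation EU := 1 (only parsing).
Local Notation EV := 2 (only parsing).
Local Notation DEG := 3 (only parsing).
Local Notation NSUM := 4 (only parsing).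
Local Notation PW := 5 (only parsing).
Local Notation COL := 6 (only parsing).
Local Notation KEY := 7 (only parsing).
Local Notation DICT := 8 (only parsing).
Local Notation DEM := 9 (only parsing).
Local Notation USED := 10 (only parsing).
Local Notation LAB := 11 (only parsing).
Local Notation NL := 12 (only parsing).

Definition copy x y := CAdd x y rzero.
Definition skip := CConst 31 0.

Definition read_edges : cmd :=
  CConst rm 0 ;; CConst ra 0 ;;
  CFor ri rn (CFor rj rn (
    CAdd ra ra rone ;; CGet rb ADJ ra ;;
    CIf rb
      (CPut EU rm ri ;; CPut EV rm rj ;; CAdd rm rm rone ;;
       CGet rt DEG ri ;; CAdd rt rt rone ;; CPut DEG ri rt ;;
       CGet rt NSUM ri ;; CAdd rt rt rj ;; CPut NSUM ri rt)
      skip)).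

(** Multiplication by [n.+1] is done by [n] additions. The last power stays in [rw]; it exceeds
    every key and is the size of a table block. *)
Definition powers : cmd :=
  CConst rw 1 ;; CConst ra 0 ;; CPut PW ra rw ;;
  CFor ri rn (
    copy rt rw ;;
    CFor rj rn (CAdd rw rw rt) ;;
    CAdd ra ri rone ;; CPut PW ra rw).

Definition sum_keys : cmd :=
  CFor ri rn (CPut KEY ri rzero) ;;
  CFor ri rm (
    CGet ru EU ri ;; CGet rv EV ri ;; CGet rc COL rv ;;
    CGet rx KEY ru ;; CAdd rx rx rc ;; CPut KEY ru rx).

(** Each round uses a fresh block of the table, starting at [rD], because clearing [n.+1 ^ n]
    entries would take too long. The entry 0 marks an unseen key, as colours are positive. *)
Definition recolor : cmd :=
  CConst rc 0 ;;
  CFor ri rn (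
    CGet rx KEY ri ;; CAdd rx rx rD ;; CGet ry DICT rx ;;
    CIf ry
      (CPut COL ri ry)
      (CGet ry PW rc ;; CAdd rc rc rone ;; CPut DICT rx ry ;; CPut COL ri ry)) ;;
  CAdd rD rD rw.

Definition refine : cmd :=
  CConst rD 0 ;;
  CFor ri rn (CPut COL ri rone) ;;
  CFor rr rn (sum_keys ;; recolor).

Lemma spec_with_frame c s t (Q : state -> Prop) : spec c s t Q ->
  spec c s t (fun s' => Q s' /\ frame (mod_regs c) (mod_arrays c) s s').
Proof. by move=> [H1 H2]; split=> //; split=> //; apply: exec_frame. Qed.

Lemma spec_cons c1 c2 s t (Q : state -> Prop) : (exec c1 s).2 <= t ->
  spec c2 (exec c1 s).1 (t - (exec c1 s).2) Q -> spec (c1 ;; c2) s t Q.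
Proof. by move=> le [H1 H2]; split=> //=; rewrite -(subnKC le) leq_add2l. Qed.

Lemma spec_if x c1 c2 s t (Q : state -> Prop) : 2 <= t ->
  (rg s x != 0 -> spec c1 s (t - 2) Q) -> (rg s x = 0 -> spec c2 s (t - 2) Q) ->
  spec (CIf x c1 c2) s t Q.
Proof.
move=> t2 H1 H2; rewrite /spec /=; case: eqP => [/H2|/eqP/H1] [T HQ]; split=> //=; lia.
Qed.

Lemma digits_inj B (f g : nat -> nat) m :
  (forall k, f k < B) -> (forall k, g k < B) ->
  \sum_(k < m) f k * B ^ k = \sum_(k < m) g k * B ^ k ->
  forall k, k < m -> f k = g k.
Proof.
elim: m f g => [|m IH] f g fB gB //; rewrite !big_ord_recl !expn0 !muln1 => E.
have B0 : 0 < B by apply: leq_ltn_trans (fB 0).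
have pull (h : nat -> nat) : \sum_(i < m) h (bump 0 i) * B ^ bump 0 i = (\sum_(i < m) h i.+1 * B ^ i) * B.
  by rewrite big_distrl; apply: eq_bigr => i _; rewrite /bump /= add1n expnSr mulnA.
rewrite /= !pull in E.
have E0 : f 0 = g 0.
  have := congr1 (fun x => x %% B) E; rewrite -![_ + _ * B]addnC !modnMDl.
  by rewrite !modn_small.
have E1 : \sum_(i < m) f i.+1 * B ^ i = \sum_(i < m) g i.+1 * B ^ i.
  by move: E; rewrite E0 => /addnI/eqP; rewrite eqn_pmul2r // => /eqP.
case=> [|k] km //; exact: (IH (fun i => f i.+1) (fun i => g i.+1)).
Qed.

Section Program.
Variables (n : nat) (e : rel 'I_n).
Hypothesis fe : forest e.
Local Notation V := 'I_n.

Definition consts (s : state) := [/\ rg s rn = n, rg s rone = 1 & rg s rzero = 0].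

(** The matrix is read row by row, so [u * n + w < k] means that the entry of the pair [u], [w] has
    been read. *)
Definition reads (s : state) (k : nat) : Prop :=
  rg s ra = k /\ exists L : seq (V * V),
  [/\ uniq L, forall p, (p \in L) = e p.1 p.2 && (p.1 * n + p.2 < k), size L = rg s rm &
   [/\ forall q, q < size L -> ar s EU q = nth 0 [seq val p.1 | p <- L] q,
       forall q, q < size L -> ar s EV q = nth 0 [seq val p.2 | p <- L] q,
       forall v : V, ar s DEG v = #|[set w | e v w & v * n + w < k]| &
       forall v : V, ar s NSUM v = \sum_(w | e v w && (v * n + w < k)) w]].

Lemma position_inj (u w i j : V) : u * n + w = i * n + j -> u = i /\ w = j.
Proof.
move=> E; have wn := ltn_ord w; have jn := ltn_ord j.
have n0 : 0 < n by apply: leq_ltn_trans wn.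
have Eu : val u = i.
  by have := congr1 (fun x => x %/ n) E; rewrite !divnMDl // !divn_small // !addn0.
by split; apply: val_inj => //=; move: E; rewrite Eu => /addnI.
Qed.

Lemma sum_pred1 (f : V -> nat) (P : pred V) (j : V) : ~~ P j ->
  \sum_(w | P w || (w == j)) f w = \sum_(w | P w) f w + f j.
Proof.
move=> Pj; rewrite (bigD1 j) ?eqxx ?orbT //= addnC; congr (_ + _).
apply: eq_bigl => w; have [->|] := eqVneq w j; rewrite ?orbF ?andbT ?andbF //.
by rewrite (negPf Pj).
Qed.

Lemma read_step (s' : state) (i j : V) : consts s' -> reads s' (i * n + j) ->
  rg s' ri = i -> rg s' rj = j ->
  ar s' ADJ (1 + i * n + j) = e i j ->
  spec (CAdd ra ra rone ;; CGet rb ADJ ra ;;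
    CIf rb
      (CPut EU rm ri ;; CPut EV rm rj ;; CAdd rm rm rone ;;
       CGet rt DEG ri ;; CAdd rt rt rone ;; CPut DEG ri rt ;;
       CGet rt NSUM ri ;; CAdd rt rt rj ;; CPut NSUM ri rt)
      skip) s' 60 (fun s'' => reads s'' (i * n + j.+1)).
Proof.
move=> [c0 c1 c2] [Ra [L [uL mL sL [U1 U2 D1 S1]]]] Ei Ej Adj.
rewrite /spec /= Ra c1 (_ : i * n + j + 1 = 1 + i * n + j); last by lia.
rewrite Adj; set k := i * n + j in Ra mL D1 S1 *.
have kS : i * n + j.+1 = k.+1 by rewrite addnS.
have lt (u w : V) : (u * n + w < k.+1) = (u * n + w < k) || ((u == i) && (w == j)).
  rewrite ltnS leq_eqVlt orbC; congr (_ || _); apply/eqP/andP => [/position_inj[-> ->]//|].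
  by case=> /eqP-> /eqP->.
rewrite kS; case eij: (e i j) => /=; last first.
  have noe (u w : V) : e u w && (u * n + w < k.+1) = e u w && (u * n + w < k).
    rewrite lt; case euw: (e u w) => //=; case: eqP => [Eu|_]; rewrite ?orbF //=.
    by case: eqP => [Ew|_]; rewrite ?orbF //; rewrite Eu Ew eij in euw.
  split=> //; split=> /=; first by rewrite -kS; lia.
  exists L; split=> //; first by move=> p; rewrite noe.
  split=> // v; rewrite ?D1 ?S1.
    by apply: eq_card => w; rewrite !inE noe.
  by apply: eq_bigl => w; rewrite noe.
have nk : (i * n + j < k) = false by rewrite ltnn.
split=> //; split=> /=; first by rewrite -kS; lia.
rewrite Ei Ej; exists (rcons L (i, j)); split.
- by rewrite rcons_uniq uL mL nk andbF.
- move=> [u w] /=; rewrite mem_rcons inE mL lt xpair_eqE /=.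
  by have [->|] := eqVneq u i; have [->|] := eqVneq w j; rewrite /= ?orbF ?eij ?orbT.
- by rewrite size_rcons sL addn1.
split=> /=.
- move=> q; rewrite size_rcons map_rcons nth_rcons size_map -sL ltnS leq_eqVlt.
  by case/orP=> [/eqP->|ql]; [rewrite eqxx ltnn|rewrite ql U1 // ltn_eqF].
- move=> q; rewrite size_rcons map_rcons nth_rcons size_map -sL ltnS leq_eqVlt.
  by case/orP=> [/eqP->|ql]; [rewrite eqxx ltnn|rewrite ql U2 // ltn_eqF].
- move=> v; have [Ev|nv] := eqVneq (val v) (val i).
    have -> : v = i by apply: val_inj.
    rewrite /= D1 (_ : [set w | e i w & i * n + w < k.+1] = j |: [set w | e i w & i * n + w < k]).
      by rewrite cardsU1 inE nk andbF addnC.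
    apply/setP=> w; rewrite !inE lt eqxx /=; have [->|] := eqVneq w j; rewrite ?eij ?orbT ?orbF //.
  rewrite D1; apply: eq_card => w; rewrite !inE lt.
  by rewrite (_ : (v == i) = false) ?orbF //; apply: negbTE.
- move=> v; have [Ev|nv] := eqVneq (val v) (val i).
    have -> : v = i by apply: val_inj.
    rewrite S1 -(sum_pred1 (fun w => val w) (P := fun w => e i w && (i * n + w < k))) ?nk ?andbF //.
    apply: eq_bigl => w; rewrite lt eqxx /=; have [->|] := eqVneq w j; rewrite ?eij ?orbT ?orbF //.
  rewrite S1; apply: eq_bigl => w; rewrite lt.
  by rewrite (_ : (v == i) = false) ?orbF //; apply: negbTE.
Qed.

Definition adj_input (s : state) := forall i j : V, ar s ADJ (1 + i * n + j) = e i j.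

Definition edges_read (s : state) (L : seq (V * V)) : Prop :=
  [/\ uniq L, forall p, (p \in L) = e p.1 p.2, size L = rg s rm &
   (forall q, q < size L -> ar s EU q = nth 0 [seq val p.1 | p <- L] q) /\
   (forall q, q < size L -> ar s EV q = nth 0 [seq val p.2 | p <- L] q)].

Lemma read_edges_spec s : consts s -> adj_input s ->
  (forall v, ar s DEG v = 0) -> (forall v, ar s NSUM v = 0) ->
  spec read_edges s (7 + n * (12 + n * 67)) (fun s' =>
    [/\ exists L, edges_read s' L,
        forall v : V, ar s' DEG v = deg e v &
        forall v : V, ar s' NSUM v = \sum_(w | e v w) w]).
Proof.
move=> [c0 c1 c2] adj d0 s0.
apply: (@spec_seq _ _ _ _ 1 (6 + n * (12 + n * 67))); last by lia.
split=> //; apply: (@spec_seq _ _ _ _ 1 (5 + n * (12 + n * 67))); last by lia.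
split=> //=.
apply: (@spec_for (fun i s' => reads s' (i * n)) _ _ _ _ _ (5 + n * 67)) => /=.
- split=> //; exists [::]; split=> //.
  + by move=> p; rewrite ltn0 andbF.
  + split=> // v /=; first by rewrite d0 eq_card0 // => w; rewrite !inE ltn0 andbF.
    by rewrite s0 big1 // => w; rewrite ltn0 andbF.
- rewrite c0 => i s' ilt Ri fr.
  apply: (@spec_for (fun j s'' => reads s'' (i * n + j)) _ _ _ _ _ 60) => /=.
  + by rewrite addn0; exact: Ri.
  + have n' : rg s' 0 = n by rewrite (proj1 fr).
    rewrite n' => j s'' jlt Rj fr'.
    apply: (read_step (i := Ordinal ilt) (j := Ordinal jlt)) => //=.
    * by split; rewrite /= (proj1 fr') //= ?(proj1 fr) //=.
    * by rewrite (proj1 fr').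
    * by rewrite (proj2 fr') //= (proj2 fr) // -(adj (Ordinal ilt) (Ordinal jlt)).
  + by have -> : rg s' 0 = n; [rewrite (proj1 fr)|lia].
  + have n' : rg s' 0 = n by rewrite (proj1 fr).
    by move=> s''; rewrite n' mulSn addnC.
- by rewrite c0; lia.
- rewrite c0 => s' [_ [L [uL mL sL [U1 U2 D1 S1]]]] fr.
  have lt (u w : V) : u * n + w < n * n.
    apply: (@leq_trans (u * n + n)); first by rewrite ltn_add2l.
    by rewrite addnC -mulSn leq_mul2r ltn_ord orbT.
  split.
  + by exists L; split=> // p; rewrite mL lt andbT.
  + by move=> v; rewrite D1; apply: eq_card => w; rewrite !inE lt andbT.
  + by move=> v; rewrite S1; apply: eq_bigl => w; rewrite lt andbT.
Qed.

Lemma powers_spec s : consts s ->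
  spec powers s (14 + n * (21 + n * 8)) (fun s' =>
    rg s' rw = n.+1 ^ n /\ forall k, k <= n -> ar s' PW k = n.+1 ^ k).
Proof.
move=> [c0 c1 c2].
do 3!(apply: spec_cons => //=).
apply: (@spec_for (fun k s' => rg s' rw = n.+1 ^ k /\ forall q, q <= k -> ar s' PW q = n.+1 ^ q)
  _ _ _ _ _ (14 + n * 8)) => /=.
- by split=> // q; rewrite leqn0 => /eqP->.
- rewrite c0 => k s' kn [W P] fr.
  have n' : rg s' 0 = n by rewrite (proj1 fr).
  have o' : rg s' 1 = 1 by rewrite (proj1 fr).
  have z' : rg s' 2 = 0 by rewrite (proj1 fr).
  apply: spec_cons => //=.
  apply: (@spec_seq _ _ _ _ (5 + n * 8) 8); last by lia.
  apply: (@spec_for (fun j s'' => rg s'' rw = j.+1 * n.+1 ^ k) _ _ _ _ _ 1) => /=.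
  + by rewrite W mul1n.
  + rewrite n' => j s'' jn W' fr'; split=> //=.
    by rewrite W' (proj1 fr') //= W z' addn0 mulSn addnC.
  + by rewrite n'.
  + rewrite n' => s'' W' fr'; split=> //=.
    have i'' : rg s'' 5 = k by rewrite (proj1 fr').
    have o'' : rg s'' 1 = 1 by rewrite (proj1 fr').
    rewrite i'' o'' W' expnS addn1; split=> // q.
    rewrite leq_eqVlt ltnS; case: eqP => [->|_] //= qk.
      by rewrite expnS.
    by rewrite (proj2 fr') //= P.
- by rewrite c0; lia.
- by rewrite c0.
Qed.


(* The colour classes are named by powers of [n + 1], so that the sum of the
   colours of the neighbours determines how often each colour occurs. *)
Definition coloring (s : state) (kap : V -> nat) : Prop :=
  (forall v, kap v < n) /\ forall v : V, ar s COL v = n.+1 ^ kap v.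

Definition key_of (kap : V -> nat) (u : V) := \sum_(w | e u w) n.+1 ^ kap w.

Lemma key_of_lt kap u : (forall v, kap v < n) -> key_of kap u < n.+1 ^ n.
Proof.
move=> kn; have n0 : 0 < n by apply: leq_ltn_trans (ltn_ord u).
apply: (@leq_ltn_trans (n * n.+1 ^ n.-1)).
  rewrite -[n in n * _](card_ord n) -sum_nat_const [X in X <= _]big_mkcond /=.
  apply: leq_sum => w _; case: ifP => // _; rewrite leq_exp2l //.
  by have := kn w; lia.
by move: n0; case: (n) => // m _; rewrite expnS ltn_mul2r expn_gt0 ltnSn.
Qed.

Lemma key_of_digits kap u : (forall v, kap v < n) ->
  key_of kap u = \sum_(k < n) #|[set w | e u w & kap w == k]| * n.+1 ^ k.
Proof.
move=> kn; rewrite /key_of (partition_big (fun w => Ordinal (kn w)) predT) //=.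
apply: eq_bigr => k _.
rewrite (eq_bigr (fun=> n.+1 ^ k)) => [|w /andP[_ /eqP <-] //].
rewrite sum_nat_const; congr (_ * _); apply: eq_card => w.
by rewrite [RHS]inE.
Qed.

(** A digit counts at most [n] neighbours, so no carries occur in base [n.+1] and the sum determines
    all counts. *)
Lemma key_of_eq kap u v : (forall v, kap v < n) ->
  (key_of kap u = key_of kap v <->
   forall k, #|[set w | e u w & n.+1 ^ kap w == k]| = #|[set w | e v w & n.+1 ^ kap w == k]|).
Proof.
move=> kn; have n0 : 0 < n by apply: leq_ltn_trans (ltn_ord u).
have pow (k : nat) x : [set w | e x w & n.+1 ^ kap w == n.+1 ^ k] = [set w | e x w & kap w == k].
  by apply/setP=> w; rewrite !inE eqn_exp2l.
have bd x k : #|[set w | e x w & kap w == k]| < n.+1.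
  by rewrite ltnS; apply: leq_trans (max_card _) _; rewrite card_ord.
split=> [E k|E]; last first.
  by rewrite !key_of_digits //; apply: eq_bigr => k _; rewrite -!pow E.
rewrite !key_of_digits // in E.
have H := digits_inj (bd u) (bd v) E.
have [/existsP[w /eqP <-]|] := boolP [exists w, n.+1 ^ kap w == k]; first by rewrite !pow H.
rewrite negb_exists => /forallP no.
by rewrite !eq_card0 // => w; rewrite !inE (negPf (no w)) andbF.
Qed.

Lemma edge_sum (L : seq (V * V)) (f : V -> nat) u : uniq L ->
  (forall p, (p \in L) = e p.1 p.2) ->
  \sum_(p <- L | p.1 == u) f p.2 = \sum_(w | e u w) f w.
Proof.
move=> uL mL; rewrite -big_filter -[RHS]big_filter -(big_map snd predT f) /=.
apply: perm_big; apply: uniq_perm.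
- rewrite map_inj_in_uniq ?filter_uniq // => -[a b] [a' b'].
  by rewrite !mem_filter /= => /andP[/eqP-> _] /andP[/eqP-> _] ->.
- by rewrite filter_uniq // index_enum_uniq.
- move=> w; rewrite mem_filter mem_index_enum andbT; apply/mapP/idP => [[[a b]]|uw].
    by rewrite mem_filter /= mL => /andP[/eqP-> /= ab ->].
  by exists (u, w); rewrite // mem_filter eqxx mL.
Qed.

Lemma sum_keys_spec s L kap : consts s -> edges_read s L -> rg s rm <= 2 * n -> coloring s kap ->
  spec sum_keys s (10 + n * 14 + 2 * n * 50) (fun s' => forall u : V, ar s' KEY u = key_of kap u).
Proof.
move=> [c0 c1 c2] [uL mL sL [U1 U2]] m2 [kn colE].
apply: (@spec_seq _ _ _ _ (5 + n * 14) (5 + 2 * n * 50)); last by lia.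
apply: (@spec_for (fun k s' => forall v, v < k -> ar s' KEY v = 0) _ _ _ _ _ 7) => //=.
- move=> k s' kn' Z fr; split=> //= v; rewrite (proj1 fr) //= c2 ltnS leq_eqVlt.
  by case: eqP => //= _ /Z.
- by rewrite c0.
rewrite c0 => s1 Z fr1.
have m1 : rg s1 rm = rg s rm by rewrite (proj1 fr1).
apply: (@spec_for (fun k s' => forall u : V,
    ar s' KEY u = \sum_(p <- take k L | p.1 == u) n.+1 ^ kap p.2) _ _ _ _ _ 43) => //=.
- by move=> u; rewrite take0 big_nil Z.
- rewrite m1 -sL => k s' kL I fr; split=> //= u.
  have E1 : ar s' EU k = nth 0 [seq val p.1 | p <- L] k by rewrite (proj2 fr) // (proj2 fr1) // U1.
  have E2 : ar s' EV k = nth 0 [seq val p.2 | p <- L] k by rewrite (proj2 fr) // (proj2 fr1) // U2.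
  have EC v : ar s' COL v = ar s COL v by rewrite (proj2 fr) // (proj2 fr1).
  have [p0 _] : exists p, p \in L by case: (L) kL => // p l _; exists p; rewrite mem_head.
  rewrite E1 E2 !(nth_map p0) // EC colE (take_nth p0) // -cats1 big_cat /= big_cons big_nil addn0.
  have [Eu|nu] := eqVneq u (nth p0 L k).1; first by rewrite -Eu !eqxx I.
  have nuv : (val u == val (nth p0 L k).1) = false by rewrite val_eqE (negPf nu).
  by rewrite nuv ?addn0 I ?addn0.
- by rewrite m1; nia.
- by rewrite m1 -sL => s' I fr u; rewrite I take_size (edge_sum (fun w => n.+1 ^ kap w) _ uL mL).
Qed.

Lemma recolor_spec s kap : consts s -> rg s rw = n.+1 ^ n ->
  (forall k, k <= n -> ar s PW k = n.+1 ^ k) ->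
  (forall v, kap v < n) -> (forall u : V, ar s KEY u = key_of kap u) ->
  (forall x, ar s DICT (rg s rD + x) = 0) ->
  spec recolor s (10 + n * 50) (fun s' =>
    (forall x, ar s' DICT (rg s' rD + x) = 0) /\
    exists kap', coloring s' kap' /\
      forall u v, kap' u = kap' v <-> key_of kap u = key_of kap v).
Proof.
move=> [c0 c1 c2] W P kn K D0.
apply: spec_cons => //=.
apply: (@spec_seq _ _ _ _ (5 + n * 50) 1); last by lia.
pose D := rg s rD.
(* The bound on the places of nonzero entries leaves the next block empty; the injectivity clause
   makes equal colours come from equal keys. *)
apply: (@spec_for (fun k s' => [/\ rg s' rc <= k,
    forall x, ar s' DICT (D + x) != 0 -> x < n.+1 ^ n /\
       exists2 q, q < rg s' rc & ar s' DICT (D + x) = n.+1 ^ q,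
    forall x y, ar s' DICT (D + x) != 0 -> ar s' DICT (D + x) = ar s' DICT (D + y) -> x = y &
    forall v : V, v < k -> ar s' COL v = ar s' DICT (D + key_of kap v) /\ ar s' COL v != 0])
  _ _ _ _ _ 40) => /=.
- by split=> // x; rewrite D0.
- rewrite c0 => k s' klt [cnt dic inj col] fr.
  pose v0 := Ordinal klt.
  have n0 : 0 < n := leq_ltn_trans (leq0n k) klt.
  have E1 : ar s' KEY k = key_of kap v0 by rewrite (proj2 fr) // -K.
  have E2 : rg s' rD = D by rewrite (proj1 fr).
  have E3 : rg s' rone = 1 by rewrite (proj1 fr).
  have E4 q : q <= n -> ar s' PW q = n.+1 ^ q by move=> qn; rewrite (proj2 fr) //= P.
  have key0 : key_of kap v0 + D = D + key_of kap v0 by rewrite addnC.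
  have kv (v : V) : v < k.+1 = (v < k) || (v == v0).
    by rewrite ltnS leq_eqVlt orbC.
  rewrite /spec /= E1 E2 key0; case: ifP => [/eqP Z|/negbT NZ] /=; last first.
    split=> //=; split=> //=; first exact: leqW.
    move=> v; rewrite kv -val_eqE /=; case: eqP => [Ev _|_].
      have -> : v = v0 by apply: val_inj.
      by [].
    by rewrite orbF => /col.
  have cn : rg s' rc < n := leq_ltn_trans cnt klt.
  split=> //=; rewrite E3 addn1 E4; last exact: ltnW.
  split=> /=; first by rewrite ltnS.
  + move=> x; rewrite eqn_add2l; case: (x =P _) => [-> _|_ /dic[xn [q qc ->]]].
      by split; [exact: key_of_lt|exists (rg s' rc)].
    by split=> //; exists q => //; apply: leqW.
  + have fresh x : ar s' DICT (D + x) = n.+1 ^ rg s' rc -> False.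
      move=> E; have [|_ [q qc]] := dic x; first by rewrite E expn_eq0.
      by rewrite E => /eqP; rewrite eqn_exp2l // => /eqP Eq; rewrite Eq ltnn in qc.
    move=> x y; rewrite !eqn_add2l; case: (x =P _) => [->|_]; case: (y =P _) => [->|_] //.
    * by move=> _ /esym/fresh.
    * by move=> _ /fresh.
    * exact: inj.
  + move=> v; rewrite kv -val_eqE /= eqn_add2l; case: eqP => [Ev _|_].
      have -> : v = v0 by apply: val_inj.
      by rewrite eqxx expn_eq0.
    rewrite orbF => /col[E nz]; split=> //.
    by case: eqP => // Ek; move: nz; rewrite E Ek Z.
- by rewrite c0; lia.
- rewrite c0 => s' [cnt dic inj col] fr; split=> //=.
  have E2 : rg s' rD = D by rewrite (proj1 fr).
  have EW : rg s' rw = n.+1 ^ n by rewrite (proj1 fr).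
  rewrite E2 EW; split=> [x|].
    apply/eqP; apply: contraT; rewrite -addnA => /dic[].
    by rewrite ltnNge leq_addr.
  have ex v : exists q : 'I_n, ar s' COL (v : V) == n.+1 ^ q.
    have [E nz] := col v (ltn_ord v); rewrite E in nz.
    have [_ [q qc Eq]] := dic _ nz.
    by exists (Ordinal (leq_trans qc cnt)); rewrite E Eq.
  pose kap' v : nat := odflt v [pick q : 'I_n | ar s' COL (v : V) == n.+1 ^ q].
  have kapE v : ar s' COL (v : V) = n.+1 ^ kap' v.
    rewrite /kap'; case: pickP => [q /eqP //|no].
    by have [q] := ex v; rewrite no.
  exists kap'; split=> [|u v]; first by split=> v; [apply: ltn_ord|apply: kapE].
  have [Eu nu] := col u (ltn_ord u); have [Ev nv] := col v (ltn_ord v).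
  split=> E.
    apply: inj; first by rewrite -Eu.
    by rewrite -Eu -Ev !kapE E.
  have n0 : 0 < n by apply: leq_ltn_trans (ltn_ord u).
  by have := kapE u; rewrite Eu E -Ev kapE => /eqP; rewrite eqn_exp2l // => /eqP.
Qed.

Lemma refine_spec s L : consts s -> edges_read s L -> rg s rm <= 2 * n -> rg s rw = n.+1 ^ n ->
  (forall k, k <= n -> ar s PW k = n.+1 ^ k) -> (forall x, ar s DICT x = 0) ->
  spec refine s (20 + n * 14 + n * (40 + n * 180)) (fun s' =>
    exists col, [/\ color_refinement e col, forall v : V, ar s' COL v = col n v &
      forall v : V, col n v != 0]).
Proof.
move=> [c0 c1 c2] eL m2 W P D0.
apply: spec_cons => //=.
apply: (@spec_seq _ _ _ _ (5 + n * 14) (5 + n * (40 + n * 180))); last by lia.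
apply: (@spec_for (fun k s' => forall v, v < k -> ar s' COL v = 1) _ _ _ _ _ 7) => //=.
- move=> k s' kn' Z fr; split=> //= v; rewrite (proj1 fr) //= c1 ltnS leq_eqVlt.
  by case: eqP => //= _ /Z.
- by rewrite c0.
rewrite c0 => s1 C1 fr1.
have n1 : rg s1 rn = n by rewrite (proj1 fr1).
apply: (@spec_for (fun t s' => (forall x, ar s' DICT (rg s' rD + x) = 0) /\
   exists (col : nat -> V -> nat) kap, [/\ forall u v, col 0 u = col 0 v,
     forall t' u v, t' < t -> (col t'.+1 u = col t'.+1 v <->
        forall k, #|[set w | e u w & col t' w == k]| = #|[set w | e v w & col t' w == k]|),
     coloring s' kap & forall v, col t v = n.+1 ^ kap v]) _ _ _ _ _ (30 + n * 180)) => //=.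
- split=> [x|]; first by rewrite (proj2 fr1) //= D0.
  exists (fun _ _ => 1), (fun=> 0); split=> //.
  split=> [v|v]; first by apply: leq_ltn_trans (ltn_ord v).
  by rewrite expn0 C1.
- rewrite n1 => t s' tn [D0' [col [kap [col0 colS [kn colE] colt]]]] fr.
  have cs' : consts (setr s' rr t) by split; rewrite /= (proj1 fr) // (proj1 fr1).
  have ms' : rg s' rm = rg s rm by rewrite (proj1 fr) // (proj1 fr1).
  apply: (@spec_seq _ _ _ _ (10 + n * 14 + 2 * n * 50) (10 + n * 50)); last by lia.
  have eL' : edges_read (setr s' rr t) L.
    case: eL => uL mL sL [U1 U2]; split=> //; first by rewrite /= ms'.
    by split=> q qL; rewrite /= (proj2 fr) // (proj2 fr1) ?U1 ?U2.
  apply: spec_weaken (leqnn _) _.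
    apply: spec_with_frame.
    by apply: (sum_keys_spec (kap := kap) cs' eL'); [rewrite /= ms'|split].
  move=> s2 [K fr2].
  have n0 : 0 < n by apply: leq_ltn_trans tn.
  apply: spec_weaken (leqnn _) _.
    apply: (recolor_spec (kap := kap)) => //.
    + by case: cs' => *; split; rewrite (proj1 fr2).
    + by rewrite (proj1 fr2) //= (proj1 fr) // (proj1 fr1).
    + by move=> k kn'; rewrite (proj2 fr2) //= (proj2 fr) // (proj2 fr1) // P.
    + by move=> x; rewrite (proj2 fr2) //= (proj1 fr2) //= D0'.
  move=> s3 [D3 [kap' [C3 K3]]]; split=> //.
  (* Memory holds only the current colouring; the sequence [col] lives in the proof and grows by one
     term per round. *)
  exists (fun t' => if t' <= t then col t' else fun v => n.+1 ^ kap' v), kap'; split=> //.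
  + move=> t' u v t't; have [->|lt] : t' = t \/ t' < t by lia.
    2: by rewrite lt (ltnW lt); apply: colS.
    rewrite ltnn leqnn.
    have -> : (n.+1 ^ kap' u = n.+1 ^ kap' v) <-> (kap' u = kap' v).
      by split=> [/eqP|-> //]; rewrite eqn_exp2l // => /eqP.
    rewrite K3 key_of_eq //; split=> H k; have := H k; rewrite ?/(is_true _).
      by under eq_finset => w do rewrite -colt; under [in X in _ = X]eq_finset => w do rewrite -colt.
    by under eq_finset => w do rewrite colt; under [in X in _ = X]eq_finset => w do rewrite colt.
  + by move=> v; rewrite ltnn.
- by rewrite n1; lia.
- rewrite n1 => s' [_ [col [kap [col0 colS [kn colE] colt]]]] _; exists col; split=> //.
  + by move=> v; rewrite colE colt.
  + by move=> v; rewrite colt expn_eq0.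
Qed.

End Program.

(** * Demands, peeling and the verdict *)

Definition count_leaves : cmd :=
  CFor ri rn (CPut NL ri rzero) ;;
  CFor ri rm (
    CGet ru EU ri ;; CGet rv EV ri ;; CGet rd DEG rv ;; CSub rd rd rone ;;
    CIf rd skip (CGet rx NL ru ;; CAdd rx rx rone ;; CPut NL ru rx)).

(** Truncated subtraction of 1 separates 0 and 1 from larger numbers and so tests for degree 1 and
    for stars. A label is set only at demand 1; the label 0 means that there is none. *)
Definition demands : cmd :=
  CFor ri rn (
    CGet rd DEG ri ;;
    CIf rd
      (CSub rd rd rone ;;
       CIf rd
         (CGet rx NL ri ;; CSub rx rx rone ;; CIf rx (CConst ry 0) (CConst ry 2))
         (CGet ru NSUM ri ;; CGet rx NL ru ;; CSub rx rx rone ;;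
          CIf rx (CConst ry 0)
            (CConst ry 1 ;; CGet rc COL ri ;; CPut LAB ri rc)))
      (CConst ry 0) ;;
    CPut DEM ri ry).

Definition find_leaf : cmd :=
  CConst rb 0 ;; CConst rv 0 ;;
  CFor ri rn (
    CGet rd DEG ri ;;
    CIf rd (CSub rd rd rone ;; CIf rd skip (copy rv ri ;; CConst rb 1)) skip).

Definition remove_edge : cmd :=
  CGet ru NSUM rv ;; CPut DEG rv rzero ;; CPut NSUM rv rzero ;;
  CGet rd DEG ru ;; CSub rd rd rone ;; CPut DEG ru rd ;;
  CGet rd NSUM ru ;; CSub rd rd rv ;; CPut NSUM ru rd.

(** [rf] collects errors: of two truncated differences one is positive exactly if the labels differ,
    and a used edge whose removed leaf has no label is an error too. *)
Definition merge_labels : cmd :=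
  CGet rx LAB rv ;; CGet ry LAB ru ;;
  CIf ry
    (CSub rt rx ry ;; CAdd rf rf rt ;; CSub rt ry rx ;; CAdd rf rf rt)
    (CPut LAB ru rx) ;;
  CIf rx skip (CAdd rf rf rone).

Definition use_edge : cmd :=
  CGet ry USED rv ;; CAdd ry ry rone ;; CPut USED rv ry ;;
  CGet ry USED ru ;; CAdd ry ry rone ;; CPut USED ru ry ;;
  merge_labels.

(** All other edges at the leaf are already decided, so this one is needed exactly if the demand is
    not yet met. *)
Definition peel_leaf : cmd :=
  remove_edge ;;
  CGet rx DEM rv ;; CGet ry USED rv ;; CSub rx rx ry ;;
  CIf rx use_edge skip.

Definition peel : cmd :=
  CConst rf 0 ;; CFor rr rn (find_leaf ;; CIf rb peel_leaf skip).

Definition verdict : cmd :=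
  CFor ri rn (
    CGet rx DEM ri ;; CGet ry USED ri ;;
    CSub rt rx ry ;; CAdd rf rf rt ;; CSub rt ry rx ;; CAdd rf rf rt) ;;
  CIf rf (CConst rn 0) (CConst rn 1).

Section Peeling.
Variables (n : nat) (e : rel 'I_n).
Hypothesis fe : forest e.
Local Notation V := 'I_n.

Lemma count_leaves_spec s L : consts n s -> edges_read e s L -> rg s rm <= 2 * n ->
  (forall v : V, ar s DEG v = deg e v) ->
  spec count_leaves s (10 + n * 14 + 2 * n * 60) (fun s' =>
    forall u : V, ar s' NL u = #|[set w | e u w & deg e w == 1]|).
Proof.
move=> [c0 c1 c2] [uL mL sL [U1 U2]] m2 DE.
apply: (@spec_seq _ _ _ _ (5 + n * 14) (5 + 2 * n * 60)); last by lia.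
apply: (@spec_for (fun k s' => forall v, v < k -> ar s' NL v = 0) _ _ _ _ _ 7) => //=.
- move=> k s' kn' Z fr; split=> //= v; rewrite (proj1 fr) //= c2 ltnS leq_eqVlt.
  by case: eqP => //= _ /Z.
- by rewrite c0.
rewrite c0 => s1 Z fr1.
have m1 : rg s1 rm = rg s rm by rewrite (proj1 fr1).
have o1 : rg s1 rone = 1 by rewrite (proj1 fr1).
apply: (@spec_for (fun k s' => forall u : V,
    ar s' NL u = \sum_(p <- take k L | p.1 == u) (deg e p.2 == 1)) _ _ _ _ _ 50) => //=.
- by move=> u; rewrite take0 big_nil Z.
- rewrite m1 -sL => k s' kL I fr.
  have E1 : ar s' EU k = nth 0 [seq val p.1 | p <- L] k by rewrite (proj2 fr) // (proj2 fr1) // U1.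
  have E2 : ar s' EV k = nth 0 [seq val p.2 | p <- L] k by rewrite (proj2 fr) // (proj2 fr1) // U2.
  have ED v : ar s' DEG v = ar s DEG v by rewrite (proj2 fr) // (proj2 fr1).
  have o' : rg s' rone = 1 by rewrite (proj1 fr).
  have [p0 _] : exists p, p \in L by case: (L) kL => // p l _; exists p; rewrite mem_head.
  rewrite /spec /= E1 E2 !(nth_map p0) // ED DE o'.
  set p := nth p0 L k.
  have : e p.1 p.2 by rewrite -mL mem_nth.
  rewrite (forest_sym fe) => /deg_gt0 d0.
  have eq0 : (deg e p.2 - 1 == 0) = (deg e p.2 == 1) by lia.
  have step u : \sum_(q <- take k.+1 L | q.1 == u) (deg e q.2 == 1) =
      \sum_(q <- take k L | q.1 == u) (deg e q.2 == 1) + (if p.1 == u then (deg e p.2 == 1 : nat) else 0).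
    by rewrite (take_nth p0) // -cats1 big_cat /= big_cons big_nil -/p; case: ifP; rewrite ?addn0.
  rewrite eq0; case d1: (deg e p.2 == 1) => /=; split=> //= u; rewrite step d1 I.
    have -> : (val u == val p.1) = (p.1 == u) by rewrite val_eqE eq_sym.
    by case: eqP => [->|_]; rewrite ?I ?addn0.
  by case: ifP; rewrite addn0.
- by rewrite m1; nia.
- rewrite m1 -sL => s' I fr u; rewrite I take_size (edge_sum (fun w => deg e w == 1) _ uL mL).
  rewrite -sum1dep_card big_mkcond [RHS]big_mkcond /=; apply: eq_bigr => w _.
  by case: (e u w) => //=; case: (_ == 1).
Qed.

Lemma demands_spec s (c : V -> nat) : consts n s ->
  (forall v : V, ar s DEG v = deg e v) -> (forall v : V, ar s NSUM v = \sum_(w | e v w) w) ->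
  (forall u : V, ar s NL u = #|[set w | e u w & deg e w == 1]|) ->
  (forall v : V, ar s COL v = c v) -> (forall v, ar s LAB v = 0) ->
  spec demands s (5 + n * 70) (fun s' =>
    forall v : V, ar s' DEM v = demand e v /\
      ar s' LAB v = if demand e v == 1 then c v else 0).
Proof.
move=> [c0 c1 c2] D S N C Z; have es := forest_sym fe.
apply: (@spec_for (fun k s' => forall v : V,
   (v < k -> ar s' DEM v = demand e v) /\
   ar s' LAB v = if (v < k) && (demand e v == 1) then c v else 0) _ _ _ _ _ 60) => //=.
- rewrite c0 => k s' kn I fr; pose v0 := Ordinal kn.
  have ED : ar s' DEG k = deg e v0 by rewrite (proj2 fr) // -D.
  have EN (v : V) : ar s' NL v = #|[set w | e v w & deg e w == 1]| by rewrite (proj2 fr).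
  have ES : ar s' NSUM k = \sum_(w | e v0 w) w by rewrite (proj2 fr) // -S.
  have EC : ar s' COL k = c v0 by rewrite (proj2 fr) // -C.
  have o' : rg s' rone = 1 by rewrite (proj1 fr).
  have done' s2 t dv : dv = demand e v0 -> t <= 60 -> ar s2 DEM = ar s' DEM ->
      (forall i, ar s2 LAB i = if (i == k) && (demand e v0 == 1) then c v0 else ar s' LAB i) ->
      t <= 60 /\ forall v : V, (v < k.+1 -> (if val v == k then dv else ar s2 DEM v) = demand e v) /\
      ar s2 LAB v = if (v < k.+1) && (demand e v == 1) then c v else 0.
    move=> -> t60 E2 L2; split=> // v; rewrite L2 E2 ltnS leq_eqVlt.
    have [Ev|nv] := eqVneq (val v) k; last by have [I1 I2] := I v.
    have -> : v = v0 by apply: val_inj.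
    by split=> //=; case: ifP => // nd; have [_ ->] := I v0; rewrite ltnn.
  rewrite /spec /= ED o'; case: (deg e v0 =P 0) => [d0|d0] /=.
    have E0 : demand e v0 = 0 by rewrite /demand d0.
    apply: (done' s' _ 0) => // i; by rewrite E0 andbF.
  have eq0 : (deg e v0 - 1 == 0) = (deg e v0 == 1) by lia.
  rewrite eq0; case: (deg e v0 =P 1) => [d1|d1] /=.
    have/card_gt0P[u] : 0 < deg e v0 by rewrite d1.
    rewrite in_rel => vu.
    have Eu : ar s' NSUM k = u.
      rewrite ES (bigD1 u) //= big1 ?addn0 // => w /andP[vw wu].
      by rewrite (deg1_nbr d1 vw vu) eqxx in wu.
    have st : (#|[set w | e u w & deg e w == 1]| - 1 == 0) = ~~ star e u.
      by rewrite /star; lia.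
    rewrite Eu EN st; case su: (star e u) => /=.
      have E0 : demand e v0 = 0 by rewrite /demand d1 eqxx (star_leaf_nbr es d1 vu) su.
      apply: (done' s' _ 0) => // i; by rewrite E0 andbF.
    have E1 : demand e v0 = 1 by rewrite /demand d1 eqxx (star_leaf_nbr es d1 vu) su.
    rewrite EC.
    apply: (done' (seta s' LAB k (c v0)) _ 1) => // i; by rewrite E1 eqxx andbT.
  have st : (#|[set w | e v0 w & deg e w == 1]| - 1 == 0) = ~~ star e v0.
    by rewrite /star; lia.
  have -> : ar s' NL k = #|[set w | e v0 w & deg e w == 1]| by rewrite -EN.
  rewrite st; case sv: (star e v0) => /=.
    have E0 : demand e v0 = 0 by rewrite star_demand.
    apply: (done' s' _ 0) => // i; by rewrite E0 andbF.
  have E2 : demand e v0 = 2.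
    by rewrite /demand sv; case: eqP => // _; case: eqP.
  apply: (done' s' _ 2) => // i; by rewrite E2 andbF.
- by rewrite c0; lia.
- rewrite c0 => s' I _ v; have [-> // ->] := I v; by rewrite ltn_ord.
Qed.

Lemma find_leaf_spec s : consts n s ->
  spec find_leaf s (10 + n * 30) (fun s' =>
    (rg s' rb = 0 /\ forall v : V, ar s' DEG v != 1) \/
    (rg s' rb = 1 /\ exists v : V, rg s' rv = v /\ ar s' DEG v = 1)).
Proof.
move=> [c0 c1 c2]; do 2!(apply: spec_cons => //=).
apply: (@spec_for (fun k s' =>
    (rg s' rb = 0 /\ forall v : V, v < k -> ar s' DEG v != 1) \/
    (rg s' rb = 1 /\ exists v : V, rg s' rv = v /\ ar s' DEG v = 1)) _ _ _ _ _ 20) => //=.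
- by left.
- rewrite c0 => k s' kn I fr; pose v0 := Ordinal kn.
  have o' : rg s' rone = 1 by rewrite (proj1 fr).
  have z' : rg s' rzero = 0 by rewrite (proj1 fr).
  have skipped : ar s' DEG k != 1 ->
     (rg s' rb = 0 /\ forall v : V, v < k.+1 -> ar s' DEG v != 1) \/
     (rg s' rb = 1 /\ exists v : V, rg s' rv = v /\ ar s' DEG v = 1).
    move=> n1; case: I => [[b0 I]|[b1 I]]; [left|right] => //; split=> // v.
    by rewrite ltnS leq_eqVlt => /orP[/eqP->|/I].
  rewrite /spec /= o'; case: (ar s' DEG k =P 0) => [d0|d0] /=.
    by split=> //; apply: skipped; rewrite d0.
  case: (ar s' DEG k - 1 =P 0) => d1 /=; split=> //.
    by right; split=> //; exists v0; rewrite z' addn0; split=> //=; lia.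
  by apply: skipped; apply/eqP; lia.
- by rewrite c0; lia.
- rewrite c0 => s' [[b0 I]|I] _; [left|by right].
  by split=> // v; apply: I.
Qed.

(* [r] is the set of edges not yet removed and [F] the set of removed edges that
   were put on a path. *)
Definition peeling (r F : rel V) (s : state) : Prop :=
  [/\ symmetric r /\ symmetric F, subrel r e, forall u v, F u v -> e u v && ~~ r u v &
   [/\ forall v : V, ar s DEG v = #|r v|, forall v : V, ar s NSUM v = \sum_(w | r v w) w &
       forall v : V, ar s USED v = #|F v|]].

(** This holds whether or not a factor exists. If in the end no error is recorded and all demands
    are met, it makes [F] with the labels in memory a balanced factor. *)
Definition labels_sound (c : V -> nat) (F : rel V) (s : state) : Prop :=
  (forall v : V, demand e v = 1 -> ar s LAB v = c v) /\
  (rg s rf = 0 -> forall u w : V, F u w -> ar s LAB u = ar s LAB w /\ ar s LAB u <> 0).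

(** If a factor exists, the run follows it edge by edge without recording an error. The last clause
    ensures that a vertex already on a path has a label to pass on. *)
Definition labels_complete (c : V -> nat) (r F : rel V) (s : state) : Prop :=
  forall F0 lab0, balanced_factor e F0 lab0 c ->
  [/\ rg s rf = 0, forall u v, F u v = F0 u v && ~~ r u v,
      forall v : V, ar s LAB v <> 0 -> ar s LAB v = lab0 v &
      forall v : V, 0 < #|F v| -> ar s LAB v <> 0].

Lemma remove_edge_spec s (v p : V) : consts n s -> rg s rv = v -> ar s NSUM v = p -> v != p ->
  spec remove_edge s 60 (fun s' =>
    [/\ rg s' ru = p,
        forall w, ar s' DEG w = if w == p then ar s DEG p - 1 else if w == v then 0 else ar s DEG w &
        forall w, ar s' NSUM w = if w == p then ar s NSUM p - v else if w == v then 0 else ar s NSUM w]).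
Proof.
move=> [c0 c1 c2] Ev Ep vp.
have pv : (val p == val v) = false by rewrite val_eqE eq_sym (negPf vp).
by rewrite /spec /= Ev Ep c1 c2 pv.
Qed.

Lemma merge_labels_spec s (v p : V) : consts n s -> rg s rv = v -> rg s ru = p ->
  spec merge_labels s 40 (fun s' =>
    (forall w, ar s' LAB w = if (w == p) && (ar s LAB p == 0) then ar s LAB v else ar s LAB w) /\
    (rg s' rf = 0 <-> [/\ rg s rf = 0, ar s LAB v <> 0 &
             ar s LAB p = 0 \/ ar s LAB p = ar s LAB v])).
Proof.
move=> [c0 c1 c2] Ev Ep; rewrite /spec /= Ev Ep.
case: (ar s LAB p =P 0) => lp; case: (ar s LAB v =P 0) => lv /=; split=> //; split;
  try (by move=> w; rewrite ?andbT ?andbF); rewrite ?c1; split; try (by case; lia);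
  move=> H; split; lia.
Qed.

Lemma use_edge_spec s (v p : V) : consts n s -> rg s rv = v -> rg s ru = p -> v != p ->
  spec use_edge s 80 (fun s' =>
    [/\ forall w, ar s' USED w = ar s USED w + (w == v) + (w == p),
        forall w, ar s' LAB w = if (w == p) && (ar s LAB p == 0) then ar s LAB v else ar s LAB w &
        rg s' rf = 0 <-> [/\ rg s rf = 0, ar s LAB v <> 0 &
             ar s LAB p = 0 \/ ar s LAB p = ar s LAB v]]).
Proof.
move=> [c0 c1 c2] Ev Ep vp.
have pv : (val p == val v) = false by rewrite val_eqE eq_sym (negPf vp).
do 6!(apply: spec_cons => //=).
apply: (spec_weaken (spec_with_frame (@merge_labels_spec _ v p _ _ _))) => //=.
move=> s' [[L R] fr]; rewrite /= in L R; split=> // w.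
rewrite (proj2 fr) //= Ev Ep c1 pv.
have [->|] := eqVneq w (val p); first by rewrite pv addn0.
by have [->|] := eqVneq w (val v) => //=; rewrite !addn0.
Qed.

Lemma peel_leaf_spec s (v p : V) : consts n s -> rg s rv = v -> ar s NSUM v = p -> v != p ->
  spec peel_leaf s 180 (fun s' =>
    [/\ forall w, ar s' DEG w = if w == p then ar s DEG p - 1 else if w == v then 0 else ar s DEG w,
        forall w, ar s' NSUM w = if w == p then ar s NSUM p - v else if w == v then 0 else ar s NSUM w &
     if ar s DEM v <= ar s USED v then
       [/\ ar s' USED = ar s USED, ar s' LAB = ar s LAB & rg s' rf = rg s rf]
     else
       [/\ forall w, ar s' USED w = ar s USED w + (w == v) + (w == p),
           forall w, ar s' LAB w = if (w == p) && (ar s LAB p == 0) then ar s LAB v else ar s LAB w &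
           rg s' rf = 0 <-> [/\ rg s rf = 0, ar s LAB v <> 0 &
             ar s LAB p = 0 \/ ar s LAB p = ar s LAB v]]]).
Proof.
move=> cs Ev Ep vp; have [c0 c1 c2] := cs.
apply: (@spec_seq _ _ _ _ 60 120) => //.
apply: spec_weaken (spec_with_frame (remove_edge_spec cs Ev Ep vp)) (leqnn _) _.
move=> s1 [[E1 D1 N1] fr1].
have [U1 L1 M1] : [/\ ar s1 USED = ar s USED, ar s1 LAB = ar s LAB & ar s1 DEM = ar s DEM].
  by split; rewrite (proj2 fr1).
have [Ev1 R1] : rg s1 rv = v /\ rg s1 rf = rg s rf by split; rewrite (proj1 fr1).
do 3!(apply: spec_cons => //=).
apply: spec_if => //=; rewrite Ev1 U1 M1 -?lt0n ?subn_gt0 => du; last first.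
  by split=> //=; move/eqP: du; rewrite subn_eq0 => ->.
rewrite leqNgt du /=; set s2 := setr _ _ _.
have cs2 : consts n s2 by split; rewrite /= (proj1 fr1).
apply: (spec_weaken (spec_with_frame (use_edge_spec cs2 Ev1 E1 vp))) => //.
move=> s3 [[U3 L3 R3] fr2]; rewrite /= U1 L1 R1 in U3 L3 R3.
by split=> // w; rewrite (proj2 fr2) //= ?D1 ?N1.
Qed.

End Peeling.

Section PeelLoop.
Variables (n : nat) (e : rel 'I_n).
Hypothesis fe : forest e.
Local Notation V := 'I_n.
Variable c : V -> nat.
Hypothesis c_neq0 : forall v, c v != 0.

Definition same_edge (v p u w : V) := (u == v) && (w == p) || (u == p) && (w == v).

Lemma same_edge_sym v p u w : same_edge v p u w = same_edge v p w u.
Proof. by rewrite /same_edge orbC andbC [in X in _ || X]andbC. Qed.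

Lemma card_rel_add (A B : pred V) p : ~~ A p -> (forall w, B w = A w || (w == p)) ->
  #|B| = #|A| + 1.
Proof.
move=> Ap BE; rewrite -!sum1_card -(sum_pred1 (fun=> 1) Ap); apply: eq_bigl => w.
exact: BE.
Qed.

Lemma peel_step (r F : rel V) (s s' : state) (v p : V) :
  peeling e r F s -> labels_sound e c F s -> labels_complete e c r F s ->
  (forall u : V, ar s DEM u = demand e u) ->
  ar s DEG v = 1 -> r v p -> v != p ->
  [/\ forall w, ar s' DEG w = if w == p then ar s DEG p - 1 else if w == v then 0 else ar s DEG w,
        forall w, ar s' NSUM w = if w == p then ar s NSUM p - v else if w == v then 0 else ar s NSUM w &
     if ar s DEM v <= ar s USED v then
       [/\ ar s' USED = ar s USED, ar s' LAB = ar s LAB & rg s' rf = rg s rf]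
     else
       [/\ forall w, ar s' USED w = ar s USED w + (w == v) + (w == p),
           forall w, ar s' LAB w = if (w == p) && (ar s LAB p == 0) then ar s LAB v else ar s LAB w &
           rg s' rf = 0 <-> [/\ rg s rf = 0, ar s LAB v <> 0 &
             ar s LAB p = 0 \/ ar s LAB p = ar s LAB v]]] ->
  exists r' F', [/\ peeling e r' F' s', labels_sound e c F' s', labels_complete e c r' F' s' &
    #|[set q | r' q.1 q.2]| + 2 <= #|[set q | r q.1 q.2]|].
Proof.
move=> [[rs Fs] re Fe [D N U]] [snd1 snd2] cmp DE Dv rvp vp [D' N' rest].
have pv : (p == v) = false by rewrite eq_sym (negPf vp).
have onlyp w : r v w -> w = p.
  have /card1P[z Ez] : #|r v| == 1 by rewrite -D Dv.
  by move=> vw; move: (Ez w) (Ez p); rewrite !in_rel vw rvp !inE => /esym/eqP-> /esym/eqP->.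
pose r' : rel V := fun u w => r u w && ~~ same_edge v p u w.
pose b := ar s USED v < ar s DEM v.
pose F' : rel V := fun u w => F u w || (b && same_edge v p u w).
have nFvp : F v p = false by apply/negP => /Fe; rewrite rvp andbF.
have nFpv : F p v = false by rewrite Fs.
have r'v w : r' v w = false.
  rewrite /r'; case vw: (r v w) => //=.
  by rewrite /same_edge (onlyp w vw) !eqxx.
have r'p w : r' p w = r p w && (w != v).
  by rewrite /r' /same_edge eqxx pv.
have r'o u w : u != v -> u != p -> r' u w = r u w.
  by move=> uv up; rewrite /r' /same_edge (negPf uv) (negPf up) andbT.
have rpv : r p v by rewrite rs.
have F'v w : F' v w = F v w || (b && (w == p)).
  by rewrite /F' /same_edge eqxx (negPf vp) orbF.
have F'p w : F' p w = F p w || (b && (w == v)).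
  by rewrite /F' /same_edge eqxx pv.
have F'o u w : u != v -> u != p -> F' u w = F u w.
  by move=> uv up; rewrite /F' /same_edge (negPf uv) (negPf up) andbF orbF.
have cardF (u : V) : #|F' u| = #|F u| + (b && (u == v)) + (b && (u == p)).
  have [->|uv] := eqVneq u v.
    rewrite (negPf vp) andbF addn0 andbT; case B: b; last first.
      by rewrite addn0; apply: eq_card => w; rewrite !in_rel F'v B orbF.
    by apply: (@card_rel_add _ _ p) => [|w]; rewrite ?nFvp // F'v B.
  have [->|up] := eqVneq u p.
    rewrite andbF addn0 andbT; case B: b; last first.
      by rewrite addn0; apply: eq_card => w; rewrite !in_rel F'p B orbF.
    by apply: (@card_rel_add _ _ v) => [|w]; rewrite ?nFpv // F'p B.
  by rewrite !andbF !addn0; apply: eq_card => w; rewrite !in_rel F'o.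
exists r', F'; split.
- split.
  + by split=> u w; [rewrite /r' rs|rewrite /F' Fs]; rewrite same_edge_sym.
  + by move=> u w /andP[/re].
  + move=> u w /orP[/Fe/andP[-> nr]|/andP[_ se]]; first by rewrite /r' (negPf nr).
    rewrite /r' se andbF andbT.
    by case/orP: se => /andP[/eqP-> /eqP->]; apply: re.
  split=> u.
  + rewrite D'; have [Eu|nu] := eqVneq (val u) p.
      have -> : u = p by apply: val_inj.
      rewrite D (@card_rel_add (r' p) (r p) v) ?addnK //.
        by rewrite r'p eqxx andbF.
      by move=> w; rewrite r'p; have [->|_] := eqVneq w v; rewrite ?rpv ?orbF ?andbT.
    have [Eu|nv] := eqVneq (val u) v.
      have -> : u = v by apply: val_inj.
      by rewrite eq_card0 // => w; rewrite in_rel r'v.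
    by rewrite D; apply: eq_card => w; rewrite !in_rel r'o.
  + rewrite N'; have [Eu|nu] := eqVneq (val u) p.
      have -> : u = p by apply: val_inj.
      rewrite N (eq_bigl (fun w => r' p w || (w == v))); last first.
        by move=> w; rewrite r'p; have [->|_] := eqVneq w v; rewrite ?rpv ?orbF ?andbT.
      by rewrite (sum_pred1 (fun w => val w)) ?addnK // r'p eqxx andbF.
    have [Eu|nv] := eqVneq (val u) v.
      have -> : u = v by apply: val_inj.
      by rewrite big1 // => w; rewrite r'v.
    by rewrite N; apply: eq_bigl => w; rewrite r'o.
  + rewrite cardF -U; move: rest; rewrite leqNgt -/b; case B: b => /=.
      by case=> -> _ _; rewrite !val_eqE.
    by case=> -> _ _; rewrite !addn0.
- split.
    move=> u du; have Lu := snd1 u du; have cu := c_neq0 u.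
    move: rest; case: ifP => _ [_ L' _]; rewrite L' //.
    case: eqP => [Eu|//] /=; case: eqP => // Lp.
    by move: cu; rewrite -Lu Eu Lp.
  move: rest; rewrite leqNgt -/b; case B: b => /= -[_ L' R'].
    move=> /R'[R0 Lv Lp] u w.
    have keep z : ar s LAB (z : V) <> 0 -> ar s' LAB z = ar s LAB z.
      by move=> Lz; rewrite L'; case: eqP => [Ez|//] /=; case: eqP => // Lp0; case: Lz; rewrite Ez.
    have Lp' : ar s' LAB p = ar s LAB v.
      by rewrite L' eqxx /=; case: eqP => // Lp0; case: Lp.
    rewrite /F' B /= => /orP[Fuw|].
      have [E nz] := snd2 R0 u w Fuw.
      by rewrite !keep // -E.
    by case/orP=> /andP[/eqP-> /eqP->]; rewrite Lp' keep.
  by rewrite R' L' => R0 u w; rewrite /F' B orbF; apply: snd2.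
- move=> F0 lab0 bF; have [R0 FE L0 LF] := cmp F0 lab0 bF.
  have [F0s F0e F0d F0l F0c] := bF.
  (* All other edges at [v] are gone, so [F0] has [#|F v|] edges there, plus possibly the current
     one. *)
  have bE : b = F0 v p.
    have : demand e v = #|F v| + F0 v p.
      rewrite -F0d; case B: (F0 v p); last first.
        rewrite addn0; apply: eq_card => w; rewrite !in_rel FE.
        case F0vw: (F0 v w) => //=; apply/esym/negP => /onlyp E.
        by rewrite -E F0vw in B.
      apply: (@card_rel_add _ _ p) => [|w]; first by rewrite nFvp.
      rewrite FE; have [->|wp] := eqVneq w p; first by rewrite B orbT.
      rewrite orbF; case F0vw: (F0 v w) => //=; apply/esym/negP => /onlyp E.
      by rewrite E eqxx in wp.
    by rewrite /b DE U => ->; case: (F0 v p); [rewrite addn1 ltnSn|rewrite addn0 ltnn].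
  have FE' u w : F' u w = F0 u w && ~~ r' u w.
    rewrite /F' /r' FE bE negb_and negbK andb_orr; congr (_ || _).
    rewrite /same_edge; apply/andP/andP => -[A B]; split=> //.
      by case/orP: B => /andP[/eqP-> /eqP->] //; rewrite F0s.
    by case/orP: B A => /andP[/eqP-> /eqP->] //; rewrite F0s.
  case B: b; move: rest; rewrite leqNgt -/b B /= => -[_ L' R']; last first.
    rewrite R' L'; split=> // u; rewrite cardF B /= !addn0; exact: LF.
  (* Either [v] has a used edge and thus a label, or the current edge is its only one in [F0], so
     that [v] has demand 1 and was labelled at the outset. *)
  have Lv : ar s LAB v <> 0.
    have [Fv0|] := posnP #|F v|; last exact: LF.
    have dv : demand e v = 1.
      rewrite -F0d; apply/eqP/card1P; exists p => w; rewrite in_rel inE.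
      have [->|wp] := eqVneq w p; first by rewrite -bE.
      apply/negP => F0vw; have : w \in F v.
        by rewrite in_rel FE F0vw; apply/negP => /onlyp E; rewrite E eqxx in wp.
      by rewrite (card0_eq Fv0).
    by rewrite snd1 //; apply/eqP.
  have F0vp : F0 v p by rewrite -bE.
  have Lp : ar s LAB p = 0 \/ ar s LAB p = ar s LAB v.
    have [|/eqP Lp] := eqVneq (ar s LAB p) 0; [by left|right].
    by rewrite (L0 _ Lp) (L0 _ Lv) (F0l _ _ F0vp).
  split=> //; first by apply/R'.
    move=> u; rewrite L'; case: eqP => [Eu|_] /=; last exact: L0.
    have -> : u = p by apply: val_inj.
    by case: eqP => [_ _|_]; [rewrite (L0 _ Lv) (F0l _ _ F0vp)|apply: L0].
  move=> u Fu; rewrite L'; case: eqP => [Eu|nu] /=.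
    have -> : u = p by apply: val_inj.
    by case: eqP.
  have [->|uv] := eqVneq u v; first exact: Lv.
  apply: LF; move: Fu; rewrite cardF (negPf uv) (_ : (u == p) = false) ?andbF ?addn0 //.
  by apply/eqP => E; apply: nu; rewrite E.
- rewrite (cardsD1 (v, p) [set q | r q.1 q.2]) inE rvp.
  rewrite (cardsD1 (p, v) ([set q | r q.1 q.2] :\ (v, p))) !inE rpv xpair_eqE pv /=.
  rewrite addnC addnA leq_add2l; apply: subset_leq_card; apply/subsetP=> -[u w].
  rewrite !inE /= /r' /same_edge negb_or !xpair_eqE => /andP[-> /andP[n1 n2]].
  by rewrite n1 n2.
Qed.

Lemma deg_one_exists (r : rel V) u w : symmetric r -> subrel r e -> r u w -> exists v, #|r v| = 1.
Proof.
move=> rs re uw; apply: NNPP => no.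
have uX : u \in [set x | 0 < #|r x|] by rewrite inE; apply/card_gt0P; exists w.
apply: (forest_low_degree fe uX) => x; rewrite inE => x0.
have x1 : #|r x| <> 1 by move=> E; apply: no; exists x.
have : 1 < #|r x| by lia.
case/card_gt1P=> [y [z []]]; rewrite !in_rel => xy xz yz.
exists y, z; split; rewrite ?inE //; try exact: re.
- by apply/card_gt0P; exists x; rewrite in_rel rs.
- by apply/card_gt0P; exists x; rewrite in_rel rs.
Qed.

Lemma peel_spec s : consts n s ->
  (forall v : V, ar s DEG v = deg e v) -> (forall v : V, ar s NSUM v = \sum_(w | e v w) w) ->
  (forall v : V, ar s DEM v = demand e v /\
      ar s LAB v = if demand e v == 1 then c v else 0) ->
  (forall v, ar s USED v = 0) ->
  spec peel s (10 + n * (300 + n * 30)) (fun s' =>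
    exists F, [/\ forall v : V, ar s' USED v = #|F v|, symmetric F /\ subrel F e,
      labels_sound e c F s' &
      forall F0 lab0, balanced_factor e F0 lab0 c -> rg s' rf = 0 /\ forall u v, F u v = F0 u v]).
Proof.
move=> [c0 c1 c2] D S DL U0; apply: spec_cons => //=.
have es := forest_sym fe.
(* There are at most [2 * n] ordered edges, and each round removes both orientations of one, so [n]
   rounds suffice. *)
apply: (@spec_for (fun t s' => exists r F, [/\ peeling e r F s', labels_sound e c F s',
    labels_complete e c r F s' & #|[set q | r q.1 q.2]| <= 2 * (n - t)])
  _ _ _ _ _ (250 + n * 30)) => //=.
- exists e, (fun _ _ => false); split.
  + split=> //; split=> // v.
    by rewrite U0 eq_card0.
  + by split=> // v dv; have [_ ->] := DL v; rewrite dv.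
  + move=> F0 lab0 [_ F0e _ _ F0c]; split=> //=.
    * by move=> u v; case F0uv: (F0 u v) => //=; rewrite (F0e _ _ F0uv).
    * by move=> v; have [_ ->] := DL v; case: eqP => // dv _; rewrite F0c.
    * by move=> v; rewrite eq_card0.
  + by rewrite subn0; apply: card_edges.
- rewrite c0 => t s' tn [r [F [P SN CM cr]]] fr.
  have cs' : consts n (setr s' rr t) by split; rewrite /= (proj1 fr).
  have DE' (u : V) : ar s' DEM u = demand e u.
    by rewrite (proj2 fr) //=; have [] := DL u.
  apply: (@spec_seq _ _ _ _ (10 + n * 30) 240); last by lia.
  apply: (spec_weaken (spec_with_frame (find_leaf_spec cs'))) => // s1 [found fr1].
  have [[rs Fs] re Fe [Dr Nr Ur]] := P.
  have R1 : rg s1 rf = rg s' rf by rewrite (proj1 fr1).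
  have A1 j : ar s1 j = ar s' j by rewrite (proj2 fr1).
  have cs1 : consts n s1 by case: cs' => ? ? ?; split; rewrite (proj1 fr1).
  apply: spec_if => // [b1|b0]; last first.
    split=> //=; exists r, F.
    have r0 u w : r u w = false.
      apply/negP => uw; have [v v1] := deg_one_exists rs re uw.
      case: found => [[_ /(_ v)]|[b1 _]]; last by rewrite b1 in b0.
      by rewrite A1 Dr v1.
    split.
    + by split=> //; split=> v; rewrite /= A1.
    + by case: SN => SN1 SN2; split; rewrite /= ?R1 A1.
    + by move=> F0 lab0 /CM; rewrite /= R1 A1.
    + by rewrite eq_card0 // => q; rewrite inE r0.
  case: found => [[b0]|[_ [v [Ev Dv]]]]; first by rewrite b0 in b1.
  have P1 : peeling e r F s1 by split=> //; split=> v'; rewrite A1.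
  have /card1P[p Ep] : #|r v| == 1 by rewrite -Dr -A1 Dv.
  have rvp : r v p by have := Ep p; rewrite in_rel inE eqxx.
  have vp : v != p by apply: (forest_neq fe); apply: re.
  have Np : ar s1 NSUM v = p.
    have E : r v =1 pred1 p by move=> w; have := Ep w; rewrite in_rel.
    by rewrite A1 Nr (eq_bigl _ _ E) big_pred1_eq.
  apply: (spec_weaken (peel_leaf_spec cs1 Ev Np vp)) => // s2 post.
  have [|||r' [F' [P2 S2 C2 cr']]] := peel_step P1 _ _ _ Dv rvp vp post.
  + by case: SN => SN1 SN2; split; rewrite ?R1 A1.
  + by move=> F0 lab0 /CM; rewrite R1 A1.
  + by move=> u; rewrite A1.
  + exists r', F'; split=> //.
    have aux a : a + 2 <= 2 * (n - t) -> a <= 2 * (n - t.+1) by lia.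
    by apply: aux; apply: leq_trans cr' cr.
- by rewrite c0; lia.
- rewrite c0 => s' [r [F [[[rs Fs] re Fe [Dr Nr Ur]] SN CM cr]]] fr; exists F.
  have r0 u w : r u w = false.
    apply/negP => uw; move: cr; rewrite subnn muln0 leqn0 cards_eq0 => /eqP/setP/(_ (u, w)).
    by rewrite !inE uw.
  split=> //; first by split=> // u w /Fe/andP[].
  by move=> F0 lab0 /CM[R FE _ _]; split=> // u v; rewrite FE r0 andbT.
Qed.

Lemma verdict_spec s F : consts n s -> (forall v : V, ar s DEM v = demand e v) ->
  (forall v : V, ar s USED v = #|F v|) -> symmetric F -> subrel F e ->
  labels_sound e c F s ->
  (forall F0 lab0, balanced_factor e F0 lab0 c -> rg s rf = 0 /\ forall u v, F u v = F0 u v) ->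
  spec verdict s (10 + n * 40) (fun s' =>
    rg s' rn <= 1 /\ (rg s' rn = 1 <-> exists F lab, balanced_factor e F lab c)).
Proof.
move=> [c0 c1 c2] DE US Fs Fe [sn1 sn2] cmp.
apply: (@spec_seq _ _ _ _ (5 + n * 37) 5); last by lia.
apply: (@spec_for (fun k s' => rg s' rf = 0 <-> rg s rf = 0 /\
    forall v : V, v < k -> ar s DEM v = ar s USED v) _ _ _ _ _ 30) => //=.
- by split=> [->|[]].
- rewrite c0 => k s' kn I fr; split=> //=; rewrite !(proj2 fr) //.
  split=> [E|[E1 E2]].
    have [R0 H] : rg s rf = 0 /\ forall v : V, v < k -> ar s DEM v = ar s USED v by apply/I; lia.
    split=> // v; rewrite ltnS leq_eqVlt => /orP[/eqP->|/H //]; lia.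
  have -> : rg s' rf = 0 by apply/I; split=> // v vk; apply: E2; apply: ltnW.
  by have := E2 (Ordinal kn) (ltnSn k) => /= ->; lia.
- by rewrite c0; lia.
- rewrite c0 => s' I fr.
  have key : rg s' rf = 0 <-> exists F lab, balanced_factor e F lab c.
    split=> [/I[R0 H]|[F0 [lab0 bF]]].
      exists F, (fun v : V => ar s LAB v); split=> //.
      - by move=> v; rewrite -US -H // DE.
      - by move=> u v /(sn2 R0)[].
    have [R0 FE] := cmp F0 lab0 bF; apply/I; split=> // v _.
    have [_ _ F0d _ _] := bF.
    rewrite DE US -F0d; apply: eq_card => w; by rewrite !in_rel FE.
  apply: spec_if => // [R1|R0]; split=> //=; split=> //.
    by split=> // /key E; rewrite E in R1.
  by split=> // _; apply/key.
Qed.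

End PeelLoop.

(** * The program *)

Definition algorithm : cmd :=
  read_edges ;; powers ;; refine ;; count_leaves ;; demands ;; peel ;; verdict.

Definition move_cell (j : nat) : cmd :=
  CGet 24 j 23 ;; CPut j 23 rzero ;;
  CAdd 25 23 23 ;; CAdd 25 25 25 ;; CAdd 25 25 25 ;; CAdd 25 25 25 ;;
  CConst 26 (64 + j) ;; CAdd 25 25 26 ;; CPut ADJ 25 24.

Fixpoint move_cells (j : nat) : cmd :=
  if j is j'.+1 then move_cell j' ;; move_cells j' else skip.

(* The input occupies cells 1 to [n * n]: cell [a >= 64] is copied to entry [a]
   of the array [ADJ], that is to a higher cell, and erased, going downwards;
   the contents of the cells below 64 are known constants [bits]. *)
Definition relocate : cmd :=
  CConst 20 0 ;; CFor 21 rn (CAdd 20 20 rn) ;;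
  CAdd 22 20 rone ;; CFor 21 22 (CSub 23 20 21 ;; move_cells 16).

(** [bits] is indexed by cell numbers; its entry 0 is a dummy, as cell 0 holds [n]. *)
Fixpoint write_bits (bits : seq nat) (a : nat) : cmd :=
  if a is a'.+1 then
    CConst 23 a ;; CConst 24 (nth 0 bits a) ;; CPut ADJ 23 24 ;; write_bits bits a'
  else skip.

Definition main_cmd (bits : seq nat) : cmd :=
  CConst rone 1 ;; CConst rzero 0 ;; relocate ;; write_bits bits 63 ;; algorithm.

Definition leaf_program (bits : seq nat) (off : nat) : program :=
  compile 0 off (main_cmd bits) ++ [:: IHalt].

(* Cells 1 to 63 hold bits; a decision tree reads them, so that they can be used
   as registers afterwards. *)
Fixpoint tree (k : nat) (bits : seq nat) (off : nat) : program :=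
  if k is k'.+1 then
    let t1 := tree k' (1 :: bits) off.+1 in
    IJz k (off.+1 + size t1) :: t1 ++ tree k' (0 :: bits) (off.+1 + size t1)
  else leaf_program (0 :: bits) off.

Lemma tree_correct P m k bits off : code_at P off (tree k bits off) ->
  (forall a, 1 <= a <= k -> m a <= 1) ->
  exists off', code_at P off' (leaf_program (0 :: [seq m a | a <- iota 1 k] ++ bits) off') /\
    run P k (off, m) = (off', m).
Proof.
elim: k bits off => [|k IH] bits off; first by move=> H _; exists off.
move=> /code_at_cons[h /code_at_cat[h1 h2]] mb.
have mb' a : 1 <= a <= k -> m a <= 1 by move=> ak; apply: mb; lia.
have -> : iota 1 k.+1 = iota 1 k ++ [:: k.+1] by rewrite -[k.+1]addn1 iotaD addn1.
rewrite map_cat -catA -[X in run P X _]add1n.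
have mk : m k.+1 <= 1 by apply: mb; lia.
case E: (m k.+1) mk => [|[|//]] _.
- have [off' [hl r]] := IH (0 :: bits) _ h2 mb'.
  exists off'; split; first by rewrite /= E.
  by apply: run_trans _ r; apply: run_one; rewrite /step /fetch h E.
- have [off' [hl r]] := IH (1 :: bits) _ h1 mb'.
  exists off'; split; first by rewrite /= E.
  by apply: run_trans _ r; apply: run_one; rewrite /step /fetch h E.
Qed.

Lemma main_wf bits : wf 0 (main_cmd bits).
Proof. by []. Qed.

Section Relocation.
Variable f : nat -> nat.

(** Entry [i] of [ADJ] lies in cell [64 + 16 * i], above cell [i], so it is already vacated when
    cell [i] is moved. *)
Definition relocating (A : nat) (s : state) : Prop :=
  forall j i, j < 16 -> ar s j i =
    if 64 + 16 * i + j < A then f (64 + 16 * i + j)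
    else if (j == 0) && (A <= i) then f i else 0.

Lemma move_cell_spec s j i : j < 16 -> rg s 23 = i -> rg s rzero = 0 ->
  relocating (64 + 16 * i + j).+1 s ->
  spec (move_cell j) s 60 (relocating (64 + 16 * i + j)).
Proof.
move=> j16 Ei c2 R; set c := 64 + 16 * i + j in R *.
rewrite /spec /= Ei c2 R // ltnSn.
have -> : i + i + (i + i) + (i + i + (i + i)) + (i + i + (i + i) + (i + i + (i + i))) + (64 + j) = c.
  by rewrite /c; lia.
split=> // j' i' j16' /=; set c' := 64 + 16 * i' + j'.
have [Ej|nj] := eqVneq j' 0.
  have c'E : 64 + 16 * i' + 0 = c' by rewrite /c' Ej.
  have [Ei'|ni] := eqVneq i' c.
    have -> : (c' < c) = false by rewrite /c' Ei'; lia.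
    by rewrite Ei' leqnn.
  have le_c : (c <= i') = (c < i') by rewrite leq_eqVlt eq_sym (negPf ni).
  have [Ejj|njj] := eqVneq 0 j.
    rewrite -Ejj; have [Ei'|nii] := eqVneq i' i.
      have -> : (c' < c) = false by rewrite /c' /c Ei' Ej -Ejj ltnn.
      by have -> : (c <= i') = false by rewrite Ei' /c; lia.
    rewrite R // c'E.
    have c'c : c' != c by rewrite /c' /c; apply/eqP; move/eqP: nii; lia.
    rewrite ltnS leq_eqVlt (negPf c'c) /= ?eqxx /=.
    by rewrite le_c.
  rewrite R // c'E.
  have c'c : c' != c by rewrite /c' /c; apply/eqP; move/eqP: njj; lia.
  rewrite ltnS leq_eqVlt (negPf c'c) /= ?eqxx /=.
  by rewrite le_c.
have [Ejj|njj] := eqVneq j' j.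
  have [Ei'|nii] := eqVneq i' i.
    by have -> : (c' < c) = false by rewrite /c' /c Ei' Ejj ltnn.
  rewrite -Ejj R // -/c' (negPf nj) /=.
  have c'c : c' != c by rewrite /c' /c; apply/eqP; move/eqP: nii; lia.
  by rewrite ltnS leq_eqVlt (negPf c'c).
rewrite R // -/c' (negPf nj) /=.
have c'c : c' != c by rewrite /c' /c; apply/eqP; move/eqP: njj; lia.
by rewrite ltnS leq_eqVlt (negPf c'c).
Qed.

Lemma move_cells_spec s j i : j <= 16 -> rg s 23 = i -> rg s rzero = 0 ->
  relocating (64 + 16 * i + j) s ->
  spec (move_cells j) s (1 + j * 60) (relocating (64 + 16 * i)).
Proof.
elim: j s => [|j IH] s j16 Ei c2 R; first by split=> //=; rewrite addn0 in R.
apply: (@spec_seq _ _ _ _ 60 (1 + j * 60)); last by lia.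
rewrite addnS in R.
apply: (spec_weaken (spec_with_frame (move_cell_spec j16 Ei c2 R))) => // s' [R' fr].
by apply: IH => //; [apply: ltnW|rewrite (proj1 fr)|rewrite (proj1 fr)].
Qed.

Lemma relocate_spec n s : consts n s -> (forall a, n * n < a -> f a = 0) ->
  (forall j i, j < 16 -> ar s j i = f (64 + 16 * i + j)) ->
  spec relocate s (20 + n * 8 + (n * n).+1 * 1000) (relocating 64).
Proof.
move=> [c0 c1 c2] f0 A0; apply: spec_cons => //=.
apply: (@spec_seq _ _ _ _ (5 + n * 8) (10 + (n * n).+1 * 1000)); last by lia.
apply: (@spec_for (fun k s' => rg s' 20 = k * n) _ _ _ _ _ 1) => //=.
- rewrite c0 => k s' kn E fr; split=> //=.
  by rewrite E (proj1 fr) //= c0 mulSn addnC.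
- by rewrite c0.
rewrite c0 => s1 E1 fr1; apply: spec_cons => //=.
have c1' : rg s1 rone = 1 by rewrite (proj1 fr1).
rewrite E1 c1' addn1.
(* Treating the indices from [n * n] down to 0 in all sixteen arrays covers the input, since the
   cells above [n * n] are zero. *)
apply: (@spec_for (fun k s' => relocating (64 + 16 * ((n * n).+1 - k)) s') _ _ _ _ _ 970) => /=.
- move=> j i j16 /=; rewrite (proj2 fr1) //= A0 // subn0.
  case: ifP => // big; rewrite f0; last by lia.
  by case: ifP => // /andP[_ le]; rewrite f0 //; lia.
- move=> k s' kn R fr; apply: spec_cons => //=.
  rewrite (proj1 fr) //= E1.
  apply: (spec_weaken (@move_cells_spec _ 16 (n * n - k) _ _ _ _)) => //=.
  + by rewrite (proj1 fr) //= (proj1 fr1).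
  + by move: R; rewrite (_ : 64 + 16 * ((n * n).+1 - k) = 64 + 16 * (n * n - k) + 16) //; lia.
- by lia.
- by move=> s'; rewrite subnn muln0 addn0.
Qed.

End Relocation.

Lemma write_bits_spec bits s a : spec (write_bits bits a) s (1 + a * 9) (fun s' =>
  (forall x, ar s' ADJ x = if 1 <= x <= a then nth 0 bits x else ar s ADJ x) /\
  forall j, j != ADJ -> ar s' j = ar s j).
Proof.
elim: a s => [|a IH] s.
  by split=> //=; split=> // x; case: x.
do 3!(apply: spec_cons => //=).
apply: (spec_weaken (IH _)) => //=.
move=> s' [H1 H2]; split=> [x|j j0]; last by rewrite H2 //= (negPf j0).
rewrite H1 /=; have [->|xa] := eqVneq x a.+1; first by rewrite ltnn andbF leqnn.
have -> : (x <= a.+1) = (x <= a) by rewrite leq_eqVlt (negPf xa).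
by [].
Qed.

(** * Total running time and correctness *)

Section Correctness.
Variables (n : nat) (e : rel 'I_n).
Hypothesis fe : forest e.
Local Notation V := 'I_n.

Definition algorithm_time :=
  100 + n * 700 + n * n * 300.

Lemma algorithm_spec s : consts n s -> adj_input e s ->
  (forall j, 0 < j < 16 -> forall i, ar s j i = 0) ->
  spec algorithm s algorithm_time (fun s' =>
    rg s' rn <= 1 /\ (rg s' rn = 1 <-> iso_unique_zf e)).
Proof.
move=> cs adj z.
apply: (@spec_seq _ _ _ _ (7 + n * (12 + n * 67)) (90 + n * 688 + n * n * 230)); last first.
  by rewrite /algorithm_time; nia.
apply: (spec_weaken (spec_with_frame (read_edges_spec cs adj _ _))) => // [v|v|]; try exact: z.
move=> s1 [[[L eL] D1 N1] fr1].
have cs1 : consts n s1 by case: cs => ? ? ?; split; rewrite (proj1 fr1).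
have m1 : rg s1 rm <= 2 * n.
  have [uL mL <- _] := eL; rewrite -(card_uniqP uL); apply: leq_trans (card_edges fe).
  by apply: subset_leq_card; apply/subsetP=> q; rewrite mL inE.
apply: (@spec_seq _ _ _ _ (14 + n * (21 + n * 8)) (76 + n * 667 + n * n * 222)); last by nia.
apply: (spec_weaken (spec_with_frame (powers_spec cs1))) => // s2 [[W2 P2] fr2].
have cs2 : consts n s2 by case: cs1 => ? ? ?; split; rewrite (proj1 fr2).
have m2 : rg s2 rm = rg s1 rm by rewrite (proj1 fr2).
have eL2 : edges_read e s2 L.
  case: eL => uL mL sL [U1 U2]; split=> //; first by rewrite m2.
  by split=> q qL; rewrite (proj2 fr2) ?U1 ?U2.
apply: (@spec_seq _ _ _ _ (20 + n * 14 + n * (40 + n * 180)) (56 + n * 613 + n * n * 42)); last by nia.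
apply: (spec_weaken (spec_with_frame (refine_spec cs2 eL2 _ W2 P2 _))) => //.
- by rewrite m2.
- by move=> x; rewrite (proj2 fr2) // (proj2 fr1) // z.
move=> s3 [[col [cr C3 C0]] fr3].
have cs3 : consts n s3 by case: cs2 => ? ? ?; split; rewrite (proj1 fr3).
have m3 : rg s3 rm = rg s1 rm by rewrite (proj1 fr3).
have eL3 : edges_read e s3 L.
  case: eL => uL mL sL [U1 U2]; split=> //; first by rewrite m3.
  by split=> q qL; rewrite (proj2 fr3) // (proj2 fr2) ?U1 ?U2.
have D3 (v : V) : ar s3 DEG v = deg e v by rewrite (proj2 fr3) // (proj2 fr2).
apply: (@spec_seq _ _ _ _ (10 + n * 14 + 2 * n * 60) (46 + n * 479 + n * n * 42)); last by nia.
apply: (spec_weaken (spec_with_frame (count_leaves_spec fe cs3 eL3 _ D3))) => //; first by rewrite m3.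
move=> s4 [N4 fr4].
have cs4 : consts n s4 by case: cs3 => ? ? ?; split; rewrite (proj1 fr4).
apply: (@spec_seq _ _ _ _ (5 + n * 70) (41 + n * 409 + n * n * 42)); last by nia.
apply: (spec_weaken (spec_with_frame (@demands_spec _ _ fe s4 (col n) cs4 _ _ N4 _ _))) => //.
- by move=> v; rewrite (proj2 fr4) // D3.
- by move=> v; rewrite (proj2 fr4) // (proj2 fr3) // (proj2 fr2) // N1.
- by move=> v; rewrite (proj2 fr4) // C3.
- by move=> v; rewrite (proj2 fr4) // (proj2 fr3) // (proj2 fr2) // (proj2 fr1) // z.
move=> s5 [DL5 fr5].
have cs5 : consts n s5 by case: cs4 => ? ? ?; split; rewrite (proj1 fr5).
apply: (@spec_seq _ _ _ _ (10 + n * (300 + n * 30)) (31 + n * 109 + n * n * 12)); last by nia.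
apply: (spec_weaken (spec_with_frame (@peel_spec _ _ fe (col n) C0 s5 cs5 _ _ DL5 _))) => //.
- by move=> v; rewrite (proj2 fr5) // (proj2 fr4) // D3.
- by move=> v; rewrite (proj2 fr5) // (proj2 fr4) // (proj2 fr3) // (proj2 fr2) // N1.
- by move=> v; rewrite (proj2 fr5) // (proj2 fr4) // (proj2 fr3) // (proj2 fr2) // (proj2 fr1) // z.
move=> s6 [[F [U6 [Fs Fe] SN CM]] fr6].
have cs6 : consts n s6 by case: cs5 => ? ? ?; split; rewrite (proj1 fr6).
apply: (spec_weaken (verdict_spec cs6 _ U6 Fs Fe SN CM)).
- by move=> v; rewrite (proj2 fr6) //; have [] := DL5 v.
- by nia.
- move=> s7 [le1 E]; split=> //; apply: (iff_trans E); apply: iff_sym.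
  exact: iso_unique_balanced.
Qed.

Lemma main_spec m bits s : encodes e m ->
  (forall a, 1 <= a <= 63 -> nth 0 bits a = m a) ->
  rg s rn = n -> (forall j i, j < 16 -> ar s j i = m (64 + 16 * i + j)) ->
  spec (main_cmd bits) s (3000 + n * 1000 + n * n * 2000) (fun s' =>
    rg s' rn <= 1 /\ (rg s' rn = 1 <-> iso_unique_zf e)).
Proof.
move=> [m0 [mE mZ]] bE c0 A0; apply: (@spec_seq _ _ _ _ 1 (2999 + n * 1000 + n * n * 2000)); last by lia.
split; first by [].
apply: (@spec_seq _ _ _ _ 1 (2998 + n * 1000 + n * n * 2000)); last by lia.
split; first by [].
set s0 := (exec _ _).1; have cs : consts n s0 by [].
apply: (@spec_seq _ _ _ _ (20 + n * 8 + (n * n).+1 * 1000) (1900 + n * 700 + n * n * 300)); last by nia.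
apply: (spec_weaken (spec_with_frame (@relocate_spec m n _ cs mZ A0))) => // s1 [R1 fr1].
apply: (@spec_seq _ _ _ _ (1 + 63 * 9) (100 + n * 700 + n * n * 300)); last by lia.
apply: (spec_weaken (spec_with_frame (write_bits_spec bits s1 63))) => // s2 [[B1 B2] fr2].
apply: (spec_weaken (@algorithm_spec s2 _ _ _)) => //.
- by case: cs => ? ? ?; split; rewrite (proj1 fr2) // (proj1 fr1).
- move=> i j; rewrite B1 -mE; case: ifP => [a63|a64]; first by rewrite bE.
  by rewrite R1 // ltnNge leq_addr /= ifT //; lia.
- move=> j j16 i; rewrite B2; last by apply/eqP; lia.
  rewrite R1; last by lia.
  by rewrite ltnNge -addnA leq_addr /=; case: j j16.
Qed.

End Correctness.

Lemma encodes_bit n (e : rel 'I_n) m a : encodes e m -> 1 <= a -> m a <= 1.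
Proof.
move=> [_ [mE mZ]] a1; have [/mZ -> //|an] := ltnP (n * n) a.
have n0 : 0 < n by case: (n) an a1 => //; lia.
have an' : a.-1 < n * n by lia.
have q : a.-1 %/ n < n by rewrite ltn_divLR.
have r : a.-1 %% n < n by rewrite ltn_mod.
have := mE (Ordinal q) (Ordinal r); rewrite /= (_ : 1 + _ * n + _ = a).
  by move=> ->; case: (e _ _).
by rewrite -addnA -divn_eq; lia.
Qed.

Lemma halted_at P pc m : nth IHalt P pc = IHalt -> halted P (pc, m).
Proof. by rewrite /halted /fetch /= => ->. Qed.

(* There is a RAM program P and a constant c such that on every forest on n
   vertices, P halts within c * n^2 + c steps and outputs (in cell 0) 1 iff
   the forest is an iso-unique zero forcing graph, and 0 otherwise. *)
Theorem theorem3p12 :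
  exists (P : program) (c : nat),
    forall (n : nat) (e : rel 'I_n), forest e ->
    forall m : memory, encodes e m ->
    exists k, k <= c * n ^ 2 + c /\
      let cf := run P k (0, m) in
      halted P cf /\ cf.2 0 <= 1 /\ (cf.2 0 = 1 <-> iso_unique_zf e).
Proof.
(* The decision tree has [2 ^ 63] leaves; the existential keeps it from being unfolded. *)
have [P codeP] : exists P, code_at P 0 (tree 63 [::] 0) by exists (tree 63 [::] 0).
exists P, 4000 => n e fe m enc.
have [|off [hl r1]] := tree_correct codeP (m := m).
  by move=> a /andP[a1 _]; apply: encodes_bit enc a1.
move: hl; set bits := 0 :: _ => /code_at_cat[hc /code_at_cons[hh _]].
have bE a : 1 <= a <= 63 -> nth 0 bits a = m a.
  case: a => // a /andP[_ a63]; rewrite -[LHS]/(nth 0 ([seq m b | b <- iota 1 63] ++ [::]) a).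
  rewrite cats0 (nth_map 0) ?size_iota //.
  by rewrite nth_iota.
pose s := State m (fun j i => m (64 + 16 * i + j)).
have sm : sim m s by [].
have [T [le1 res]] := main_spec fe enc bE (s := s) (proj1 enc) (fun j i _ => erefl).
have [m' [r2 [sm' _] _]] := compile_correct (isT : 0 <= 12) (main_wf bits) hc sm.
exists (63 + (exec (main_cmd bits) s).2); split.
  apply: leq_trans (leq_add (leqnn 63) T) _; rewrite expnS expn1.
  have : n <= n * n by case: (n) => // k; rewrite leq_pmull.
  by nia.
have m0 := sm' 0 isT; rewrite -m0 in le1 res.
by rewrite (run_trans r1 r2); split; [apply: halted_at|split].
Qed.
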